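(* For every $n\ge 2$, the geodesic complexity of the flat $n$-dimensional Klein bottle satisfies $\mathrm{GC}(K_n,d_K)=2n$.
   Context: Let $e_i$ be the $i$-th standard unit vector of $\mathbb R^n$. Let $\sim$ be the equivalence relation on $\mathbb R^n$ generated by $x\sim x+e_i$ for $1\le i\le n-1$ and $(x_1,\ldots,x_{n-1},x_n)\sim(1-x_1,\ldots,1-x_{n-1},x_n+1)$. The higher Klein bottle is $K_n=\mathbb R^n/\sim$ with quotient map $p:\mathbb R^n\to K_n$ (equivalently $K_n=(S^1)^n/((z_1,\dots,z_{n-1},z_n)\sim(\bar z_1,\dots,\bar z_{n-1},-z_n))$). It carries the flat metric $d_K(y,y')=\min\{d(x,x'):x\in p^{-1}(y),x'\in p^{-1}(y')\}$, $d$ the Euclidean metric. For a metric space $X$, let $PX$ be the space of paths $[0,1]\to X$ (compact-open topology), $GX\subset PX$ the minimal geodesics, i.e. paths $\gamma$ whose length equals $d(\gamma(0),\gamma(1))$, and $\pi:GX\to X\times X$, $\gamma\mapsto(\gamma(0),\gamma(1))$. The geodesic complexity $\mathrm{GC}(X,d)$ is the smallest $k$ such that $X\times X=\bigsqcup_{i=0}^k E_i$ with the $E_i$ pairwise disjoint ENRs each admitting a continuous section $s_i:E_i\to GX$ of $\pi$. *)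

(* Defs.v *)
From Stdlib Require Import Reals Lra Lia Relations ClassicalEpsilon.
Open Scope R_scope.

Definition open_in {X : Type} (d : X -> X -> R) (U : X -> Prop) : Prop :=
  forall x, U x -> exists e, 0 < e /\ forall y, d x y < e -> U y.

Definition rel_open {X : Type} (d : X -> X -> R) (E S : X -> Prop) : Prop :=
  forall x, E x -> S x -> exists e, 0 < e /\ forall y, E y -> d x y < e -> S y.

Definition cont_on {X Y : Type} (dX : X -> X -> R) (dY : Y -> Y -> R)
  (E : X -> Prop) (f : X -> Y) : Prop :=
  forall x, E x -> forall eps, 0 < eps -> exists delta, 0 < delta /\
    forall y, E y -> dX x y < delta -> dY (f x) (f y) < eps.

Definition unit_I (t : R) : Prop := 0 <= t <= 1.

(* a path [0,1] -> X (values outside [0,1] are irrelevant) *)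
Definition is_path {X : Type} (d : X -> X -> R) (g : R -> X) : Prop :=
  cont_on R_dist d unit_I g.

Definition partition (k : nat) (t : nat -> R) : Prop :=
  t 0%nat = 0 /\ t k = 1 /\ forall i, (i < k)%nat -> t i <= t (S i).

Fixpoint psum {X : Type} (d : X -> X -> R) (g : R -> X) (t : nat -> R) (k : nat) : R :=
  match k with
  | O => 0
  | S k' => psum d g t k' + d (g (t k')) (g (t k))
  end.

Definition length_sums {X : Type} (d : X -> X -> R) (g : R -> X) (r : R) : Prop :=
  exists k t, partition k t /\ r = psum d g t k.

Definition min_geodesic {X : Type} (d : X -> X -> R) (g : R -> X) : Prop :=
  is_path d g /\ is_lub (length_sums d g) (d (g 0) (g 1)).

Definition dprod {X : Type} (d : X -> X -> R) (p q : X * X) : R :=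
  Rmax (d (fst p) (fst q)) (d (snd p) (snd q)).

Definition Rn (N : nat) : Type := { x : nat -> R | forall i, (N <= i)%nat -> x i = 0 }.

Fixpoint sumsq (k : nat) (x y : nat -> R) : R :=
  match k with
  | O => 0
  | S k' => sumsq k' x y + (x k' - y k') ^ 2
  end.

Definition eucl (N : nat) (u v : Rn N) : R :=
  sqrt (sumsq N (proj1_sig u) (proj1_sig v)).

Definition ENR {Y : Type} (dY : Y -> Y -> R) (E : Y -> Prop) : Prop :=
  exists (N : nat) (f : Y -> Rn N) (U : Rn N -> Prop) (r : Rn N -> Rn N),
    cont_on dY (eucl N) E f /\
    (forall a b, E a -> E b -> f a = f b -> a = b) /\
    (forall a, E a -> forall eps, 0 < eps -> exists delta, 0 < delta /\
        forall b, E b -> eucl N (f a) (f b) < delta -> dY a b < eps) /\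
    open_in (eucl N) U /\
    (forall a, E a -> U (f a)) /\
    cont_on (eucl N) (eucl N) U r /\
    (forall y, U y -> exists a, E a /\ r y = f a) /\
    (forall a, E a -> r (f a) = f a).

(* s : E -> PX is continuous for the compact-open topology on PX:
   preimages of the subbasic sets {g | g(K) c U} (K c [0,1] compact, U open)
   are open in E. *)
Definition co_continuous {X : Type} (d : X -> X -> R) (E : X * X -> Prop)
  (s : X * X -> R -> X) : Prop :=
  forall (K : R -> Prop) (U : X -> Prop),
    compact K -> (forall t, K t -> unit_I t) -> open_in d U ->
    rel_open (dprod d) E (fun p => forall t, K t -> U (s p t)).

Definition GC_le {X : Type} (d : X -> X -> R) (k : nat) : Prop :=
  exists E : nat -> X * X -> Prop,
    (forall p, exists i, (i <= k)%nat /\ E i p) /\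
    (forall i j p, (i <= k)%nat -> (j <= k)%nat -> E i p -> E j p -> i = j) /\
    (forall i, (i <= k)%nat ->
       ENR (dprod d) (E i) /\
       exists s : X * X -> R -> X,
         (forall p, E i p -> min_geodesic d (s p) /\ s p 0 = fst p /\ s p 1 = snd p) /\
         co_continuous d (E i) s).

Definition GC_eq {X : Type} (d : X -> X -> R) (k : nat) : Prop :=
  GC_le d k /\ forall k', GC_le d k' -> (k <= k')%nat.

(* coordinates are indexed 0..n-1; e_i (1<=i<=n-1) is coordinate i-1 *)
Definition Kgen_raw (n : nat) (x y : nat -> R) : Prop :=
  (exists i, (i < n - 1)%nat /\
     forall j, y j = x j + (if Nat.eqb j i then 1 else 0)) \/
  (forall j, y j = if Nat.ltb j (n - 1) then 1 - x j
                   else if Nat.eqb j (n - 1) then x j + 1 else x j).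

Definition Kgen (n : nat) (u v : Rn n) : Prop := Kgen_raw n (proj1_sig u) (proj1_sig v).

Definition Krel (n : nat) : Rn n -> Rn n -> Prop := clos_refl_sym_trans (Rn n) (Kgen n).

Definition Kn (n : nat) : Type :=
  { P : Rn n -> Prop | exists x, forall z, P z <-> Krel n x z }.

Definition dK (n : nat) (y y' : Kn n) : R :=
  epsilon (inhabits 0)
    (fun m => (exists x x', proj1_sig y x /\ proj1_sig y' x' /\ eucl n x x' = m) /\
              (forall x x', proj1_sig y x -> proj1_sig y' x' -> m <= eucl n x x')).

(* Main.v *)
(** Lower bound. Modulo translations of the last coordinate, the pairs near
    [x = (0,..,0,c)], [y = (1/2,..,1/2,c+1/2)] are parametrised by 2n-1 numbers: the
    difference [h] between the squared lengths of the shortest geodesics of even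
    and of odd parity, and for each horizontal coordinate one deviation for each
    parity. Signs of these numbers decide which of the [2^n] geodesics at the
    centre survive as minimal ones. Grouping the sign patterns of each parity by
    the position of the first minus sign (even parity) or plus sign (odd parity)
    leaves [2n] labels whose regions intersect like the faces of a simplex. A point coloured [i] (by the set [E_i]
    containing it) with label [l] has nearby points where [l] is no longer
    available, and these cannot have colour [i] again; so with at most [2n] colours
    the flags of points shrinking the set of available labels define a bijection
    from colours to labels, which is locally constant along the circle of
    centres. The pairs for [c = 0] and [c = 1] coincide, but going around reflects
    the horizontal coordinates and changes the label of the chosen geodesic.

    Upper bound. Normalise a lift of a pair so that the displacement is minimal.
    The number of boundary conditions met by the normalised lift is upper
    semicontinuous, and on each of its level sets the lift is continuous. There
    are at most [2n] conditions at once, and each level set is a disjoint union of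
    relatively open pieces cut out of an affine subspace, a graph or a quadric. *)

Require Import Defs.
From Stdlib Require Import Reals Lra Lia Relations ClassicalEpsilon ZArith List.
From Stdlib Require Import FunctionalExtensionality PropExtensionality ProofIrrelevance.
From Stdlib Require Import ssreflect.
From mathcomp Require all_boot zify.
Open Scope R_scope.

(** * Flags in simplex-like covers *)

(** Nothing is known about how the sets [E_i] touch each other: continuity of a section only says
    that near a point its colour keeps its label. So the argument has to be a count. Every label
    dropped along a flag costs a colour, and with no colour to spare the record of colour-label
    pairs is rigid. Its independence of the points chosen goes by induction on the number of labels;
    the induction step moves the top point of the flag through the points with a given set of
    labels, which form a convex set. The grouping by first fork serves this count: single geodesics
    are too many in general, while the grouped regions have every non-empty set of labels realised
    near the centre. In the upper bound the obstacle is that a condition must not depend on the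
    lift. When the two parities tie, lifts of opposite parity compete and differences and sums of
    coordinates exchange their roles, so some conditions are also imposed at interior values of the
    domain. The singular point of the quadric receives a condition of its own and thus becomes a
    separate stratum. *)

Module SimplexFlags.
Import all_boot.
Local Open Scope nat_scope.
Set Implicit Arguments.
Unset Strict Implicit.
Unset Printing Implicit Defensive.

Section Flags.

Variables (X : Type) (L C : finType).
Variables (al : X -> {set L}) (lab : X -> L) (col : X -> C).
Variables (Op : (X -> Prop) -> Prop) (B : X -> X -> Prop).

Local Notation meet O O' := (fun x => O x /\ O' x).

Hypothesis OpI : forall O O', Op O -> Op O' -> Op (meet O O').
Hypothesis OpB : forall p, Op (B p).
Hypothesis Bp : forall p, B p p.
Hypothesis lab_al : forall p, lab p \in al p.
Hypothesis gauge : forall p q, B p q -> col q = col p -> lab q = lab p.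
Hypothesis dense : forall O p (J : {set L}), Op O -> O p -> J != set0 -> J \subset al p ->
  exists2 q, O q & al q = J.
Hypothesis conn : forall O J (P : X -> Prop), Op O ->
  (forall p, O p -> al p = J -> exists O', [/\ Op O', O' p &
     forall q, O q -> O' q -> al q = J -> (P p <-> P q)]) ->
  forall p q, O p -> O q -> al p = J -> al q = J -> P p -> P q.

(** The neighbourhoods shrink along a flag because the tie between a colour and its label only holds
    in [B p]. Of the chosen points only the colour-label pairs are kept. *)
Inductive flag : {set L} -> (X -> Prop) -> {set C * L} -> Prop :=
| flag0 O : flag set0 O set0
| flagS J O p b : O p -> al p = J -> flag (J :\ lab p) (meet O (B p)) b ->
    flag J O ((col p, lab p) |: b).

(** A budget of colours: [I] bounds what can still occur once the labels outside [J] are gone. *)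
Definition good (J : {set L}) (I : {set C}) (O : X -> Prop) :=
  forall q, O q -> al q \subset J -> col q \in I.

Lemma flag_sub J O O' b : (forall x, O x -> O' x) -> flag J O b -> flag J O' b.
Proof.
move=> sub fl; elim: fl O' sub => {J O b} [O|J O p b Op' alp _ IH] O' sub.
  exact: flag0.
apply: flagS => //; first exact: sub.
by apply: IH => x [Ox Bx]; split=> //; apply: sub.
Qed.

Lemma good_sub J I (O O' : X -> Prop) :
  (forall x, O' x -> O x) -> good J I O -> good J I O'.
Proof. by move=> sub gd q /sub Oq; apply: gd. Qed.

(** A point of colour [i] carries the label [j], so [j] is available at it, and it is not among the
    points whose labels avoid [j]. *)
Lemma good_step J I (O : X -> Prop) i j : good J I O ->
  (forall q, O q -> col q = i -> lab q = j) -> good (J :\ j) (I :\ i) O.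
Proof.
move=> gd lq q Oq alq; rewrite in_setD1; apply/andP; split; last first.
  by apply: gd => //; apply: subset_trans alq (subD1set _ _).
apply/eqP=> /(lq q Oq) lj; have := subsetP alq _ (lab_al q).
by rewrite lj in_setD1 eqxx.
Qed.

Lemma good_stepB J I O p : good J I O ->
  good (J :\ lab p) (I :\ col p) (meet O (B p)).
Proof.
move=> gd; apply: good_step; first by apply: good_sub gd => x [].
by move=> q [_ Bq]; apply: gauge.
Qed.

Arguments good_stepB [J I O] p _.

(** After discarding [lab q] the remaining labels are still available at [q], so [q] is itself a
    base point for the next use of density. *)
Lemma flag_exists (J : {set L}) O p : Op O -> O p -> J \subset al p -> exists b, flag J O b.
Proof.
move: {2}#|J| (leqnn #|J|) => k; elim: k J O p => [|k IH] J O p cJ oO Op' sJ.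
  move: cJ; rewrite leqn0 cards_eq0 => /eqP ->; exists set0; exact: flag0.
have [J0|Jn0] := eqVneq J set0; first by rewrite J0; exists set0; apply: flag0.
have [q Oq alq] := dense oO Op' Jn0 sJ.
have lJ : lab q \in J by rewrite -alq.
have [||||b fb] := IH (J :\ lab q) (meet O (B q)) q.
- by move: cJ; rewrite (cardsD1 (lab q)) lJ.
- exact: OpI.
- by split.
- by rewrite alq subD1set.
by exists ((col q, lab q) |: b); apply: flagS.
Qed.

(** Each stage of a flag takes one label from [J] and one colour from the budget. *)
Lemma flag_col J O b I : flag J O b -> good J I O ->
  #|J| <= #|I| /\ (forall i l, (i, l) \in b -> i \in I).
Proof.
move=> fl; elim: fl I => {J O b} [O|J O p b Op' alp _ IH] I gd.
  by split; [rewrite cards0 | move=> i l; rewrite inE].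
have [le cI] := IH _ (good_stepB p gd).
have pI : col p \in I by apply: gd => //; rewrite alp.
have lJ : lab p \in J by rewrite -alp.
split; first by rewrite (cardsD1 (lab p)) lJ (cardsD1 (col p) I) pI.
move=> i l; rewrite in_setU1 => /orP[/eqP[-> _] //|/cI].
by rewrite in_setD1 => /andP[].
Qed.

(** A recorded colour has left the budget and cannot reappear further down. *)
Lemma flag_functional J O b I : flag J O b -> good J I O ->
  forall i l l', (i, l) \in b -> (i, l') \in b -> l = l'.
Proof.
move=> fl; elim: fl I => {J O b} [O|J O p b Op' alp fl IH] I gd i l l'.
  by rewrite inE.
have gd' := good_stepB p gd.
have cI : forall l0, (col p, l0) \in b -> False.
  by move=> l0 /(proj2 (flag_col fl gd')); rewrite in_setD1 eqxx.
rewrite !in_setU1 => /orP[/eqP[ei el]|h1] /orP[/eqP[ei' el']|h2].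
- by rewrite el el'.
- by rewrite ei in h2; case: (cI _ h2).
- by rewrite ei' in h1; case: (cI _ h1).
exact: IH gd' _ _ _ h1 h2.
Qed.

(** [flag_uniq] and [flag_remove] are proved together by induction on [k]; [flag_adherent] is an
    intermediate form following from both at the same [k]. By [flag_col], the bound on [I] leaves no
    colour to spare. *)
Definition flag_uniq k := forall (J : {set L}) (I : {set C}) O b b', #|J| = k -> #|I| <= k -> Op O ->
  good J I O -> flag J O b -> flag J O b' -> b = b'.

Definition flag_remove k := forall (J : {set L}) (I : {set C}) O i j b b', #|J| = k -> #|I| <= k ->
  Op O -> good J I O -> i \in I -> j \in J ->
  (forall q, O q -> col q = i -> lab q = j) ->
  flag J O b -> flag (J :\ j) O b' -> b = (i, j) |: b'.

Definition flag_adherent k := forall (J : {set L}) (I : {set C}) O z b b', #|J| = k -> #|I| <= k ->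
  Op O -> good J I O -> O z -> J \subset al z -> lab z \in J -> col z \in I ->
  flag J O b -> flag (J :\ lab z) (meet O (B z)) b' ->
  b = (col z, lab z) |: b'.

Lemma cardsD1S (T : finType) (A : {set T}) a k : #|A| = k.+1 -> a \in A ->
  #|A :\ a| = k.
Proof. by rewrite (cardsD1 a) => e aA; move: e; rewrite aA => -[]. Qed.

Lemma cardsD1leS (T : finType) (A : {set T}) a k : #|A| <= k.+1 -> a \in A ->
  #|A :\ a| <= k.
Proof. by rewrite (cardsD1 a) => e aA; move: e; rewrite aA. Qed.

(** Inside [B z] the colour of [z] is tied to its label, which is the situation of [flag_remove];
    uniqueness carries the result back to [O]. The labels available at [z] may exceed [J]. *)
Lemma flag_adherentP k : flag_uniq k -> flag_remove k -> flag_adherent k.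
Proof.
move=> U R J I O z b b' cJ cI oO gd Oz sJ lz cz fb fb'.
have oO' : Op (meet O (B z)) by exact: OpI.
have [|b3 fb3] := flag_exists oO' _ sJ; first by split.
have -> : b = b3.
  apply: (U J I O) => //; apply: flag_sub fb3 => x [] //.
apply: (R J I (meet O (B z))) => //.
- by apply: good_sub gd => x [].
- by move=> q [_ Bq]; apply: gauge.
Qed.

(* Two colours cannot compete for one label: one would be missing below. *)
Lemma label_inj (J : {set L}) (I : {set C}) O p q k : #|J| = k.+1 -> #|I| <= k.+1 -> Op O ->
  good J I O -> J \subset al q -> O q -> col q \in I -> col p \in I ->
  lab q \in J -> (forall x, O x -> col x = col p -> lab x = lab p) ->
  col q != col p -> lab q != lab p.
Proof.
move=> cJ cI oO gd sJ Oq qI pI lJ up cqp; apply/eqP=> lqp.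
have oO' : Op (meet O (B q)) by exact: OpI.
have [||b fb] := @flag_exists (J :\ lab q) _ q oO'; first by split.
  by apply: subset_trans sJ; rewrite subD1set.
have gd1 := good_stepB q gd.
have gd2 : good (J :\ lab q :\ lab p) (I :\ col q :\ col p) (meet O (B q)).
  by apply: good_step gd1 _ => x [Ox _]; apply: up.
have e : J :\ lab q :\ lab p = J :\ lab q.
  by apply/setP=> x; rewrite !inE -lqp; case: (x == lab q).
rewrite e in gd2; have [le _] := flag_col fb gd2.
have cI1 := cardsD1leS cI qI.
have pI1 : col p \in I :\ col q by rewrite in_setD1 eq_sym cqp.
move: le; rewrite (cardsD1S cJ lJ) => le.
by move: cI1; rewrite (cardsD1 (col p)) pI1 add1n => /leq_trans/(_ le); rewrite ltnn.
Qed.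

Lemma setU1C (T : finType) (a b : T) (A : {set T}) : a |: (b |: A) = b |: (a |: A).
Proof. by rewrite !setUA (setUC [set a]). Qed.

Lemma setD1C (T : finType) (a b : T) (A : {set T}) : A :\ a :\ b = A :\ b :\ a.
Proof. by apply/setP=> x; rewrite !inE andbCA. Qed.

Lemma flag_inv J O b : flag J O b -> J != set0 -> exists p b1,
  [/\ O p, al p = J, flag (J :\ lab p) (meet O (B p)) b1 & b = (col p, lab p) |: b1].
Proof.
case=> {J O b} [O|J O p b Op' alp fl _]; first by rewrite eqxx.
by exists p, b.
Qed.

(** If the top point has colour [i], uniqueness below suffices. Otherwise its label is not [j], the
    pair [(i, j)] can be pulled out of the flag below it, and the top point becomes an adherent
    point for the labels without [j]. *)
Lemma flag_removeP k : flag_uniq k -> flag_remove k -> flag_remove k.+1.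
Proof.
move=> U R J I O i j b b' cJ cI oO gd iI jJ uij fb fb'.
have Jn0 : J != set0 by apply/set0Pn; exists j.
have [q [b1 [Oq alq fb1 ->]]] := flag_inv fb Jn0.
have lJ : lab q \in J by rewrite -alq.
have qI : col q \in I by apply: gd => //; rewrite alq.
have gdj := good_step gd uij.
have [ci|ci] := eqVneq (col q) i.
  have lj := uij q Oq ci; rewrite ci lj in fb1 *; congr (_ |: _).
  apply: (U (J :\ j) (I :\ i) O) => //.
  - exact: cardsD1S.
  - exact: cardsD1leS.
  - by apply: flag_sub fb1 => x [].
have oO' : Op (meet O (B q)) by exact: OpI.
(* Otherwise both [i] and the colour of [q] would be spent on the single label [j]. *)
have lj : lab q != j.
  apply/eqP=> lj; have [b0 fb0] : exists b0, flag (J :\ j) (meet O (B q)) b0.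
    apply: (@flag_exists _ _ q) => //.
    by rewrite alq subD1set.
  have gd1 := good_stepB q gdj; rewrite lj in gd1.
  have e : J :\ j :\ j = J :\ j by apply/setP=> x; rewrite !inE; case: (x == j).
  rewrite e in gd1; have [le _] := flag_col fb0 gd1.
  have qI1 : col q \in I :\ i by rewrite in_setD1 ci.
  have := cardsD1leS cI iI; rewrite (cardsD1 (col q)) qI1 add1n => /(leq_ltn_trans le).
  by rewrite (cardsD1S cJ jJ) ltnn.
have lJj : lab q \in J :\ j by rewrite in_setD1 lj.
have jJl : j \in J :\ lab q by rewrite in_setD1 eq_sym lj.
have qIi : col q \in I :\ i by rewrite in_setD1 ci.
have iIq : i \in I :\ col q by rewrite in_setD1 eq_sym ci.
have [b2 fb2] : exists b2, flag (J :\ lab q :\ j) (meet O (B q)) b2.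
  apply: (@flag_exists _ _ q) => //.
  by rewrite alq; apply: subset_trans (subD1set _ _) (subD1set _ _).
have -> : b1 = (i, j) |: b2.
  apply: (R (J :\ lab q) (I :\ col q) (meet O (B q))) => //.
  - exact: cardsD1S.
  - exact: cardsD1leS.
  - exact: good_stepB.
  - by move=> x [Ox _]; apply: uij.
rewrite setD1C in fb2.
rewrite setU1C; congr (_ |: _); symmetry.
apply: (flag_adherentP U R (J := J :\ j) (I := I :\ i) (O := O)) => //.
- exact: cardsD1S.
- exact: cardsD1leS.
- by rewrite alq subD1set.
Qed.

(** The record of a flag is locally constant in its top point, and [conn] turns this into
    constancy. *)
Lemma flag_uniqP k : flag_uniq k -> flag_remove k -> flag_uniq k.+1.
Proof.
move=> U R J I O b b' cJ cI oO gd fb fb'.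
have Jn0 : J != set0 by rewrite -cards_eq0 cJ.
pose P b q := exists2 b1, flag (J :\ lab q) (meet O (B q)) b1 & b = (col q, lab q) |: b1.
have exP p : O p -> al p = J -> exists b1, flag (J :\ lab p) (meet O (B p)) b1.
  move=> Op' alp; apply: (@flag_exists _ _ p); first exact: OpI.
    by split.
  by rewrite alp subD1set.
have loc p p' : O p -> al p = J -> O p' -> B p p' -> al p' = J -> forall b1 b1',
    flag (J :\ lab p) (meet O (B p)) b1 -> flag (J :\ lab p') (meet O (B p')) b1' ->
    (col p, lab p) |: b1 = (col p', lab p') |: b1'.
  move=> Oz alp Oz' Bpp' alp' b1 b1' f1 f1'.
  have lJ : lab p \in J by rewrite -alp.
  have lJ' : lab p' \in J by rewrite -alp'.
  have pI : col p \in I by apply: gd => //; rewrite alp.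
  have pI' : col p' \in I by apply: gd => //; rewrite alp'.
  have oOB q : Op (meet O (B q)) by exact: OpI.
  have oO2 : Op (meet (meet O (B p')) (B p)) by exact: OpI.
  have m2 : meet (meet O (B p')) (B p) p' by do ![split].
  have U1 q c c' : lab q \in J -> col q \in I ->
      flag (J :\ lab q) (meet O (B q)) c -> flag (J :\ lab q) (meet O (B q)) c' -> c = c'.
    move=> lq cq; apply: (U _ (I :\ col q)) => //.
    - exact: cardsD1S.
    - exact: cardsD1leS.
    - exact: good_stepB.
  have [ci|ci] := eqVneq (col p') (col p).
    have li := gauge Bpp' ci; rewrite ci li in f1' *; congr (_ |: _).
    have [|b2 fb2] := @flag_exists (J :\ lab p) _ p' oO2 m2; first by rewrite alp' subD1set.
    transitivity b2.
      by apply: (U1 p) => //; apply: flag_sub fb2 => x [[]].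
    apply: (U1 p'); rewrite ?li //; first by apply: flag_sub fb2 => x [].
  have lj : lab p' != lab p.
    have gd2 : good J I (meet (meet O (B p')) (B p)).
      by apply: good_sub gd => x [[]].
    apply: (label_inj cJ cI oO2 gd2) => //; first by rewrite alp'.
    by move=> x [_ Bx]; apply: gauge.
  (* With different colours, both records are compared with one flag below the two labels at once,
     taken inside both neighbourhoods. *)
  have [|b2 fb2] := @flag_exists (J :\ lab p' :\ lab p) _ p' oO2 m2.
    by rewrite alp'; apply: subset_trans (subD1set _ _) (subD1set _ _).
  have -> : b1' = (col p, lab p) |: b2.
    have [|b3 fb3] := @flag_exists (J :\ lab p') _ p' oO2 m2; first by rewrite alp' subD1set.
    have -> : b1' = b3.
      by apply: (U1 p') => //; apply: flag_sub fb3 => x [].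
    apply: (R (J :\ lab p') (I :\ col p') (meet (meet O (B p')) (B p))) => //.
    - exact: cardsD1S.
    - exact: cardsD1leS.
    - by apply: good_sub (good_stepB p' gd) => x [].
    - by rewrite in_setD1 eq_sym ci.
    - by rewrite in_setD1 eq_sym lj.
    - by move=> x [_ Bx]; apply: gauge.
  rewrite setU1C; congr (_ |: _).
  apply: (flag_adherentP U R (J := J :\ lab p) (I := I :\ col p) (O := meet O (B p))) => //.
  - exact: cardsD1S.
  - exact: cardsD1leS.
  - exact: good_stepB.
  - by rewrite alp' subD1set.
  - by rewrite in_setD1 lj.
  - by rewrite in_setD1 ci.
  - by rewrite setD1C; apply: flag_sub fb2 => x [[]].
have [p [b1 [Oz alp f1 eb]]] := flag_inv fb Jn0.
have [p' [b1' [Oz' alp' f1' eb']]] := flag_inv fb' Jn0.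
have [||b2 f2 ->] := conn (J := J) (P := P b) oO _ Oz Oz' alp alp'; last 2 first.
- by exists b1.
- rewrite eb'; congr (_ |: _).
  have lJ' : lab p' \in J by rewrite -alp'.
  have pI' : col p' \in I by apply: gd => //; rewrite alp'.
  apply: (U (J :\ lab p') (I :\ col p') (meet O (B p'))) => //.
  + exact: cardsD1S.
  + exact: cardsD1leS.
  + exact: OpI.
  + exact: good_stepB.
move=> q Oq alq; exists (B q); split=> // q' Oq' Bq' alq'.
have [c fc] := exP q Oq alq; have [c' fc'] := exP q' Oq' alq'.
split=> -[d fd ->].
  by exists c' => //; apply: loc fd fc'.
by exists c => //; symmetry; apply: loc fc fd.
Qed.

Lemma flag_uniqE k : flag_uniq k /\ flag_remove k.
Proof.
elim: k => [|k [U R]]; last by split; [apply: flag_uniqP | apply: flag_removeP].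
split=> [J I O b b' /eqP|J I O i j b b' /eqP]; rewrite cards_eq0 => /eqP ->; last first.
  by rewrite inE.
move=> _ _ _ fb fb'.
have inv0 c : flag set0 O c -> c = set0.
  move e : set0 => J0 fc; case: fc e => {J0 c} // J0 O0 p c _ alp _ e.
  by have := lab_al p; rewrite alp -e inE.
by rewrite (inv0 _ fb) (inv0 _ fb').
Qed.

(** A flag starting at [p] and one starting at [q] have the same record over the whole space, and a
    record is functional. *)
Theorem colour_determines_label (p q : X) : Op (fun _ => True) ->
  #|C| <= #|L| -> al p = [set: L] -> al q = [set: L] ->
  col p = col q -> lab p = lab q.
Proof.
move=> oT cCL alp alq cpq.
have gd : good [set: L] [set: C] (fun _ => True) by move=> x _ _; rewrite inE.
have ex x : al x = [set: L] -> exists b,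
    flag [set: L] (fun _ => True) b /\ (col x, lab x) \in b.
  move=> alx; have [|//||b fb] := @flag_exists ([set: L] :\ lab x) (meet (fun _ => True) (B x)) x.
  - exact: OpI.
  - by rewrite alx subD1set.
  by exists ((col x, lab x) |: b); split; [apply: flagS | rewrite setU11].
have [b [fb inb]] := ex p alp; have [b' [fb' inb']] := ex q alq.
have [U _] := flag_uniqE #|L|.
have eb : b = b' by apply: (U [set: L] [set: C] (fun _ => True)); rewrite ?cardsT.
rewrite -eb -cpq in inb'; exact: flag_functional fb gd _ _ _ inb inb'.
Qed.

End Flags.
End SimplexFlags.

(** * Sign conditions: which sets of labels occur near a point *)

Module StaircaseCones.
Import all_boot zify.
Set Implicit Arguments.
Unset Strict Implicit.
Unset Printing Implicit Defensive.

(** The labels of one parity with deviations [z]: some sign pattern compatible with [z] has its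
    first fork at [j], where [j = m] stands for no fork. *)
Definition stair (m : nat) (z : nat -> R) (j : nat) : Prop :=
  (forall k, (k < j)%N -> z k <= 0) /\ ((j < m)%N -> 0 <= z j).

(** This [j] is the first strictly positive entry. The available positions are it and the zeros
    before it, and the next two lemmas rest on this description. *)
Lemma stair_first_pos (m : nat) (z : nat -> R) : exists j, [/\ (j <= m)%N,
  forall k, (k < j)%N -> z k <= 0 & (j < m)%N -> 0 < z j].
Proof.
elim: m => [|m [j [jm le lt]]]; first by exists 0%N; split.
have [jm'|jm'] := ltnP j m.
  by exists j; split=> //; [lia | move=> _; apply: lt].
have {jm jm'} ej : j = m by lia.
subst j; have [le0|lt0] := Rle_dec (z m) 0.
  exists m.+1; split=> //; last by rewrite ltnn.
  move=> k km; have [km'|->] : (k < m)%N \/ k = m by lia.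
    exact: le.
  exact: le0.
by exists m; split=> // _; lra.
Qed.

(** Agreement at the two ends forces the same first positive position and the same zeros before it;
    the other earlier entries are negative at both ends and stay so. *)
Lemma stair_convex (m : nat) (z w : nat -> R) (t : R) : 0 <= t <= 1 ->
  (forall j, (j <= m)%N -> (stair m z j <-> stair m w j)) ->
  forall j, (j <= m)%N -> stair m (fun k => z k + t * (w k - z k)) j <-> stair m z j.
Proof.
move=> t01 zw j H; split=> [[le ge]|sz]; last first.
  have [le ge] := sz; have [le' ge'] := proj1 (zw _ H) sz.
  split=> [k kj|jm]; first by have := le k kj; have := le' k kj; nra.
  by have := ge jm; have := ge' jm; nra.
have [j1 [j1m le1 lt1]] := stair_first_pos m z.
have [j2 [j2m le2 lt2]] := stair_first_pos m w.
have s1 : stair m w j1 by apply/zw => //; split=> // h; have := lt1 h; lra.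
have s2 : stair m z j2 by apply/zw => //; split=> // h; have := lt2 h; lra.
have e12 : j1 = j2.
  have [h|h|//] := ltngtP j1 j2.
    have h' : (j1 < m)%N by lia.
    by have := lt1 h'; have := proj1 s2 _ h; lra.
  have h' : (j2 < m)%N by lia.
  by have := lt2 h'; have := proj1 s1 _ h; lra.
subst j2; have [h|h] := ltnP j1 j.
  have h' : (j1 < m)%N by lia.
  by have := le _ h; have := lt1 h'; have := lt2 h'; nra.
have lez k : (k < j)%N -> z k <= 0 by move=> kj; apply: le1; lia.
have lew k : (k < j)%N -> w k <= 0 by move=> kj; apply: le2; lia.
split=> // jm; have [//|neg] := Rle_dec 0 (z j).
have [e|ne] : j = j1 \/ (j < j1)%N by lia.
  by subst j; have := lt1 jm; lra.
have negw : w j < 0.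
  have [pos|] := Rle_dec 0 (w j); last by lra.
  by case: neg; apply: (proj2 (proj2 (zw _ H) (conj lew (fun _ => pos)))).
by have := ge jm; nra.
Qed.

(** Push up the entry at the largest chosen position and push down the earlier ones that are not
    chosen; earlier chosen entries are zero and stay. *)
Lemma stair_dense (m : nat) (z : nat -> R) (S : nat -> bool) (e : R) : 0 < e ->
  (forall j, S j -> (j <= m)%N /\ stair m z j) -> (exists j, S j) ->
  exists z', (forall k, Rabs (z' k - z k) <= e) /\
    forall j, (j <= m)%N -> (stair m z' j <-> S j).
Proof.
move=> e0 Sz exS.
have bS j : S j -> (j <= m)%N by move=> /Sz[].
pose j1 := ex_maxn exS bS.
have [S1 max1] : S j1 /\ forall j, S j -> (j <= j1)%N.
  by rewrite /j1; case: ex_maxnP.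
have [j1m [le1 ge1]] := Sz _ S1.
exists (fun k => if (k < j1)%N then (if S k then z k else z k - e)
                 else if (k == j1)%N then z k + e else z k); split.
  move=> k; case: ifP => _; last by case: ifP => _; apply: Rabs_le; lra.
  by case: ifP => _; apply: Rabs_le; lra.
move=> j jm; split=> [[le ge]|Sj].
  have jj1 : (j <= j1)%N.
    rewrite leqNgt; apply/negP=> lt; have := le _ lt.
    rewrite ltnn eqxx; have := ge1 ltac:(lia); lra.
  have [->//|lt] : j = j1 \/ (j < j1)%N by lia.
  have := ge ltac:(lia); rewrite lt; case: (S j) => // h.
  by have := le1 _ lt; lra.
have jj1 := max1 _ Sj; have [_ [lej gej]] := Sz _ Sj.
split=> [k kj|jm'].
  have kj1 : (k < j1)%N by lia.
  by rewrite kj1; case: (S k); have := le1 _ kj1; lra.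
have := gej jm'; have [->|lt] : j = j1 \/ (j < j1)%N by lia.
  by rewrite ltnn eqxx; lra.
by rewrite lt Sj.
Qed.

(** Coordinate 0 of [u] runs along the axis of centres and coordinate 1 is the difference of squared
    lengths. The deviations follow, interleaved: even parity ([true]) at [2k+2], odd parity at
    [2k+3]. *)
Definition coord (b : bool) (k : nat) (u : nat -> R) : R := u (2 * k + ~~ b).+2.

Definition side (b : bool) (u : nat -> R) : R := if b then u 1%N else - u 1%N.

Definition asbool (P : Prop) : bool := if excluded_middle_informative P then true else false.

Lemma asboolP P : reflect P (asbool P).
Proof. by rewrite /asbool; case: excluded_middle_informative => h; constructor. Qed.

Section Cones.

Variable m : nat.
Local Notation L := (bool * 'I_m.+1)%type.

Definition allowed (u : nat -> R) (l : L) : Prop :=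
  side l.1 u <= 0 /\ stair m (fun k => coord l.1 k u) l.2.

Definition al (u : nat -> R) : {set L} := [set l | asbool (allowed u l)].

Lemma in_al u l : l \in al u <-> allowed u l.
Proof. by rewrite inE; split=> /asboolP. Qed.

Definition mix (t : R) (p q : nat -> R) (i : nat) : R := p i + t * (q i - p i).

(** Openness is tested on the finitely many coordinates that matter; convexity is included so that
    points of [O] with equal label sets are joined by segments. *)
Definition open_convex (O : (nat -> R) -> Prop) : Prop :=
  (forall p, O p -> exists2 e, 0 < e & forall q,
     (forall i, (i < 2 * m + 2)%N -> Rabs (q i - p i) < e) -> O q) /\
  (forall p q t, O p -> O q -> 0 <= t <= 1 -> O (mix t p q)).

Lemma al_side u b : (exists j, (b, j) \in al u) <-> side b u <= 0.
Proof.
split=> [[j /in_al[]] //|h].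
have [j [jm le lt]] := stair_first_pos m (fun k => coord b k u).
exists (inord j); apply/in_al; split=> //=; rewrite inordK //; split=> // jm'.
by have := lt jm'; lra.
Qed.

(** A parity absent at both ends stays absent, whatever its deviations; only for a parity that is
    present do the label sets compare the staircases. *)
Lemma al_convex p q t : 0 <= t <= 1 -> al p = al q -> al (mix t p q) = al p.
Proof.
move=> t01 epq.
have hs b : side b p <= 0 <-> side b q <= 0 by rewrite -!al_side epq.
have mb b : side b (mix t p q) = side b p + t * (side b q - side b p).
  by case: b; rewrite /side /mix; lra.
have hm b : side b (mix t p q) <= 0 <-> side b p <= 0.
  rewrite mb; have h := hs b; split; last by move=> h1; have := proj1 h h1; nra.
  move=> h1; have [//|n1] := Rle_dec (side b p) 0.
  have n2 : ~ side b q <= 0 by move/h.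
  by nra.
have agree b : side b p <= 0 -> forall i, (i <= m)%N ->
    (stair m (fun k => coord b k p) i <-> stair m (fun k => coord b k q) i).
  move=> hp i im; have ei : i = nat_of_ord (inord i : 'I_m.+1) by rewrite inordK.
  split=> hi.
    have : (b, inord i) \in al p by apply/in_al; split=> //=; rewrite -ei.
    by rewrite epq => /in_al[_ /=]; rewrite -ei.
  have : (b, inord i) \in al q by apply/in_al; split=> //=; [apply/hs | rewrite -ei].
  by rewrite -epq => /in_al[_ /=]; rewrite -ei.
apply/setP=> -[b j].
have jm : (j <= m)%N by have := ltn_ord j; lia.
apply/idP/idP => /in_al[/= h1 h2]; apply/in_al; split=> /=.
- exact/hm.
- have hp : side b p <= 0 by apply/hm.
  exact: (proj1 (stair_convex t01 (agree b hp) jm) h2).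
- exact/hm.
exact: (proj2 (stair_convex t01 (agree b h1) jm) h2).
Qed.

Lemma al_dense (O : (nat -> R) -> Prop) p (J : {set L}) : open_convex O -> O p ->
  J != set0 -> J \subset al p -> exists2 q, O q & al q = J.
Proof.
move=> [oO _] Op /set0Pn[[b0 j0] J0] sJ.
have [e e0 he] := oO p Op.
have inJ b j : (b, j) \in J -> allowed p (b, j) by move=> /(subsetP sJ) /in_al.
pose S b j := (j <= m)%N && ((b, inord j) \in J).
have Sz b j : S b j -> (j <= m)%N /\ stair m (fun k => coord b k p) j.
  by move=> /andP[jm /inJ[_ /=]]; rewrite inordK.
have exz b : exists z', (forall k, Rabs (z' k - coord b k p) <= e / 2) /\
    ((exists j, S b j) -> forall j, (j <= m)%N -> (stair m z' j <-> S b j)).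
  case: (excluded_middle_informative (exists j, S b j)) => [ex|nex].
    have [|||z' [h1 h2]] := @stair_dense m (fun k => coord b k p) (S b) (e / 2).
    - by lra.
    - exact: Sz.
    - exact: ex.
    by exists z'.
  exists (fun k => coord b k p); split=> // k.
  by rewrite Rminus_diag Rabs_R0; lra.
have [zt [dt st]] := exz true; have [zf [df sf]] := exz false.
pose inb b := asbool (exists j, S b j).
(* If both parities occur in [J] the difference of lengths is zero and stays; otherwise it moves
   strictly to the side of the only parity present. *)
pose h' := if inb true then (if inb false then p 1%N else p 1%N - e / 2)
           else p 1%N + e / 2.
pose q i := match i with 0 => p 0%N | 1 => h'
  | i'.+2 => if odd i' then zf i'./2 else zt i'./2 end.
have qz b k : coord b k q = if b then zt k else zf k.
  have -> : coord b k q = if odd (2 * k + ~~ b) then zf (2 * k + ~~ b)./2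
                          else zt (2 * k + ~~ b)./2 by [].
  rewrite oddD mul2n odd_double halfD odd_double doubleK add0n.
  by case: b => /=; rewrite addn0.
have dq i : Rabs (q i - p i) <= e / 2.
  case: i => [|[|i]] /=.
  - by rewrite Rminus_diag Rabs_R0; lra.
  - by rewrite /h'; case: ifP => _; [case: ifP => _|]; apply: Rabs_le; lra.
  - have ei : i = (2 * i./2 + ~~ ~~ odd i)%N by rewrite negbK mul2n addnC odd_double_half.
    case: ifP => oi; rewrite ?oi /= in ei.
      by rewrite {2}ei; apply: (df i./2).
    by rewrite {2}ei; apply: (dt i./2).
exists q; first by apply: he => i _; have := dq i; lra.
have inbP b : reflect (exists j, S b j) (inb b) by apply: asboolP.
have Sj b j : S b j -> side b p <= 0 by move=> /andP[_ /inJ[]].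
have sq b : side b q <= 0 <-> inb b.
  have tf : inb true \/ inb false.
    case: b0 J0 => J0; [left|right]; apply/inbP; exists j0; apply/andP; split.
    - by have := ltn_ord j0; lia.
    - by rewrite inord_val.
    - by have := ltn_ord j0; lia.
    - by rewrite inord_val.
  have ht : inb true -> p 1%N <= 0 by move=> /inbP[j /Sj].
  have hf : inb false -> 0 <= p 1%N by move=> /inbP[j /Sj] /=; lra.
  case: b; rewrite /= /h'.
    case: (inb true) tf ht hf => tf ht hf.
      by split=> // _; have := ht isT; case: (inb false) => h; lra.
    by split=> //; have := hf ltac:(by case: tf); lra.
  case: (inb false) tf ht hf => tf ht hf.
    by split=> // _; have := hf isT; case: (inb true) => h; lra.
  have tt : inb true by case: tf.
  by rewrite tt; split=> //; have := ht tt; lra.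
apply/setP=> -[b j].
have jm : (j <= m)%N by have := ltn_ord j; lia.
have eS : S b j = ((b, j) \in J) by rewrite /S jm inord_val.
have stq : inb b -> stair m (fun k => coord b k q) j <-> S b j.
  move=> /inbP hb; have -> : (fun k => coord b k q) = if b then zt else zf.
    by apply: functional_extensionality => k; rewrite qz; case: (b).
  by case: b hb {eS} => hb; [apply: st | apply: sf].
apply/idP/idP=> [/in_al[/= /sq hb /(stq hb)]|]; rewrite -eS // => hS.
have hb : inb b by apply/inbP; exists j.
by apply/in_al; split=> /=; [apply/sq | apply/(stq hb)].
Qed.

Lemma segment_connected (P : R -> Prop) :
  (forall t, 0 <= t <= 1 -> exists2 d, 0 < d &
     forall s, 0 <= s <= 1 -> Rabs (s - t) < d -> (P t <-> P s)) -> P 0 -> P 1.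
Proof.
move=> loc P0.
pose A t := 0 <= t <= 1 /\ forall s, 0 <= s <= t -> P s.
have [|| c [ub lub]] := completeness A.
- by exists 1 => t [[]].
- by exists 0; split; [lra | move=> s hs; have -> : s = 0 by lra].
have c0 : 0 <= c by apply: ub; split; [lra | move=> s hs; have -> : s = 0 by lra].
have c1 : c <= 1 by apply: lub => t [[]].
have [d d0 hd] := loc c (conj c0 c1).
have [t [At tc]] : exists t, A t /\ c - d < t.
  apply: NNPP => no; have : c <= c - d.
    apply: lub => t At; have [//|h] := Rle_dec t (c - d).
    by case: no; exists t; split=> //; lra.
  by lra.
have tle := ub t At.
have Pc : P c.
  have [h h'] := At; apply/(hd t h); first by apply: Rabs_def1; lra.
  by apply: h'; lra.
have Ac s : 0 <= s <= 1 -> s < c + d -> P s.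
  move=> hs sd; have [le|nle] := Rle_dec s t; first by apply: (proj2 At); lra.
  by apply/(hd s hs) => //; apply: Rabs_def1; lra.
have [le|nle] := Rle_dec 1 (c + d / 2); first by apply: Ac; lra.
have : c + d / 2 <= c; last by lra.
by apply: ub; split; [lra | move=> s hs; apply: Ac; lra].
Qed.

Lemma bound_finite (f : nat -> R) N : exists2 M, 0 < M & forall i, (i < N)%N -> Rabs (f i) <= M.
Proof.
elim: N => [|N [M M0 hM]]; first by exists 1; [lra | ].
exists (M + Rabs (f N)); first by have := Rabs_pos (f N); lra.
move=> i; rewrite ltnS leq_eqVlt => /orP[/eqP->|/hM]; first lra.
by have := Rabs_pos (f N); lra.
Qed.

Lemma al_conn (O : (nat -> R) -> Prop) (J : {set L}) (P : (nat -> R) -> Prop) :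
  open_convex O ->
  (forall p, O p -> al p = J -> exists O', [/\ open_convex O', O' p &
     forall q, O q -> O' q -> al q = J -> (P p <-> P q)]) ->
  forall p q, O p -> O q -> al p = J -> al q = J -> P p -> P q.
Proof.
move=> [oO cO] loc p q Op Oq alp alq.
have e0 : mix 0 p q = p by apply: functional_extensionality => i; rewrite /mix; lra.
have e1 : mix 1 p q = q by apply: functional_extensionality => i; rewrite /mix; lra.
suff: P (mix 0 p q) -> P (mix 1 p q) by rewrite e0 e1.
apply: (@segment_connected (fun t => P (mix t p q))) => t t01.
have [|O' [[oO' _] O't hO']] := loc (mix t p q) (cO _ _ _ Op Oq t01).
  by rewrite al_convex // alp alq.
have [e e_gt0 he] := oO' _ O't.
have [M M0 hM] := bound_finite (fun i => q i - p i) (2 * m + 2).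
exists (e / M); first exact: Rdiv_lt_0_compat.
move=> s s01 st; apply: hO'; first (exact: cO); last by rewrite al_convex // alp alq.
apply: he => i iN; have -> : mix s p q i - mix t p q i = (s - t) * (q i - p i).
  by rewrite /mix; lra.
rewrite Rabs_mult; have hi := hM i iN.
have h1 := Rmult_le_compat_l (Rabs (s - t)) _ _ (Rabs_pos _) hi.
have h2 := Rmult_lt_compat_r M _ _ M0 st.
have h3 : e / M * M = e by field; lra.
lra.
Qed.

End Cones.

(** The interface between flags and geometry, stated without finite types. On the axis all
    deviations vanish, so every label is available there. *)
Theorem axis_colour_determines_label (m K : nat) (col : (nat -> R) -> nat)
    (par : (nat -> R) -> bool) (idx : (nat -> R) -> nat) :
  (forall u, Peano.lt (col u) K) ->
  (forall u, Peano.le (idx u) m) ->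
  (forall u, side (par u) u <= 0) ->
  (forall u k, Peano.lt k (idx u) -> coord (par u) k u <= 0) ->
  (forall u, Peano.lt (idx u) m -> 0 <= coord (par u) (idx u) u) ->
  (forall u, exists rho, 0 < rho /\ forall u',
     (forall i, Peano.lt i (Nat.add (Nat.mul 2 m) 2) -> Rabs (u' i - u i) < rho) ->
     col u' = col u -> par u' = par u /\ idx u' = idx u) ->
  Peano.le K (Nat.add (Nat.mul 2 m) 2) ->
  forall u u', (forall i, u (S i) = 0) -> (forall i, u' (S i) = 0) ->
  col u = col u' -> par u = par u' /\ idx u = idx u'.
Proof.
move=> colK idxm parP lt_idx ge_idx gauge leK u u' u0 u'0 cuu'.
have colK' v : (col v < K)%N by have := colK v; lia.
have idxm' v : (idx v < m.+1)%N by have := idxm v; lia.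
pose lab v : bool * 'I_m.+1 := (par v, Ordinal (idxm' v)).
pose c v : 'I_K := Ordinal (colK' v).
pose rho v := proj1_sig (constructive_indefinite_description _ (gauge v)).
have rhoP v := proj2_sig (constructive_indefinite_description _ (gauge v)).
(* A radius strictly below [rho p] leaves a margin, so [B p] is open without taking a maximum over
   the coordinates. *)
pose B p q := exists2 r, r < rho p & forall i, (i < 2 * m + 2)%N -> Rabs (q i - p i) <= r.
have alT v : (forall i, v (S i) = 0) -> al m v = [set: bool * 'I_m.+1].
  move=> v0; apply/setP=> -[b j]; rewrite in_setT; apply/in_al; split=> /=.
    by case: b; rewrite /side v0; lra.
  by split=> *; rewrite /coord v0; lra.
have: lab u = lab u'; last by rewrite /lab; case=> -> ->.
apply: (@SimplexFlags.colour_determines_label _ _ _ (@al m) lab c (open_convex m) B).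
- move=> O O' [o1 c1] [o2 c2]; split=> [p [/o1[e e0 he] /o2[e' e'0 he']]|p q t [? ?] [? ?] t01].
    exists (Rmin e e'); first exact: Rmin_glb_lt.
    move=> q hq; split; [apply: he | apply: he'] => i /hq.
      by have := Rmin_l e e'; lra.
    by have := Rmin_r e e'; lra.
  by split; [apply: c1 | apply: c2].
- move=> p; split=> [q [r rr hr]|q1 q2 t [r1 rr1 hr1] [r2 rr2 hr2] t01].
    exists ((rho p - r) / 2); first by lra.
    move=> q' hq'; exists ((rho p + r) / 2); first by lra.
    move=> i iN; have -> : q' i - p i = (q' i - q i) + (q i - p i) by lra.
    apply: Rle_trans (Rabs_triang _ _) _.
    by have := hq' i iN; have := hr i iN; lra.
  exists (Rmax r1 r2); first exact: Rmax_lub_lt.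
  move=> i iN; have h1 := hr1 i iN; have h2 := hr2 i iN.
  have := Rmax_l r1 r2; have := Rmax_r r1 r2; move=> h3 h4.
  have a1 := Rle_abs (q1 i - p i); have b1 := Rle_abs (- (q1 i - p i)).
  have a2 := Rle_abs (q2 i - p i); have b2 := Rle_abs (- (q2 i - p i)).
  rewrite Rabs_Ropp in b1; rewrite Rabs_Ropp in b2.
  by apply: Rabs_le; rewrite /mix; nra.
- move=> p; have [r0 _] := rhoP p; exists (rho p / 2); rewrite -/(rho p) in r0.
    lra.
  by move=> i _; rewrite Rminus_diag Rabs_R0; lra.
- move=> p; apply/in_al; split=> /=; first exact: parP.
  split=> [k kj|jm]; first by apply: lt_idx; lia.
  by apply: ge_idx; lia.
- move=> p q [r rr hr] /(congr1 (@nat_of_ord _)) /= cc.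
  have [r0 hq] := rhoP p; rewrite -/(rho p) in r0 hq.
  have [|ep ei] := hq q _ cc.
    by move=> i iN; have := hr i ltac:(lia); lra.
  by rewrite /lab; congr (_, _) => //; apply: val_inj.
- by move=> O p J; apply: al_dense.
- by move=> O J P; apply: al_conn.
- by split=> // p _; exists 1; [lra | ].
- by rewrite card_prod card_bool !card_ord; lia.
- exact: alT u0.
- exact: alT u'0.
- exact: val_inj.
Qed.

End StaircaseCones.

(** * Euclidean space *)

Local Notation "u .[ i ]" := (proj1_sig u i%nat)
  (at level 2, i at level 200, format "u .[ i ]").

Fixpoint rsum (k : nat) (f : nat -> R) : R :=
  match k with O => 0 | S k' => rsum k' f + f k' end.

Lemma rsum_ext k f g : (forall i, (i < k)%nat -> f i = g i) -> rsum k f = rsum k g.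
Proof.
elim: k => [|k IH] H //=; rewrite (H k); last by lia.
by rewrite IH // => i ik; apply: H; lia.
Qed.

Lemma rsum_le k f g : (forall i, (i < k)%nat -> f i <= g i) -> rsum k f <= rsum k g.
Proof.
elim: k => [|k IH] H /=; first by lra.
have := IH (fun i ik => H i ltac:(lia)); have := H k ltac:(lia); lra.
Qed.

Lemma rsum_le_eq k f g : (forall i, (i < k)%nat -> f i <= g i) ->
  rsum k g <= rsum k f -> forall i, (i < k)%nat -> f i = g i.
Proof.
elim: k => [|k IH] H /= le i ik; first by lia.
have h1 := rsum_le k f g (fun i ik => H i ltac:(lia)).
have h2 := H k ltac:(lia).
have [->|ik'] : i = k \/ (i < k)%nat by lia.
  by lra.
by apply: IH => //; [move=> j jk; apply: H; lia | lra].
Qed.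

Lemma rsum_const k c : rsum k (fun _ => c) = INR k * c.
Proof. by elim: k => [|k IH]; rewrite ?S_INR /= ?IH; lra. Qed.

Lemma rsum_ge0 k f : (forall i, (i < k)%nat -> 0 <= f i) -> 0 <= rsum k f.
Proof.
move=> H; have := rsum_le k (fun _ => 0) f H; rewrite rsum_const; lra.
Qed.

Lemma rsum_term k f i : (forall i, (i < k)%nat -> 0 <= f i) -> (i < k)%nat ->
  f i <= rsum k f.
Proof.
elim: k => [|k IH] H ik /=; first by lia.
have h0 := rsum_ge0 k f (fun i ik => H i ltac:(lia)).
have hk := H k ltac:(lia).
have [->|ik'] : i = k \/ (i < k)%nat by lia.
  by lra.
have := IH (fun i ik => H i ltac:(lia)) ik'; lra.
Qed.

Lemma rsum_plus k f g : rsum k f + rsum k g = rsum k (fun i => f i + g i).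
Proof. by elim: k => [|k IH] /=; rewrite -?IH; lra. Qed.

Lemma rsum_scal k a f : a * rsum k f = rsum k (fun i => a * f i).
Proof. by elim: k => [|k IH] /=; rewrite -?IH; lra. Qed.

Lemma sumsq_rsum k x y : sumsq k x y = rsum k (fun i => (x i - y i) ^ 2).
Proof. by elim: k => [|k IH] //=; rewrite IH. Qed.

Definition mkRn (N : nat) (f : nat -> R) : Rn N.
exists (fun i => if Nat.ltb i N then f i else 0).
by move=> i Ni; have -> : Nat.ltb i N = false by apply/Nat.ltb_ge.
Defined.

Lemma mkRnE N f i : (i < N)%nat -> (mkRn N f).[i] = f i.
Proof. by move=> iN /=; have -> : Nat.ltb i N = true by apply/Nat.ltb_lt. Qed.

Lemma Rn_ext N (u v : Rn N) : (forall i, (i < N)%nat -> u.[i] = v.[i]) -> u = v.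
Proof.
case: u v => [u hu] [v hv] /= H.
have e : u = v.
  apply: functional_extensionality => i.
  have [iN|Ni] : (i < N)%nat \/ (N <= i)%nat by lia.
    exact: H.
  by rewrite hu ?hv.
by subst v; rewrite (proof_irrelevance _ hu hv).
Qed.

Lemma Rabs_bounds (a b : R) : Rabs a <= b -> - b <= a <= b.
Proof. by rewrite /Rabs; case: Rcase_abs; lra. Qed.

Lemma Rabs_sqr (a : R) : Rabs a ^ 2 = a ^ 2.
Proof. by rewrite /Rabs; case: Rcase_abs => _; ring. Qed.

Lemma Rabs_le_of_sqr (a b : R) : 0 <= b -> a ^ 2 <= b ^ 2 -> Rabs a <= b.
Proof. by move=> b0 h; apply: Rabs_le; nra. Qed.

Section Euclid.
Variable N : nat.
Implicit Types u v w : Rn N.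

Lemma sumsq_ge0 k x y : 0 <= sumsq k x y.
Proof. by elim: k => [|k IH] /=; [lra | have := pow2_ge_0 (x k - y k); lra]. Qed.

Lemma eucl_ge0 u v : 0 <= eucl N u v.
Proof. exact: sqrt_pos. Qed.

Lemma eucl_sqr u v : eucl N u v ^ 2 = rsum N (fun i => (u.[i] - v.[i]) ^ 2).
Proof. by rewrite -sumsq_rsum /eucl pow2_sqrt //; apply: sumsq_ge0. Qed.

Lemma eucl_sym u v : eucl N u v = eucl N v u.
Proof.
by rewrite /eucl !sumsq_rsum; congr sqrt; apply: rsum_ext => i _; ring.
Qed.

Lemma eucl_refl u : eucl N u u = 0.
Proof.
rewrite /eucl sumsq_rsum (rsum_ext _ _ (fun _ => 0)).
  by rewrite rsum_const Rmult_0_r sqrt_0.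
by move=> i _; ring.
Qed.

(** Minkowski's inequality in the plane for [(sqrt A, a)] and [(sqrt B, b)], from Cauchy-Schwarz. It
    is the induction step of the triangle inequality, splitting off the last coordinate. *)
Lemma sqrt_triangle A B a b : 0 <= A -> 0 <= B ->
  sqrt ((sqrt A + sqrt B) ^ 2 + (a + b) ^ 2) <= sqrt (A + a ^ 2) + sqrt (B + b ^ 2).
Proof.
move=> A0 B0; have a2 := pow2_ge_0 a; have b2 := pow2_ge_0 b.
have sA := sqrt_pos A; have sB := sqrt_pos B.
have eA := pow2_sqrt A A0; have eB := pow2_sqrt B B0.
have p1 := sqrt_pos (A + a ^ 2); have p2 := sqrt_pos (B + b ^ 2).
have e1 := pow2_sqrt (A + a ^ 2) ltac:(lra); have e2 := pow2_sqrt (B + b ^ 2) ltac:(lra).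
move: (sqrt A) (sqrt B) (sqrt (A + a ^ 2)) (sqrt (B + b ^ 2)) sA sB eA eB p1 p2 e1 e2.
move=> x y p q x0 y0 <- <- p0 q0 ep eq.
have cs : x * y + a * b <= p * q.
  have h : (x * y + a * b) ^ 2 <= (p * q) ^ 2.
    have -> : (p * q) ^ 2 = (x ^ 2 + a ^ 2) * (y ^ 2 + b ^ 2) by rewrite -ep -eq; ring.
    by have := pow2_ge_0 (x * b - y * a); lra.
  by have [_ ] := Rabs_bounds _ _ (Rabs_le_of_sqr _ _ (Rmult_le_pos _ _ p0 q0) h).
rewrite -(sqrt_pow2 (p + q)); last by lra.
by apply: sqrt_le_1_alt; lra.
Qed.

Lemma sumsq_triangle k x y z :
  sqrt (sumsq k x z) <= sqrt (sumsq k x y) + sqrt (sumsq k y z).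
Proof.
elim: k => [|k IH] /=; first by rewrite sqrt_0; lra.
apply: Rle_trans (sqrt_triangle _ _ (x k - y k) (y k - z k) (sumsq_ge0 k x y) (sumsq_ge0 k y z)).
apply: sqrt_le_1_alt.
have -> : x k - y k + (y k - z k) = x k - z k by ring.
have h0 := sqrt_pos (sumsq k x z); have h := pow2_sqrt _ (sumsq_ge0 k x z).
by nra.
Qed.

Lemma eucl_triangle v u w : eucl N u w <= eucl N u v + eucl N v w.
Proof. exact: sumsq_triangle. Qed.

Lemma eucl_coord u v i : (i < N)%nat -> Rabs (u.[i] - v.[i]) <= eucl N u v.
Proof.
move=> iN; apply: Rabs_le_of_sqr; first exact: eucl_ge0.
rewrite eucl_sqr.
by apply: (rsum_term N (fun i => (u.[i] - v.[i]) ^ 2)) => // j _; apply: pow2_ge_0.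
Qed.

Lemma eucl_le_coord u v e : 0 <= e -> (forall i, (i < N)%nat -> Rabs (u.[i] - v.[i]) <= e) ->
  eucl N u v <= INR N * e.
Proof.
move=> e0 H; have N0 := pos_INR N.
have N2 : INR N <= INR N ^ 2.
  have [->|N1] : N = 0%nat \/ (1 <= N)%nat by lia.
    by rewrite /=; lra.
  by have := le_INR 1 N N1; rewrite /= -/INR; nra.
rewrite -[X in _ <= X]Rabs_pos_eq; last by nra.
rewrite -[eucl _ _ _]Rabs_pos_eq; last exact: eucl_ge0.
apply: Rabs_le_of_sqr; first exact: Rabs_pos.
rewrite !Rabs_sqr eucl_sqr.
apply: Rle_trans (rsum_le _ _ (fun _ => e ^ 2) _) _ => [i iN|].
  by have [] := Rabs_bounds _ _ (H i iN); nra.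
by rewrite rsum_const Rpow_mult_distr; have := pow2_ge_0 e; nra.
Qed.

Lemma eucl_eq0 u v : eucl N u v = 0 -> u = v.
Proof.
move=> h; apply: Rn_ext => i iN; have := eucl_coord u v i iN.
by rewrite h => /Rabs_bounds; lra.
Qed.

Definition interp (t : R) u v : Rn N := mkRn N (fun i => u.[i] + t * (v.[i] - u.[i])).

Lemma eucl_interp s t u v : eucl N (interp s u v) (interp t u v) = Rabs (s - t) * eucl N u v.
Proof.
rewrite -[LHS]Rabs_pos_eq; last exact: eucl_ge0.
rewrite -[eucl N u v]Rabs_pos_eq; last exact: eucl_ge0.
rewrite -Rabs_mult; apply: Rsqr_eq_abs_0; rewrite !Rsqr_pow2 Rpow_mult_distr !eucl_sqr.
rewrite rsum_scal.
by apply: rsum_ext => i iN; rewrite !mkRnE //; ring.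
Qed.

Lemma interp0 u v : interp 0 u v = u.
Proof. by apply: Rn_ext => i iN; rewrite mkRnE //; ring. Qed.

Lemma interp1 u v : interp 1 u v = v.
Proof. by apply: Rn_ext => i iN; rewrite mkRnE //; ring. Qed.

(** The parallelogram law, applied to [w] and the midpoint of the segment. *)
Lemma midpoint_unique u v w D : 0 <= D -> eucl N u w <= D / 2 -> eucl N w v <= D / 2 ->
  D <= eucl N u v -> w = interp (1 / 2) u v /\ eucl N u v = D.
Proof.
move=> D0 h1 h2 h3.
have h4 := eucl_triangle w u v.
split; last by lra.
apply: eucl_eq0.
have pl : 4 * eucl N w (interp (1 / 2) u v) ^ 2 =
    2 * eucl N u w ^ 2 + 2 * eucl N w v ^ 2 + (-1) * eucl N u v ^ 2.
  rewrite !eucl_sqr !rsum_scal !rsum_plus.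
  by apply: rsum_ext => i iN; rewrite !mkRnE //; field.
have := eucl_ge0 w (interp (1 / 2) u v); have := eucl_ge0 u w; have := eucl_ge0 w v.
have := eucl_ge0 u v; nra.
Qed.

End Euclid.

(** * The metric of the Klein bottle *)

Definition sgn (k : Z) : R := if Z.even k then 1 else -1.

Lemma sgn_mul k l : sgn (k + l) = sgn k * sgn l.
Proof. by rewrite /sgn Z.even_add; case: Z.even; case: Z.even => /=; ring. Qed.

Lemma sgn_sqr k : sgn k * sgn k = 1.
Proof. by rewrite /sgn; case: Z.even; ring. Qed.

Lemma sgn_opp k : sgn (- k) = sgn k.
Proof. by rewrite /sgn Z.even_opp. Qed.

Definition sgnZ (k : Z) : Z := if Z.even k then 1%Z else (-1)%Z.

Lemma sgnZE k : IZR (sgnZ k) = sgn k.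
Proof. by rewrite /sgn /sgnZ; case: Z.even. Qed.

Section Deck.
Variable m : nat.
Local Notation n := (S m).
Implicit Types u v w : Rn n.

(** The deck group in normal form: [k] is the degree in the last coordinate, and its parity decides
    whether the horizontal coordinates are reflected. *)
Definition deck (k : Z) (t : nat -> Z) u v : Prop :=
  (forall i, (i < m)%nat -> v.[i] = sgn k * u.[i] + IZR (t i)) /\ v.[m] = u.[m] + IZR k.

Definition act (k : Z) (t : nat -> Z) u : Rn n :=
  mkRn n (fun i => if Nat.eqb i m then u.[i] + IZR k else sgn k * u.[i] + IZR (t i)).

Lemma act_low k t u i : (i < m)%nat -> (act k t u).[i] = sgn k * u.[i] + IZR (t i).
Proof.
move=> im; rewrite mkRnE; last by lia.
by have -> : Nat.eqb i m = false by apply/Nat.eqb_neq; lia.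
Qed.

Lemma act_top k t u : (act k t u).[m] = u.[m] + IZR k.
Proof. by rewrite mkRnE ?Nat.eqb_refl //; lia. Qed.

Lemma act_deck k t u : deck k t u (act k t u).
Proof. by split=> [i im|]; [apply: act_low | apply: act_top]. Qed.

Lemma Rn_extS u v : (forall i, (i < m)%nat -> u.[i] = v.[i]) -> u.[m] = v.[m] -> u = v.
Proof.
move=> H Hm; apply: Rn_ext => i iN.
have [->//|im] : i = m \/ (i < m)%nat by lia.
exact: H.
Qed.

Lemma deck_act k t u v : deck k t u v -> v = act k t u.
Proof.
move=> [H Hm]; apply: Rn_extS => [i im|]; first by rewrite act_low // H.
by rewrite act_top.
Qed.

Lemma deck_trans k t k' t' u v w : deck k t u v -> deck k' t' v w ->
  deck (k + k') (fun i => sgnZ k' * t i + t' i)%Z u w.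
Proof.
move=> [H Hm] [H' Hm']; split=> [i im|]; last by rewrite Hm' Hm plus_IZR; ring.
by rewrite H' // H // sgn_mul plus_IZR mult_IZR sgnZE; ring.
Qed.

Lemma deck_sym k t u v : deck k t u v -> deck (- k) (fun i => - (sgnZ k * t i))%Z v u.
Proof.
move=> [H Hm]; split=> [i im|]; last by rewrite Hm opp_IZR; ring.
rewrite H // sgn_opp opp_IZR mult_IZR sgnZE.
by rewrite Rmult_plus_distr_l -Rmult_assoc sgn_sqr; ring.
Qed.

Lemma Krel_deck u v : Krel n u v -> exists k t, deck k t u v.
Proof.
elim=> {u v} [u v|u|u v _ [k [t H]]|u v w _ [k [t H]] _ [k' [t' H']]].
- rewrite /Kgen /Kgen_raw; have -> : (n - 1)%nat = m by lia.
  move=> [[i0 [im H]]|H].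
    exists 0%Z, (fun j => if Nat.eqb j i0 then 1%Z else 0%Z); split=> [i _|]; rewrite H.
      by rewrite /sgn /=; case: Nat.eqb; ring.
    by have -> : Nat.eqb m i0 = false by apply/Nat.eqb_neq; lia.
  exists 1%Z, (fun _ => 1%Z); split=> [i im|]; rewrite H.
    by rewrite (proj2 (Nat.ltb_lt i m) im) /sgn /=; ring.
  by rewrite Nat.ltb_irrefl Nat.eqb_refl.
- by exists 0%Z, (fun _ => 0%Z); split=> [i _|]; rewrite ?/sgn /=; ring.
- by exists (- k)%Z, (fun i => - (sgnZ k * t i))%Z; apply: deck_sym.
by exists (k + k')%Z, (fun i => sgnZ k' * t i + t' i)%Z; apply: deck_trans H H'.
Qed.

Definition delta (j : nat) (z : Z) (i : nat) : Z := if Nat.eqb i j then z else 0%Z.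

Lemma Krel_delta j (z : nat) u : (j < m)%nat -> Krel n u (act 0 (delta j (Z.of_nat z)) u).
Proof.
move=> jm; elim: z => [|z IH].
  have -> : act 0 (delta j (Z.of_nat 0)) u = u; last exact: rst_refl.
  apply: Rn_extS => [i im|]; first (rewrite act_low // /delta /sgn /=; case: Nat.eqb; ring).
  by rewrite act_top /=; ring.
apply: rst_trans IH _; apply: rst_step; left; exists j; split; first by lia.
move=> i; have [im|[->|im]] : (i < m)%nat \/ i = m \/ (n <= i)%nat by lia.
- rewrite !act_low // /delta; case: Nat.eqb; last by ring.
  by rewrite Nat2Z.inj_succ succ_IZR; ring.
- rewrite !act_top; have -> : Nat.eqb m j = false by apply/Nat.eqb_neq; lia.
  by ring.
rewrite (proj2_sig (act _ _ _) i im) (proj2_sig (act _ _ _) i im).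
have -> : Nat.eqb i j = false by apply/Nat.eqb_neq; lia.
by ring.
Qed.

Lemma Krel_deltaZ j z u : (j < m)%nat -> Krel n u (act 0 (delta j z) u).
Proof.
move=> jm; have [z0|z0] : (0 <= z)%Z \/ (z < 0)%Z by lia.
  by rewrite -(Z2Nat.id z z0); apply: Krel_delta.
have e : u = act 0 (delta j (Z.of_nat (Z.to_nat (- z)))) (act 0 (delta j z) u).
  rewrite Z2Nat.id; last by lia.
  apply: Rn_extS => [i im|]; rewrite ?act_top ?act_low //; last by ring.
  by rewrite /delta /sgn /=; case: Nat.eqb; rewrite ?opp_IZR; ring.
by apply: rst_sym; rewrite {2}e; apply: Krel_delta.
Qed.

Lemma Krel_translation t u : Krel n u (act 0 t u).
Proof.
pose tj j i := if Nat.ltb i j then t i else 0%Z.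
have H j : (j <= m)%nat -> Krel n u (act 0 (tj j) u).
  elim: j => [|j IH] jm.
    have -> : act 0 (tj 0%nat) u = u; last exact: rst_refl.
    by apply: Rn_extS => [i im|]; rewrite ?act_top ?act_low // /tj /sgn /=; ring.
  apply: rst_trans (IH ltac:(lia)) _.
  have -> : act 0 (tj (S j)) u = act 0 (delta j (t j)) (act 0 (tj j) u); last by apply: Krel_deltaZ; lia.
  apply: Rn_extS => [i im|]; rewrite ?act_top ?act_low //; last by ring.
  rewrite /tj /delta /sgn /=; have [ij|[->|ij]] : (i < j)%nat \/ i = j \/ (j < i)%nat by lia.
  - have -> : Nat.ltb i j = true by apply/Nat.ltb_lt.
    have -> : Nat.ltb i (S j) = true by apply/Nat.ltb_lt; lia.
    have -> : Nat.eqb i j = false by apply/Nat.eqb_neq; lia.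
    by ring.
  - have -> : Nat.ltb j (S j) = true by apply/Nat.ltb_lt; lia.
    by rewrite Nat.ltb_irrefl Nat.eqb_refl; ring.
  - have -> : Nat.ltb i j = false by apply/Nat.ltb_ge; lia.
    have -> : Nat.ltb i (S j) = false by apply/Nat.ltb_ge; lia.
    have -> : Nat.eqb i j = false by apply/Nat.eqb_neq; lia.
    by ring.
have -> : act 0 t u = act 0 (tj m) u; last exact: H.
apply: Rn_extS => [i im|]; rewrite ?act_top ?act_low //.
by have -> : tj m i = t i by rewrite /tj (proj2 (Nat.ltb_lt i m) im).
Qed.

Lemma Krel_glide (k : nat) u : Krel n u (act (Z.of_nat k) (fun _ => 0%Z) u).
Proof.
elim: k => [|k IH]; first exact: Krel_translation.
(* The generator maps a horizontal coordinate to one minus itself, so a translation by -1 must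
   follow to give the pure reflection. *)
apply: rst_trans IH _; apply: (rst_trans _ _ _ (act 1 (fun _ => 1%Z) (act (Z.of_nat k) (fun _ => 0%Z) u))).
  apply: rst_step; right => i; have -> : (n - 1)%nat = m by lia.
  have [im|[->|im]] : (i < m)%nat \/ i = m \/ (n <= i)%nat by lia.
  - by rewrite (proj2 (Nat.ltb_lt i m) im) act_low // /(sgn 1) /=; ring.
  - by rewrite Nat.ltb_irrefl Nat.eqb_refl act_top.
  rewrite (proj2_sig (act 1 _ _) i im) (proj2_sig (act _ _ _) i im).
  have -> : Nat.ltb i m = false by apply/Nat.ltb_ge; lia.
  by have -> : Nat.eqb i m = false by apply/Nat.eqb_neq; lia.
have -> : act (Z.of_nat (S k)) (fun _ => 0%Z) u =
    act 0 (fun _ => (-1)%Z) (act 1 (fun _ => 1%Z) (act (Z.of_nat k) (fun _ => 0%Z) u)).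
  apply: Rn_extS => [i im|]; rewrite ?act_top ?act_low // Nat2Z.inj_succ -?Z.add_1_r.
    by rewrite sgn_mul /(sgn 1) /(sgn 0) /=; ring.
  by rewrite plus_IZR; ring.
exact: Krel_translation.
Qed.

Lemma Krel_act k t u : Krel n u (act k t u).
Proof.
have H : Krel n u (act k (fun _ => 0%Z) u).
  have [k0|k0] : (0 <= k)%Z \/ (k < 0)%Z by lia.
    by rewrite -(Z2Nat.id k k0); apply: Krel_glide.
  have e : u = act (Z.of_nat (Z.to_nat (- k))) (fun _ => 0%Z) (act k (fun _ => 0%Z) u).
    rewrite Z2Nat.id; last by lia.
    apply: Rn_extS => [i im|]; rewrite ?act_top ?act_low //.
      by rewrite sgn_opp Rmult_plus_distr_l -Rmult_assoc sgn_sqr; ring.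
    by rewrite opp_IZR; ring.
  by apply: rst_sym; rewrite {2}e; apply: Krel_glide.
apply: rst_trans H _.
have -> : act k t u = act 0 t (act k (fun _ => 0%Z) u); last exact: Krel_translation.
by apply: Rn_extS => [i im|]; rewrite ?act_top ?act_low // /(sgn 0) /=; ring.
Qed.

Lemma deck_Krel k t u v : deck k t u v -> Krel n u v.
Proof. by move/deck_act=> ->; apply: Krel_act. Qed.

Definition proj u : Kn n := exist _ (Krel n u) (ex_intro _ u (fun z => iff_refl _)).

Lemma Kn_ext (y y' : Kn n) : (forall z, proj1_sig y z <-> proj1_sig y' z) -> y = y'.
Proof.
case: y y' => [Q hQ] [Q' hQ'] /= H.
have e : Q = Q' by apply: functional_extensionality => z; apply: propositional_extensionality.
by subst Q'; rewrite (proof_irrelevance _ hQ hQ').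
Qed.

Lemma proj_eq u v : proj u = proj v <-> Krel n u v.
Proof.
split=> [[e]|H]; first by rewrite e; apply: rst_refl.
apply: Kn_ext => z /=; split=> h; last exact: rst_trans H h.
exact: rst_trans (rst_sym _ _ _ _ H) h.
Qed.

Lemma proj_surj (y : Kn n) : exists u, y = proj u.
Proof. by case: y => [Q [u Hu]]; exists u; apply: Kn_ext. Qed.

End Deck.

(** * Distances to the integers and to the even integers *)

Definition nint (t : R) : Z := Int_part (t + 1 / 2).
Definition nd (t : R) : R := Rabs (t - IZR (nint t)).

Lemma nd_half t : nd t <= 1 / 2.
Proof.
have [h1 h2] := base_Int_part (t + 1 / 2).
by apply: Rabs_le; rewrite /nint; lra.
Qed.

Lemma nd_ge0 t : 0 <= nd t.
Proof. exact: Rabs_pos. Qed.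

Lemma nd_le t k : nd t <= Rabs (t - IZR k).
Proof.
have [->|ne] := Z.eq_dec k (nint t); first by apply: Rle_refl.
have h := nd_half t.
apply: Rle_trans h _.
have [h1 h2] := Rabs_bounds _ _ (nd_half t).
have [lt|gt] : (k + 1 <= nint t)%Z \/ (nint t + 1 <= k)%Z by lia.
  move: lt => /IZR_le; rewrite plus_IZR => lt.
  by apply: Rle_trans (Rle_abs _); lra.
move: gt => /IZR_le; rewrite plus_IZR => gt.
by rewrite Rabs_minus_sym; apply: Rle_trans (Rle_abs _); lra.
Qed.

Lemma nd_addZ t k : nd (t + IZR k) = nd t.
Proof.
apply: Rle_antisym.
  apply: Rle_trans (nd_le _ (nint t + k)) _; rewrite plus_IZR.
  by right; congr Rabs; ring.
apply: Rle_trans (nd_le _ (nint (t + IZR k) - k)) _; rewrite minus_IZR.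
by right; congr Rabs; ring.
Qed.

Lemma nd_opp t : nd (- t) = nd t.
Proof.
have H s : nd (- s) <= nd s.
  apply: Rle_trans (nd_le _ (- nint s)) _; rewrite opp_IZR.
  by right; rewrite -Rabs_Ropp; congr Rabs; ring.
by apply: Rle_antisym => //; rewrite -{1}(Ropp_involutive t).
Qed.

Lemma nd_lip s t : Rabs (nd s - nd t) <= Rabs (s - t).
Proof.
have H a b : nd a - nd b <= Rabs (a - b).
  have h1 := nd_le a (nint b).
  have h2 := Rabs_triang (a - b) (b - IZR (nint b)).
  have e : a - b + (b - IZR (nint b)) = a - IZR (nint b) by ring.
  by rewrite e in h2; rewrite {2}/nd; lra.
apply: Rabs_le; have := H s t; have := H t s; rewrite (Rabs_minus_sym t); lra.
Qed.

Lemma nd_small t : Rabs t <= 1 / 2 -> nd t = Rabs t.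
Proof.
move=> h; apply: Rle_antisym; first by have := nd_le t 0; rewrite Rminus_0_r.
have h' := nd_half t; rewrite /nd in h' *.
have [e|ne] := Z.eq_dec (nint t) 0; first by rewrite e Rminus_0_r; apply: Rle_refl.
have [a b] := Rabs_bounds _ _ h.
apply: Rle_trans h _.
have [lt|gt] : (nint t <= -1)%Z \/ (1 <= nint t)%Z by lia.
  by move: lt => /IZR_le lt; apply: Rle_trans (Rle_abs _); lra.
by move: gt => /IZR_le gt; rewrite Rabs_minus_sym; apply: Rle_trans (Rle_abs _); lra.
Qed.

(** Distance to the nearest even integer: deck transformations of equal parity differ by an even
    shift of the last coordinate. *)
Definition nd2 (t : R) : R := 2 * nd (t / 2).

Lemma nd2_ge0 t : 0 <= nd2 t.
Proof. by rewrite /nd2; have := nd_ge0 (t / 2); lra. Qed.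

Lemma nd2_addeven t k : Z.even k = true -> nd2 (t + IZR k) = nd2 t.
Proof.
move=> /Z.even_spec[l ->]; rewrite /nd2 mult_IZR.
have -> : (t + 2 * IZR l) / 2 = t / 2 + IZR l by field.
by rewrite nd_addZ.
Qed.

Lemma nd2_lip s t : Rabs (nd2 s - nd2 t) <= Rabs (s - t).
Proof.
have := nd_lip (s / 2) (t / 2); have -> : s / 2 - t / 2 = (s - t) / 2 by field.
have -> : nd2 s - nd2 t = 2 * (nd (s / 2) - nd (t / 2)) by rewrite /nd2; ring.
by rewrite !Rabs_mult (Rabs_pos_eq 2) ?(Rabs_pos_eq (/ 2)); lra.
Qed.

Lemma nd2_small t : Rabs t <= 1 -> nd2 t = Rabs t.
Proof.
move=> h; have e : Rabs (t / 2) = Rabs t / 2.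
  by rewrite Rabs_mult (Rabs_pos_eq (/ 2)); lra.
by rewrite /nd2 nd_small e; lra.
Qed.

Lemma nd2_le t : nd2 t <= Rabs t.
Proof.
have := nd_le (t / 2) 0; rewrite Rminus_0_r Rabs_mult (Rabs_pos_eq (/ 2)); last by lra.
by rewrite /nd2; lra.
Qed.

Lemma nd_le0 t : nd t <= Rabs t.
Proof. by have := nd_le t 0; rewrite Rminus_0_r. Qed.

Lemma nd_near t : exists k, Rabs (t + IZR k) = nd t.
Proof. by exists (- nint t)%Z; rewrite opp_IZR. Qed.

Lemma nd2_near t : exists k, Z.even k = true /\ Rabs (t + IZR k) = nd2 t.
Proof.
have [k hk] := nd_near (t / 2); exists (2 * k)%Z; split; first by rewrite Z.even_mul.
rewrite /nd2 -hk mult_IZR -{2}(Rabs_pos_eq 2); last by lra.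
by rewrite -Rabs_mult; congr Rabs; field.
Qed.

(** * The quotient distance as a minimum over two parities *)

Section Distance.
Variable m : nat.
Local Notation n := (S m).
Implicit Types x y z : Rn n.

(* Squared distance from [x] to the lifts of [proj y] obtained from [y] by a
   deck transformation of even (resp. odd) degree in the last coordinate. *)
Definition De x y := rsum m (fun i => nd (y.[i] - x.[i]) ^ 2) + nd2 (y.[m] - x.[m]) ^ 2.
Definition Do x y := rsum m (fun i => nd (y.[i] + x.[i]) ^ 2) + nd2 (y.[m] - x.[m] - 1) ^ 2.

(** Only the relative degree matters: if odd, it turns horizontal differences into sums, up to sign
    and integers, and shifts the vertical displacement by an odd integer. *)
Lemma De_deck k t k' t' x x' y y' : deck m k t x x' -> deck m k' t' y y' ->
  (Z.even (k' - k) = true /\ De x' y' = De x y /\ Do x' y' = Do x y) \/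
  (Z.even (k' - k) = false /\ De x' y' = Do x y /\ Do x' y' = De x y).
Proof.
move=> [Hx Hxm] [Hy Hym].
have e0 : y'.[m] - x'.[m] = y.[m] - x.[m] + IZR (k' - k).
  by rewrite Hxm Hym minus_IZR; ring.
have sub_low a b c i : (i < m)%nat -> y'.[i] - x'.[i] = c * a + IZR b -> (c = 1 \/ c = -1) ->
    nd (y'.[i] - x'.[i]) = nd a.
  move=> _ -> [->|->]; rewrite nd_addZ; first by congr nd; ring.
  by rewrite -(nd_opp a); congr nd; ring.
have add_low a b c i : (i < m)%nat -> y'.[i] + x'.[i] = c * a + IZR b -> (c = 1 \/ c = -1) ->
    nd (y'.[i] + x'.[i]) = nd a.
  move=> _ -> [->|->]; rewrite nd_addZ; first by congr nd; ring.
  by rewrite -(nd_opp a); congr nd; ring.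
have s1 : sgn k = 1 \/ sgn k = -1 by rewrite /sgn; case: Z.even; [left | right].
case ev : (Z.even (k' - k)); [left | right]; split=> //.
  have es : sgn k' = sgn k.
    have -> : k' = (k' - k + k)%Z by lia.
    by rewrite sgn_mul /(sgn (_ - _)) ev; ring.
  split; rewrite /De /Do e0.
    rewrite nd2_addeven //; congr (_ + _); apply: rsum_ext => i im; congr (_ ^ 2).
    apply: (sub_low _ (t' i - t i)%Z (sgn k)) => //.
    by rewrite Hx // Hy // es minus_IZR; ring.
  have -> : y.[m] - x.[m] + IZR (k' - k) - 1 = y.[m] - x.[m] - 1 + IZR (k' - k) by ring.
  rewrite nd2_addeven //; congr (_ + _); apply: rsum_ext => i im; congr (_ ^ 2).
  apply: (add_low _ (t' i + t i)%Z (sgn k)) => //.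
  by rewrite Hx // Hy // es plus_IZR; ring.
have es : sgn k' = - sgn k.
  have -> : k' = (k' - k + k)%Z by lia.
  by rewrite sgn_mul /(sgn (_ - _)) ev; ring.
split; rewrite /De /Do e0.
  have -> : y.[m] - x.[m] + IZR (k' - k) = y.[m] - x.[m] - 1 + IZR (k' - k + 1).
    by rewrite plus_IZR; ring.
  rewrite nd2_addeven; last by rewrite Z.even_add ev.
  congr (_ + _); apply: rsum_ext => i im; congr (_ ^ 2).
  apply: (sub_low _ (t' i - t i)%Z (- sgn k)) => //.
    by rewrite Hx // Hy // es minus_IZR; ring.
  by lra.
have -> : y.[m] - x.[m] + IZR (k' - k) - 1 = y.[m] - x.[m] + IZR (k' - k - 1).
  by rewrite (minus_IZR _ 1); ring.
rewrite nd2_addeven; last by rewrite Z.even_sub ev.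
congr (_ + _); apply: rsum_ext => i im; congr (_ ^ 2).
apply: (add_low _ (t' i + t i)%Z (- sgn k)) => //.
  by rewrite Hx // Hy // es plus_IZR; ring.
by lra.
Qed.

Lemma eucl_sqrS x y : eucl n x y ^ 2 =
  rsum m (fun i => (x.[i] - y.[i]) ^ 2) + (x.[m] - y.[m]) ^ 2.
Proof. by rewrite eucl_sqr. Qed.

Lemma sqr_le_abs a b : 0 <= a -> a <= Rabs b -> a ^ 2 <= b ^ 2.
Proof. by move=> a0 h; rewrite -(Rabs_sqr b); apply: pow_incr. Qed.

Lemma De_le_eucl x y : De x y <= eucl n x y ^ 2.
Proof.
rewrite eucl_sqrS /De; apply: Rplus_le_compat.
  apply: rsum_le => i im; apply: sqr_le_abs; first exact: nd_ge0.
  by rewrite Rabs_minus_sym; apply: nd_le0.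
apply: sqr_le_abs; first exact: nd2_ge0.
by rewrite Rabs_minus_sym; apply: nd2_le.
Qed.

(** [De] is bounded by the squared distance term by term, so equality of the sums is equality of all
    terms. *)
Lemma De_eq_eucl x y : eucl n x y ^ 2 <= De x y ->
  (forall i, (i < m)%nat -> Rabs (y.[i] - x.[i]) <= 1 / 2) /\ Rabs (y.[m] - x.[m]) <= 1.
Proof.
rewrite eucl_sqr => H.
pose f i := if Nat.eqb i m then nd2 (y.[i] - x.[i]) ^ 2 else nd (y.[i] - x.[i]) ^ 2.
have fm : f m = nd2 (y.[m] - x.[m]) ^ 2 by rewrite /f Nat.eqb_refl.
have fi i : (i < m)%nat -> f i = nd (y.[i] - x.[i]) ^ 2.
  by move=> im; rewrite /f; have -> : Nat.eqb i m = false by apply/Nat.eqb_neq; lia.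
have le i : (i < n)%nat -> f i <= (x.[i] - y.[i]) ^ 2.
  move=> iN; rewrite /f; case: Nat.eqb; apply: sqr_le_abs; rewrite ?(Rabs_minus_sym (x.[i])).
  - exact: nd2_ge0.
  - exact: nd2_le.
  - exact: nd_ge0.
  - exact: nd_le0.
have ge : rsum n (fun i => (x.[i] - y.[i]) ^ 2) <= rsum n f.
  apply: Rle_trans H _; rewrite /De [rsum n f]/= fm; apply: Rplus_le_compat_r.
  by right; apply: rsum_ext => i im; rewrite fi.
have E := rsum_le_eq n _ _ le ge.
split=> [i im|].
  apply: Rabs_le_of_sqr; first by lra.
  have := E i ltac:(lia); rewrite fi // => h.
  have := nd_half (y.[i] - x.[i]); have := nd_ge0 (y.[i] - x.[i]); nra.
apply: Rabs_le_of_sqr; first by lra.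
have := E m ltac:(lia); rewrite fm => h.
have := nd_half ((y.[m] - x.[m]) / 2); have := nd2_ge0 (y.[m] - x.[m]); rewrite /nd2 in h *; nra.
Qed.

Lemma eucl_eq_De x y : (forall i, (i < m)%nat -> Rabs (y.[i] - x.[i]) <= 1 / 2) ->
  Rabs (y.[m] - x.[m]) <= 1 -> eucl n x y ^ 2 = De x y.
Proof.
move=> H Hm; rewrite eucl_sqrS /De (nd2_small _ Hm) Rabs_sqr; congr (_ + _); last by ring.
by apply: rsum_ext => i im; rewrite (nd_small _ (H i im)) Rabs_sqr; ring.
Qed.

Lemma De_attained x y : exists k t, Z.even k = true /\
  eucl n x (act m k t y) ^ 2 = De x y.
Proof.
have [k [ev hk]] := nd2_near (y.[m] - x.[m]).
have ht i : Rabs (y.[i] - x.[i] + IZR (- nint (y.[i] - x.[i]))) = nd (y.[i] - x.[i]).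
  by rewrite opp_IZR.
exists k, (fun i => - nint (y.[i] - x.[i]))%Z; split=> //.
rewrite eucl_sqrS /De -hk Rabs_sqr; congr (_ + _).
  apply: rsum_ext => i im; rewrite -ht Rabs_sqr act_low // /sgn ev; ring.
by rewrite act_top; ring.
Qed.

Lemma Do_attained x y : exists k t, Z.even k = false /\
  eucl n x (act m k t y) ^ 2 = Do x y.
Proof.
have [k [t [ev h]]] := De_attained x (act m 1 (fun _ => 0%Z) y).
exists (1 + k)%Z, (fun i => sgnZ k * 0 + t i)%Z; split; first by rewrite Z.even_add ev.
have <- : act m k t (act m 1 (fun _ => 0%Z) y) = act m (1 + k) (fun i => sgnZ k * 0 + t i)%Z y.
  apply: deck_act; apply: (deck_trans m 1 (fun _ => 0%Z) k t y (act m 1 (fun _ => 0%Z) y)); exact: act_deck.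
rewrite h; have dx : deck m 0 (fun _ => 0%Z) x x by split=> [i _|]; rewrite /sgn /=; ring.
by case: (De_deck _ _ _ _ _ _ _ _ dx (act_deck m 1 (fun _ => 0%Z) y)) => [[]|[_ []]].
Qed.

Lemma lift_ge_min x x' y y' : Krel n x x' -> Krel n y y' ->
  Rmin (De x y) (Do x y) <= eucl n x' y' ^ 2.
Proof.
move=> /Krel_deck[k [t hx]] /Krel_deck[k' [t' hy]].
apply: Rle_trans (De_le_eucl x' y').
by case: (De_deck _ _ _ _ _ _ _ _ hx hy) => -[_ [-> _]]; [apply: Rmin_l | apply: Rmin_r].
Qed.

Lemma lift_attained x y : exists y', Krel n y y' /\
  eucl n x y' ^ 2 = Rmin (De x y) (Do x y).
Proof.
rewrite /Rmin; case: Rle_dec => _.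
  by have [k [t [_ h]]] := De_attained x y; exists (act m k t y); split=> //; apply: Krel_act.
by have [k [t [_ h]]] := Do_attained x y; exists (act m k t y); split=> //; apply: Krel_act.
Qed.

(** The value chosen by [epsilon] can only be used after a minimum is exhibited; a lift realising
    the smaller of the two parities provides it. *)
Lemma dK_spec x y : 0 <= dK n (proj m x) (proj m y) /\
  dK n (proj m x) (proj m y) ^ 2 = Rmin (De x y) (Do x y).
Proof.
have [y' [hy hm]] := lift_attained x y.
rewrite /dK; set Q := (fun r => _).
have : Q (epsilon (inhabits 0) Q).
  apply: epsilon_spec; exists (eucl n x y'); split.
    by exists x, y'; split; [apply: rst_refl | split].
  move=> x1 y1 hx1 hy1; have := lift_ge_min x x1 y y1 hx1 hy1.
  rewrite -hm => le; have h0 := eucl_ge0 n x1 y1.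
  rewrite -(Rabs_pos_eq (eucl n x y')); last exact: eucl_ge0.
  exact: Rabs_le_of_sqr.
set d := epsilon _ _; move=> [[x1 [y1 [hx1 [hy1 e]]]] low].
have d0 : 0 <= d by rewrite -e; apply: eucl_ge0.
split=> //; apply: Rle_antisym; last by rewrite -e; apply: lift_ge_min.
by rewrite -hm; apply: pow_incr; split=> //; apply: low => //; apply: rst_refl.
Qed.

Lemma dK_le x y y' : Krel n y y' -> dK n (proj m x) (proj m y) <= eucl n x y'.
Proof.
move=> hy; have [d0 e] := dK_spec x y.
rewrite -(Rabs_pos_eq _ d0); apply: Rabs_le_of_sqr; first exact: eucl_ge0.
by rewrite e; apply: lift_ge_min => //; apply: rst_refl.
Qed.

Lemma dK_le_eucl x y : dK n (proj m x) (proj m y) <= eucl n x y.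
Proof. by apply: dK_le; apply: rst_refl. Qed.

Lemma dK_lift x y : exists y', Krel n y y' /\ eucl n x y' = dK n (proj m x) (proj m y).
Proof.
have [y' [hy hm]] := lift_attained x y; exists y'; split=> //.
have [d0 e] := dK_spec x y; rewrite -e in hm.
apply: Rsqr_inj => //; first exact: eucl_ge0.
by rewrite !Rsqr_pow2.
Qed.

Lemma dK_ge0 p q : 0 <= dK n p q.
Proof.
have [x ->] := proj_surj m p; have [y ->] := proj_surj m q.
by case: (dK_spec x y).
Qed.

Lemma dK_refl p : dK n p p = 0.
Proof.
have [x ->] := proj_surj m p; apply: Rle_antisym; last exact: dK_ge0.
by apply: Rle_trans (dK_le_eucl x x) _; rewrite eucl_refl; lra.
Qed.

Lemma dK_sym p q : dK n p q = dK n q p.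
Proof.
have H a b : dK n a b <= dK n b a.
  have [x ->] := proj_surj m a; have [y ->] := proj_surj m b.
  have [x' [hx <-]] := dK_lift y x.
  have -> : proj m x = proj m x' by apply/proj_eq.
  by rewrite eucl_sym; apply: dK_le_eucl.
exact: Rle_antisym.
Qed.

Lemma dK_triangle q p r : dK n p r <= dK n p q + dK n q r.
Proof.
have [x ->] := proj_surj m p; have [y ->] := proj_surj m q; have [z ->] := proj_surj m r.
have [y' [hy e1]] := dK_lift x y.
have [z' [hz e2]] := dK_lift y' z.
have ey : proj m y = proj m y' by apply/proj_eq.
rewrite -e1 ey -e2; apply: Rle_trans (dK_le x z z' hz) _; exact: eucl_triangle.
Qed.

End Distance.

(** * The lower bound *)

Section MinimalGeodesics.
Variable m : nat.
Local Notation n := (S m).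
Local Notation d := (dK n).
Implicit Types (g : R -> Kn n).

Lemma geodesic_additive g s t : min_geodesic d g -> 0 <= s -> s <= t -> t <= 1 ->
  d (g 0) (g s) + d (g s) (g t) + d (g t) (g 1) <= d (g 0) (g 1).
Proof.
move=> [_ [ub _]] s0 st t1; apply: ub.
exists 3%nat, (fun i => match i with 0%nat => 0 | 1%nat => s | 2%nat => t | _ => 1 end).
split; last by rewrite /=; ring.
split=> //; split=> // -[|[|[|i]]] hi //=; lia.
Qed.

Lemma geodesic_midpoint g : min_geodesic d g ->
  exists t, 0 <= t <= 1 /\ d (g 0) (g t) = d (g 0) (g 1) / 2.
Proof.
move=> [cg _].
(* The path is continuous on the unit interval only, while the intermediate value theorem asks for
   continuity on the whole line; clamping the parameter extends it. *)
pose c t := Rmax 0 (Rmin 1 t).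
have c01 t : 0 <= c t <= 1.
  rewrite /c; split; first exact: Rmax_l.
  by apply: Rmax_lub; [lra | apply: Rmin_l].
have clip s t : Rabs (c s - c t) <= Rabs (s - t).
  rewrite /c /Rmax /Rmin; repeat case: Rle_dec; rewrite /Rabs; repeat case: Rcase_abs; lra.
pose f t := d (g 0) (g (c t)) - d (g 0) (g 1) / 2.
have cf : continuity f.
  move=> t eps eps0; have [del [del0 H]] := cg (c t) (c01 t) eps eps0.
  exists del; split=> // s [_ hs]; rewrite /= /R_dist in hs *.
  have hd := H (c s) (c01 s); rewrite /R_dist Rabs_minus_sym in hd.
  have {}hd := hd (Rle_lt_trans _ _ _ (clip s t) hs).
  apply: Rle_lt_trans hd; apply: Rabs_le; rewrite /f.
  have h1 := dK_triangle m (g (c t)) (g 0) (g (c s)).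
  have h2 := dK_triangle m (g (c s)) (g 0) (g (c t)).
  by rewrite (dK_sym m (g (c s))) in h2; lra.
have c0 : c 0 = 0 by rewrite /c Rmin_right ?Rmax_left; lra.
have c1 : c 1 = 1 by rewrite /c Rmin_left ?Rmax_right; lra.
have [||t [t01 ft]] := IVT_cor f 0 1 cf.
- lra.
- by rewrite /f c0 c1 dK_refl; have := dK_ge0 m (g 0) (g 1); nra.
exists (c t); split; first exact: c01.
by rewrite /f in ft; lra.
Qed.

(** Along a minimal geodesic, distances between points are differences of their distances from the
    start. *)
Lemma geodesic_from_midpoint g s t : min_geodesic d g -> 0 <= s <= 1 -> 0 <= t <= 1 ->
  d (g 0) (g s) = d (g 0) (g 1) / 2 ->
  d (g s) (g t) <= Rabs (d (g 0) (g t) - d (g 0) (g 1) / 2).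
Proof.
move=> mg s01 t01 hs.
have h1 := dK_triangle m (g s) (g 0) (g 1).
have h2 := dK_triangle m (g t) (g 0) (g 1).
have [st|ts] := Rle_dec s t.
  have h := geodesic_additive g s t mg ltac:(lra) st ltac:(lra).
  by apply: Rle_trans (Rle_abs _); lra.
have h := geodesic_additive g t s mg ltac:(lra) ltac:(lra) ltac:(lra).
rewrite (dK_sym m (g s)) Rabs_minus_sym.
by apply: Rle_trans (Rle_abs _); lra.
Qed.

End MinimalGeodesics.

(** In a pattern [true] is the plus sign. Even parity forks at a minus and odd parity at a plus, so
    that in either case a fork of a minimal geodesic means a non-negative deviation. *)
Definition fork (i : nat) (b : bool) (s : nat -> bool) : bool := Bool.eqb (s i) (negb b).

Fixpoint first_fork (k : nat) b s : nat :=
  match k with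
  | O => O
  | S k' => let j := first_fork k' b s in
            if Nat.ltb j k' then j else if fork k' b s then k' else S k'
  end.

Lemma first_forkP k b s : (first_fork k b s <= k)%nat /\
  (forall i, (i < first_fork k b s)%nat -> s i = b) /\
  ((first_fork k b s < k)%nat -> s (first_fork k b s) = negb b).
Proof.
elim: k => [|k [le [lt eq]]] /=; first by split; [lia | split=> *; lia].
case: Nat.ltb_spec => h; first by split; [lia | split=> // _; apply: eq].
have ek : first_fork k b s = k by lia.
rewrite ek in lt; rewrite /fork; case: Bool.eqb_spec => e; first by split; [lia | split].
split; first by lia.
split; last by lia.
move=> i ik; have [->|ik'] : i = k \/ (i < k)%nat by lia.
  by case: (s k) e; case: (b).
exact: lt.
Qed.

Lemma first_fork_ext k b s s' : (forall i, (i < k)%nat -> s i = s' i) ->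
  first_fork k b s = first_fork k b s'.
Proof.
elim: k => [|k IH] H //=; rewrite IH; last by move=> i ik; apply: H; lia.
by rewrite /fork H; last by lia.
Qed.

(** Position 0 is a fork for exactly one of [s] and its negation. This gives the final
    contradiction, since one turn around the circle negates the pattern. *)
Lemma first_fork_neg k b s : (1 <= k)%nat ->
  first_fork k b s <> first_fork k b (fun i => negb (s i)).
Proof.
move=> k1 e; have [_ [lt eq]] := first_forkP k b s.
have [_ [lt' eq']] := first_forkP k b (fun i => negb (s i)).
rewrite -e in lt' eq'; have [z|z] : first_fork k b s = 0%nat \/ (0 < first_fork k b s)%nat by lia.
  have h := eq ltac:(lia); have := eq' ltac:(lia); rewrite h.
  by case: (b).
have := lt 0%nat z; have := lt' 0%nat z; move=> <-; by case: (s 0%nat).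
Qed.

(** * The family of pairs around the axis of centres *)

Section LocalModel.
Variable m : nat.
Hypothesis m_pos : (1 <= m)%nat.
Local Notation n := (S m).
Implicit Types (u : nat -> R) (b : bool) (s : nat -> bool).

(** Small enough that the clamped parameters move [height] by at most 1/16 away from 1/2. *)
Definition eps : R := 1 / (8 * INR n).

Lemma INRn : 2 <= INR n.
Proof. by apply: (le_INR 2); lia. Qed.

Lemma eps_bounds : 0 < eps /\ INR n * eps = 1 / 8 /\ eps <= 1 / 16.
Proof.
have h := INRn; have e : INR n * eps = 1 / 8 by rewrite /eps; field; lra.
have h0 : 0 < eps by apply: Rdiv_lt_0_compat; lra.
by split=> //; split=> //; nra.
Qed.

(** Clamping keeps signs and lets the parameters range over all of [nat -> R], so that the flags
    live in a space without boundary. *)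
Definition clamp (t : R) : R := Rmax (- eps) (Rmin eps t).

Lemma clamp_bound t : Rabs (clamp t) <= eps.
Proof.
have [h _] := eps_bounds; apply: Rabs_le; rewrite /clamp; split; first exact: Rmax_l.
by apply: Rmax_lub; [lra | apply: Rmin_l].
Qed.

Lemma clamp_lip a t : Rabs (clamp a - clamp t) <= Rabs (a - t).
Proof.
have [h _] := eps_bounds.
rewrite /clamp /Rmax /Rmin; repeat case: Rle_dec; rewrite /Rabs; repeat case: Rcase_abs; lra.
Qed.

Lemma clamp_le0 t : clamp t <= 0 -> t <= 0.
Proof. have [h _] := eps_bounds; rewrite /clamp /Rmax /Rmin; repeat case: Rle_dec; lra. Qed.

Lemma clamp_ge0 t : 0 <= clamp t -> 0 <= t.
Proof. have [h _] := eps_bounds; rewrite /clamp /Rmax /Rmin; repeat case: Rle_dec; lra. Qed.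

Lemma clamp0 : clamp 0 = 0.
Proof. have [h _] := eps_bounds; rewrite /clamp /Rmax /Rmin; repeat case: Rle_dec; lra. Qed.

Definition off b u (i : nat) : R := clamp (StaircaseCones.coord b i u).

(** For small [t], the squared distance of [1/2 + t] to the nearest integer. *)
Definition bump (t : R) : R := (1 / 2 - Rabs t) ^ 2.

(** Solved from the requirement that [De - Do] be the clamped coordinate 1: the vertical parts are
    [height ^ 2] and [(1 - height) ^ 2], the horizontal ones are sums of [bump]. *)
Definition height u : R :=
  1 / 2 + (clamp (u 1%nat) -
    rsum m (fun i => bump (off true u i) + (-1) * bump (off false u i))) / 2.

(** With [yl], chosen so that in each horizontal coordinate the difference is [1/2 + off true] and
    the sum is [1/2 + off false]: differences govern the even parity and sums the odd one. *)
Definition xl u : Rn n :=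
  mkRn n (fun i => if Nat.eqb i m then u 0%nat else (off false u i - off true u i) / 2).

Definition yl u : Rn n :=
  mkRn n (fun i => if Nat.eqb i m then u 0%nat + height u
                   else (1 + off false u i + off true u i) / 2).

Definition pm b : R := if b then 1 / 2 else - (1 / 2).

(* The lift of [proj (yl u)] reached from [xl u] along the geodesic of parity
   [b] (the deck degree is even for [true]) and sign pattern [s]. *)
Definition yg u b s : Rn n :=
  mkRn n (fun i => if Nat.eqb i m then u 0%nat + (if b then height u else height u - 1)
    else (off false u i - off true u i) / 2 + pm (s i) + (if b then off true u i else - off false u i)).

Lemma mk_low (a : R) f i : (i < m)%nat -> (mkRn n (fun i => if Nat.eqb i m then a else f i)).[i] = f i.
Proof.
move=> im; rewrite mkRnE; last by lia.
by have -> : Nat.eqb i m = false by apply/Nat.eqb_neq; lia.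
Qed.

Lemma mk_top (a : R) f : (mkRn n (fun i => if Nat.eqb i m then a else f i)).[m] = a.
Proof. by rewrite mkRnE ?Nat.eqb_refl //; lia. Qed.

Lemma off_bound b u i : Rabs (off b u i) <= 1 / 16.
Proof. by have [_ [_ h]] := eps_bounds; apply: Rle_trans (clamp_bound _) h. Qed.

Lemma bump_diff a c : Rabs a <= eps -> Rabs c <= eps -> Rabs (bump a - bump c) <= eps.
Proof.
move=> ha hc; have [e0 [_ e1]] := eps_bounds.
have a0 := Rabs_pos a; have c0 := Rabs_pos c.
have -> : bump a - bump c = (Rabs c - Rabs a) * (1 - Rabs a - Rabs c) by rewrite /bump; field.
apply: Rabs_le; split; nra.
Qed.

Lemma bump_lip a c : Rabs a <= eps -> Rabs c <= eps -> Rabs (bump a - bump c) <= Rabs (a - c).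
Proof.
move=> ha hc; have [e0 [_ e1]] := eps_bounds.
have a0 := Rabs_pos a; have c0 := Rabs_pos c.
have -> : bump a - bump c = (Rabs c - Rabs a) * (1 - Rabs a - Rabs c) by rewrite /bump; field.
have h := Rabs_triang_inv2 c a.
rewrite Rabs_mult (Rabs_minus_sym a); rewrite (Rabs_pos_eq (1 - _ - _)); last by lra.
have h0 := Rabs_pos (Rabs c - Rabs a).
by nra.
Qed.

Lemma rsum_abs k f : Rabs (rsum k f) <= rsum k (fun i => Rabs (f i)).
Proof.
elim: k => [|k IH] /=; first by rewrite Rabs_R0; lra.
by apply: Rle_trans (Rabs_triang _ _) _; lra.
Qed.

Lemma height_bound u : 7 / 16 <= height u <= 9 / 16.
Proof.
have [e0 [e1 _]] := eps_bounds; rewrite S_INR in e1.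
set S := rsum m (fun i => bump (off true u i) + (-1) * bump (off false u i)).
have h : Rabs S <= INR m * eps.
  apply: Rle_trans (rsum_abs _ _) _; rewrite -rsum_const; apply: rsum_le => i _.
  have -> : bump (off true u i) + (-1) * bump (off false u i) = bump (off true u i) - bump (off false u i) by ring.
  by apply: bump_diff; apply: clamp_bound.
have := Rabs_bounds _ _ h; have := Rabs_bounds _ _ (clamp_bound (u 1%nat)).
by rewrite /height -/S; lra.
Qed.

Lemma yg_deck u b s :
  deck m (if b then 0 else -1)%Z
    (fun i => if b then (if s i then 0 else -1)%Z else (if s i then 1 else 0)%Z) (yl u) (yg u b s).
Proof.
split=> [i im|]; last by rewrite !mk_top; case: b; ring.
rewrite !mk_low // /pm /sgn; case: b; case: (s i) => /=; field.
Qed.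

Lemma yg_Krel u b s : Krel n (yl u) (yg u b s).
Proof. exact: deck_Krel (yg_deck u b s). Qed.

Lemma De_Do_model u : De m (xl u) (yl u) - Do m (xl u) (yl u) = clamp (u 1%nat).
Proof.
have hb := height_bound u.
rewrite /De /Do !mk_top.
have -> : u 0%nat + height u - u 0%nat = height u by ring.
rewrite nd2_small; last by apply: Rabs_le; lra.
rewrite nd2_small; last by apply: Rabs_le; lra.
rewrite !Rabs_sqr.
have half t : Rabs t <= 1 / 16 -> nd (1 / 2 + t) ^ 2 = bump t.
  move=> ht; have [t1 t2] := Rabs_bounds _ _ ht; rewrite /bump.
  have [t0|t0] := Rle_dec t 0.
    rewrite nd_small; last by apply: Rabs_le; lra.
    by rewrite Rabs_pos_eq ?(Rabs_left1 t) //; [field | lra].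
  have -> : 1 / 2 + t = t - 1 / 2 + IZR 1 by field.
  rewrite nd_addZ nd_small; last by apply: Rabs_le; lra.
  by rewrite (Rabs_left1 (_ - _)) ?(Rabs_pos_eq t); [field | lra | lra].
have -> : rsum m (fun i => nd ((yl u).[i] - (xl u).[i]) ^ 2) = rsum m (fun i => bump (off true u i)).
  apply: rsum_ext => i im; rewrite !mk_low // -half; last exact: off_bound.
  by congr (nd _ ^ 2); field.
have -> : rsum m (fun i => nd ((yl u).[i] + (xl u).[i]) ^ 2) = rsum m (fun i => bump (off false u i)).
  apply: rsum_ext => i im; rewrite !mk_low // -half; last exact: off_bound.
  by congr (nd _ ^ 2); field.
by rewrite /height -rsum_plus -rsum_scal; field.
Qed.

Definition dist_model u : R := dK n (proj m (xl u)) (proj m (yl u)).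

Lemma minimal_lift u z : Krel n (yl u) z -> eucl n (xl u) z = dist_model u ->
  (forall i, (i < m)%nat -> Rabs (z.[i] - (xl u).[i]) <= 1 / 2) /\
  Rabs (z.[m] - (xl u).[m]) <= 1.
Proof.
move=> /Krel_deck[k [t hz]] e; apply: De_eq_eucl.
have [_ e2] := dK_spec m (xl u) (yl u).
rewrite e /dist_model e2.
have dx : deck m 0 (fun _ => 0%Z) (xl u) (xl u) by split=> [i _|]; rewrite /sgn /=; ring.
by case: (De_deck _ _ _ _ _ _ _ _ _ dx hz) => -[_ [-> _]]; [apply: Rmin_l | apply: Rmin_r].
Qed.

(** The bounds on the displacement of a nearest lift leave two values for each integer of the deck
    transformation: two degrees, which are the parities, and two translations per coordinate, which
    are the signs. *)
Lemma minimal_lift_yg u z : Krel n (yl u) z -> eucl n (xl u) z = dist_model u ->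
  exists b s, z = yg u b s.
Proof.
move=> hz e; have [h1 h2] := minimal_lift u z hz e.
have [k [t [Hi Hm]]] := Krel_deck _ _ _ hz.
have hb := height_bound u.
rewrite Hm !mk_top in h2; have {}h2 := Rabs_bounds _ _ h2.
have lo : IZR (-2) < IZR k by lra.
have hi : IZR k < IZR 1 by lra.
move: lo hi => /lt_IZR lo /lt_IZR hi.
have [k0|k1] : k = 0%Z \/ k = (-1)%Z by lia.
  subst k; exists true, (fun i => Z.eqb (t i) 0); apply: Rn_extS => [i im|]; last by rewrite Hm !mk_top; ring.
  have := Rabs_bounds _ _ (h1 i im); have ob := Rabs_bounds _ _ (off_bound true u i).
  rewrite Hi // !mk_low // /sgn /= => hh.
  have lo' : IZR (-2) < IZR (t i) by lra.
  have hi' : IZR (t i) < IZR 1 by lra.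
  move: lo' hi' => /lt_IZR lo' /lt_IZR hi'.
  have [->|->] : t i = 0%Z \/ t i = (-1)%Z by lia.
    by rewrite /pm /=; field.
  by rewrite /pm /=; field.
subst k; exists false, (fun i => Z.eqb (t i) 1); apply: Rn_extS => [i im|]; last by rewrite Hm !mk_top; ring.
have := Rabs_bounds _ _ (h1 i im); have ob := Rabs_bounds _ _ (off_bound false u i).
rewrite Hi // !mk_low // /sgn /= => hh.
have lo' : IZR (-1) < IZR (t i) by lra.
have hi' : IZR (t i) < IZR 2 by lra.
move: lo' hi' => /lt_IZR lo' /lt_IZR hi'.
have [->|->] : t i = 0%Z \/ t i = 1%Z by lia.
  by rewrite /pm /=; field.
by rewrite /pm /=; field.
Qed.

Lemma minimal_side u b s : eucl n (xl u) (yg u b s) = dist_model u ->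
  StaircaseCones.side b u <= 0.
Proof.
move=> e; have [_ e2] := dK_spec m (xl u) (yl u).
have h := De_le_eucl m (xl u) (yg u b s); rewrite e /dist_model e2 in h.
have dx : deck m 0 (fun _ => 0%Z) (xl u) (xl u) by split=> [i _|]; rewrite /sgn /=; ring.
have hd := De_Do_model u.
have hmin := Rmin_l (De m (xl u) (yl u)) (Do m (xl u) (yl u)).
have hmin' := Rmin_r (De m (xl u) (yl u)) (Do m (xl u) (yl u)).
have H := De_deck _ _ _ _ _ _ _ _ _ dx (yg_deck u b s).
rewrite /StaircaseCones.side; case: b H {e} h => -[[//= _ [-> _]]|[//= _ [-> _]]] h.
  by apply: clamp_le0; lra.
suff : 0 <= u 1%nat by lra.
by apply: clamp_ge0; lra.
Qed.

(** A displacement of 1/2 or -1/2 plus the deviation must not exceed 1/2 in absolute value. For the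
    odd parity the deviation enters negatively, which swaps the two signs. *)
Lemma minimal_coord u b s i : (i < m)%nat -> eucl n (xl u) (yg u b s) = dist_model u ->
  (s i = b -> StaircaseCones.coord b i u <= 0) /\
  (s i = negb b -> 0 <= StaircaseCones.coord b i u).
Proof.
move=> im e; have [h _] := minimal_lift u _ (yg_Krel u b s) e.
have := Rabs_bounds _ _ (h i im); rewrite !mk_low // => hh.
have {hh} : - (1 / 2) <= pm (s i) + (if b then off true u i else - off false u i) <= 1 / 2 by lra.
split=> es; move: H; rewrite es; case: b es {e h} => _ /=; rewrite /pm => H.
- by apply: clamp_le0; rewrite -/(off true u i); lra.
- by apply: clamp_le0; rewrite -/(off false u i); lra.
- by apply: clamp_ge0; rewrite -/(off true u i); lra.
- by apply: clamp_ge0; rewrite -/(off false u i); lra.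
Qed.

Definition mid u b s : Kn n := proj m (interp n (1 / 2) (xl u) (yg u b s)).

(** Midpoints of different parity differ by 1/2 modulo integers in the last coordinate. For equal
    parity the last coordinate forces degree 0, and different signs give a difference of 1/2 modulo
    integers in a horizontal coordinate. *)
Lemma mid_separated u b s b' s' : dK n (mid u b s) (mid u b' s') < 1 / 2 ->
  b = b' /\ forall i, (i < m)%nat -> s i = s' i.
Proof.
have [z [/Krel_deck[k [t [Hi Hm]]] e]] :=
  dK_lift m (interp n (1 / 2) (xl u) (yg u b s)) (interp n (1 / 2) (xl u) (yg u b' s')).
rewrite -/(mid u b s) -/(mid u b' s') in e; rewrite -e => lt {e}.
have hm' := Rabs_def2 _ _ (Rle_lt_trans _ _ _ (eucl_coord n (interp n (1 / 2) (xl u) (yg u b s)) z m ltac:(lia)) lt).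
rewrite Hm !mkRnE ?Nat.eqb_refl in hm'; try lia.
have eb : b = b' /\ k = 0%Z.
  case: b b' {Hi Hm z lt} hm' => -[] hm'.
  - have lo : IZR (-1) < IZR k by lra.
    have hi : IZR k < IZR 1 by lra.
    by move: lo hi => /lt_IZR lo /lt_IZR hi; split=> //; lia.
  - have lo : IZR 0 < IZR k by lra.
    have hi : IZR k < IZR 1 by lra.
    by move: lo hi => /lt_IZR lo /lt_IZR hi; lia.
  - have lo : IZR (-1) < IZR k by lra.
    have hi : IZR k < IZR 0 by lra.
    by move: lo hi => /lt_IZR lo /lt_IZR hi; lia.
  - have lo : IZR (-1) < IZR k by lra.
    have hi : IZR k < IZR 1 by lra.
    by move: lo hi => /lt_IZR lo /lt_IZR hi; split=> //; lia.
have [ebb ek] := eb; split=> // i im; subst b' k.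
have hi := Rabs_def2 _ _ (Rle_lt_trans _ _ _ (eucl_coord n (interp n (1 / 2) (xl u) (yg u b s)) z i ltac:(lia)) lt).
rewrite Hi // in hi; rewrite !(mkRnE n (fun i => (xl u).[i] + _)) ?mk_low // in hi; try lia.
rewrite /sgn /pm /= in hi.
case: (s i) (s' i) hi => -[] hi //.
  have lo : IZR 0 < IZR (t i) by lra.
  have hi' : IZR (t i) < IZR 1 by lra.
  by move: lo hi' => /lt_IZR lo /lt_IZR hi'; lia.
have lo : IZR (-1) < IZR (t i) by lra.
have hi' : IZR (t i) < IZR 0 by lra.
by move: lo hi' => /lt_IZR lo /lt_IZR hi'; lia.
Qed.

Definition pr u : Kn n * Kn n := (proj m (xl u), proj m (yl u)).

Definition joins (g : R -> Kn n) (p : Kn n * Kn n) :=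
  min_geodesic (dK n) g /\ g 0 = fst p /\ g 1 = snd p.

(** A minimal geodesic need not have constant speed, so it is recognised by the midpoint it visits,
    at whatever time. *)
Definition follows u (g : R -> Kn n) b s :=
  eucl n (xl u) (yg u b s) = dist_model u /\ exists t, 0 <= t <= 1 /\ g t = mid u b s.

(** A lift of the halfway point of [g] is at half the distance from [xl u] and from some lift of the
    end point, so uniqueness of Euclidean midpoints puts it on a shortest segment. *)
Lemma follows_exists u g : joins g (pr u) -> exists b s, follows u g b s.
Proof.
move=> [mg [g0 g1]]; have [t [t01 ht]] := geodesic_midpoint m g mg.
have h2 := geodesic_additive m g t t mg ltac:(lra) ltac:(lra) ltac:(lra).
have [w ew] := proj_surj m (g t).
rewrite g0 g1 /= -/(dist_model u) ew dK_refl in ht h2.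
have [w' [/proj_eq hw' e1]] := dK_lift m (xl u) w.
rewrite hw' in ew h2 ht e1.
have [z [hz e2]] := dK_lift m w' (yl u).
have [||||em ed] := midpoint_unique n (xl u) z w' (dist_model u).
- exact: dK_ge0.
- by lra.
- by rewrite e2; lra.
- exact: dK_le.
have [b [s ez]] := minimal_lift_yg u z hz ed.
exists b, s; rewrite /follows /mid -ez; split=> //; exists t; split=> //.
by rewrite ew em ez.
Qed.

(** The competing geodesic may be 1/8 too long, and [g] may miss its midpoint by less than 1/8. Then
    [g t] is within 3/16 of the midpoint that [g] visits, and [3/16 + 1/8] is below the separation
    1/2. *)
Lemma follows_unique u g b s b' s' t : joins g (pr u) -> follows u g b s ->
  eucl n (xl u) (yg u b' s') <= dist_model u + 1 / 8 -> 0 <= t <= 1 ->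
  dK n (g t) (mid u b' s') < 1 / 8 -> b = b' /\ forall i, (i < m)%nat -> s i = s' i.
Proof.
move=> [mg [g0 g1]] [e1 [t1 [t101 ht1]]] le t01 lt.
have half c r : eucl n (xl u) (yg u c r) / 2 = eucl n (xl u) (interp n (1 / 2) (xl u) (yg u c r)) /\
    eucl n (xl u) (yg u c r) / 2 = eucl n (interp n (1 / 2) (xl u) (yg u c r)) (yg u c r).
  split.
    rewrite -{2}(interp0 n (xl u) (yg u c r)) eucl_interp Rabs_left1; last by lra.
    by field.
  rewrite -{3}(interp1 n (xl u) (yg u c r)) eucl_interp Rabs_left1; last by lra.
  by field.
have near c r : dK n (g 0) (mid u c r) <= eucl n (xl u) (yg u c r) / 2 /\
    dist_model u - eucl n (xl u) (yg u c r) / 2 <= dK n (g 0) (mid u c r).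
  have [h1 h2] := half c r; split; first by rewrite g0 h1; apply: dK_le_eucl.
  have := dK_triangle m (mid u c r) (proj m (xl u)) (proj m (yl u)).
  have -> : proj m (yl u) = proj m (yg u c r) by apply/proj_eq; apply: yg_Krel.
  have := dK_le_eucl m (interp n (1 / 2) (xl u) (yg u c r)) (yg u c r).
  rewrite -/(mid u c r) -h2 g0 /= /dist_model.
  have -> : proj m (yl u) = proj m (yg u c r) by apply/proj_eq; apply: yg_Krel.
  by lra.
have D1 : dK n (g 0) (g 1) = dist_model u by rewrite g0 g1.
have hm1 : dK n (g 0) (g t1) = dK n (g 0) (g 1) / 2.
  by have := near b s; rewrite D1 ht1 e1; lra.
have h3 := geodesic_from_midpoint m g t1 t mg t101 t01 hm1.
apply: (mid_separated u).
have := near b' s'.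
have tr1 := dK_triangle m (g t) (g 0) (mid u b' s').
have tr2 := dK_triangle m (mid u b' s') (g 0) (g t).
have tr3 := dK_triangle m (g t) (mid u b s) (mid u b' s').
rewrite (dK_sym m (mid u b' s') (g t)) in tr2; rewrite -ht1 in tr3 *.
rewrite D1 in h3 => nn.
have : Rabs (dK n (g 0) (g t) - dist_model u / 2) <= 3 / 16 by apply: Rabs_le; lra.
by lra.
Qed.

Definition close (rho : R) u u' := forall i, (i < 2 * m + 2)%nat -> Rabs (u' i - u i) < rho.

Lemma model_continuous u e : 0 < e -> exists rho, 0 < rho /\ forall u', close rho u u' ->
  eucl n (xl u) (xl u') <= e /\ eucl n (yl u) (yl u') <= e /\
  (forall b s, eucl n (yg u b s) (yg u' b s) <= e /\ dK n (mid u b s) (mid u' b s) <= e).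
Proof.
move=> e0; have N2 := INRn.
(* Coordinates move by at most [2 n rho], and passing from coordinates to the Euclidean distance
   costs another factor [n]. *)
pose rho := e / (2 * INR n * INR n).
have rho0 : 0 < rho by apply: Rdiv_lt_0_compat => //; nra.
have erho : INR n * (2 * INR n * rho) = e by rewrite /rho; field; lra.
exists rho; split=> // u' cl.
have off_close b i : (i < m)%nat -> - rho <= off b u i - off b u' i <= rho.
  move=> im; apply: Rabs_bounds; apply: Rle_trans (clamp_lip _ _) _.
  rewrite Rabs_minus_sym; apply/Rlt_le/cl.
  by case: b => /=; lia.
have [c0 c1] := Rabs_def2 _ _ (cl 0%nat ltac:(lia)).
have hh : Rabs (height u - height u') <= INR n * rho.
  have h1 : Rabs (clamp (u 1%nat) - clamp (u' 1%nat)) <= rho.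
    apply: Rle_trans (clamp_lip _ _) _; rewrite Rabs_minus_sym; apply/Rlt_le/cl; lia.
  set S := rsum m (fun i => bump (off true u i) + (-1) * bump (off false u i)).
  set S' := rsum m (fun i => bump (off true u' i) + (-1) * bump (off false u' i)).
  have h2 : Rabs (S + (-1) * S') <= INR m * (2 * rho).
    rewrite /S /S' rsum_scal rsum_plus -rsum_const; apply: Rle_trans (rsum_abs _ _) _.
    apply: rsum_le => i im.
    have b1 := bump_lip _ _ (clamp_bound (StaircaseCones.coord true i u)) (clamp_bound (StaircaseCones.coord true i u')).
    have b2 := bump_lip _ _ (clamp_bound (StaircaseCones.coord false i u)) (clamp_bound (StaircaseCones.coord false i u')).
    have o1 := Rabs_le _ _ (off_close true i im); have o2 := Rabs_le _ _ (off_close false i im).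
    rewrite -!/(off _ _ _) in b1 b2.
    have := Rabs_bounds _ _ (Rle_trans _ _ _ b1 o1); have := Rabs_bounds _ _ (Rle_trans _ _ _ b2 o2).
    by move=> *; apply: Rabs_le; lra.
  have := Rabs_bounds _ _ h1; have := Rabs_bounds _ _ h2; rewrite /height -/S -/S' => ? ?.
  by apply: Rabs_le; rewrite S_INR; lra.
have {}hh := Rabs_bounds _ _ hh.
have r0 : rho <= INR n * rho by nra.
have lowx i : (i < m)%nat -> - rho <= (xl u).[i] - (xl u').[i] <= rho.
  by move=> im; rewrite !mk_low //; have := off_close true i im; have := off_close false i im; lra.
have topx : - rho <= (xl u).[m] - (xl u').[m] <= rho by rewrite !mk_top; lra.
have lowg b s i : (i < m)%nat -> - (2 * INR n * rho) <= (yg u b s).[i] - (yg u' b s).[i] <= 2 * INR n * rho.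
  move=> im; rewrite !mk_low //; have := off_close true i im; have := off_close false i im.
  by case: b; lra.
have topg b s : - (2 * INR n * rho) <= (yg u b s).[m] - (yg u' b s).[m] <= 2 * INR n * rho.
  by rewrite !mk_top; case: b; lra.
have split_n (Q : nat -> Prop) : (forall i, (i < m)%nat -> Q i) -> Q m -> forall i, (i < n)%nat -> Q i.
  move=> Hl Ht i iN; have [->//|im] : i = m \/ (i < m)%nat by lia.
  exact: Hl.
rewrite -erho; split; [|split].
- apply: eucl_le_coord; first by nra.
  by apply: split_n => [i im|]; apply: Rabs_le; [have := lowx i im | ]; lra.
- apply: eucl_le_coord; first by nra.
  apply: split_n => [i im|]; apply: Rabs_le; last by rewrite !mk_top; lra.
  by rewrite !mk_low //; have := off_close true i im; have := off_close false i im; lra.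
move=> b s; split.
  apply: eucl_le_coord; first by nra.
  by apply: split_n => [i im|]; apply: Rabs_le; [apply: lowg | apply: topg].
apply: Rle_trans (dK_le_eucl _ _ _) _; apply: eucl_le_coord; first by nra.
apply: split_n => [i im|]; rewrite !(mkRnE n (fun i => (xl _).[i] + _)); try lia; apply: Rabs_le.
  by have := lowg b s i im; have := lowx i im; lra.
by have := topg b s; lra.
Qed.

End LocalModel.

Lemma GC_lower_bound m k : (1 <= m)%nat -> GC_le (dK (S m)) k -> (2 * S m <= k)%nat.
Proof.
move=> m1 [E [cov [disj sec]]].
have [//|lt] : (2 * S m <= k)%nat \/ (k < 2 * S m)%nat by lia.
exfalso.
pose c p := proj1_sig (constructive_indefinite_description _ (cov p)).
have cP p : (c p <= k)%nat /\ E (c p) p := proj2_sig (constructive_indefinite_description _ (cov p)).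
have secP i : exists s : Kn (S m) * Kn (S m) -> R -> Kn (S m), (i <= k)%nat ->
    (forall p, E i p -> joins m (s p) p) /\ co_continuous (dK (S m)) (E i) s.
  have [ik|ik] : (i <= k)%nat \/ ~ (i <= k)%nat by lia.
    by have [_ [s [h1 h2]]] := sec i ik; exists s.
  by exists (fun p _ => fst p).
pose sc i := proj1_sig (constructive_indefinite_description _ (secP i)).
have scP i := proj2_sig (constructive_indefinite_description _ (secP i)).
pose col u := c (pr m u).
pose g u := sc (col u) (pr m u).
have gj u : joins m (g u) (pr m u).
  have [ck Ec] := cP (pr m u); have [h _] := scP (col u) ck.
  exact: h.
have lab_ex u : exists bs : bool * (nat -> bool), follows m u (g u) (fst bs) (snd bs).
  by have [b [s h]] := follows_exists m m1 u (g u) (gj u); exists (b, s).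
pose lab u := proj1_sig (constructive_indefinite_description _ (lab_ex u)).
have labP u : follows m u (g u) (fst (lab u)) (snd (lab u)) :=
  proj2_sig (constructive_indefinite_description _ (lab_ex u)).
pose par u := fst (lab u); pose sg u := snd (lab u).
pose idx u := first_fork m (par u) (sg u).
have gauge u : exists rho, 0 < rho /\ forall u',
     (forall i, (i < 2 * m + 2)%nat -> Rabs (u' i - u i) < rho) ->
     col u' = col u -> par u' = par u /\ idx u' = idx u.
  have [ck Ec] := cP (pr m u); have [_ hco] := scP (col u) ck.
  pose D := dist_model m u.
  (* The points that keep away from the midpoints of all other nearly minimal geodesics. A margin
     [e] uniform in the patterns makes this set open; the geodesic chosen at [u] keeps a distance of
     1/8. *)
  pose U z := exists e, 0 < e /\ forall b s,
    ~ (par u = b /\ forall i, (i < m)%nat -> sg u i = s i) ->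
    eucl (S m) (xl m u) (yg m u b s) <= D + 1 / 8 -> 1 / 16 + e <= dK (S m) z (mid m u b s).
  have oU : open_in (dK (S m)) U.
    move=> z [e [e0 he]]; exists (e / 2); split; first by lra.
    move=> z' hz'; exists (e / 2); split; first by lra.
    move=> b s h1 h2; have := he b s h1 h2; have := dK_triangle m z' z (mid m u b s).
    by lra.
  have gU t : 0 <= t <= 1 -> U (g u t).
    move=> t01; exists (1 / 16); split; first by lra.
    move=> b s h1 h2; apply: Rnot_lt_le => h3; apply: h1.
    by apply: (follows_unique m m1 u (g u) (par u) (sg u) b s t (gj u) (labP u) h2 t01); lra.
  have [e [e0 he]] := hco (fun t => 0 <= t <= 1) U (compact_P3 0 1) (fun t h => h) oU (pr m u) Ec gU.
  (* [e / 2] keeps the pair within reach of [he]. The allowance 1/8 for near minimality is four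
     times 1/32: two for the change of distance and one for each end of the segment. *)
  have [|rho [rho0 hrho]] := model_continuous m m1 u (Rmin (e / 2) (1 / 32)).
    by apply: Rmin_glb_lt; lra.
  exists rho; split=> // u' cl cc.
  have [hx [hy hg]] := hrho u' cl.
  have e1 := Rmin_l (e / 2) (1 / 32); have e2 := Rmin_r (e / 2) (1 / 32).
  have [_ Ec'] := cP (pr m u'); rewrite -/(col u') cc in Ec'.
  have hU := he (pr m u') Ec'.
  have hpx := dK_le_eucl m (xl m u) (xl m u'); have hpy := dK_le_eucl m (yl m u) (yl m u').
  have {hU} hU : forall t, 0 <= t <= 1 -> U (g u' t).
    have -> : g u' = sc (col u) (pr m u') by rewrite /g cc.
    by apply: hU; rewrite /dprod /=; apply: Rmax_lub_lt; lra.
  have [f1 [t' [t01' ht']]] := labP u'.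
  rewrite -/(par u') -/(sg u') in f1 ht'.
  have same : par u = par u' /\ forall i, (i < m)%nat -> sg u i = sg u' i.
    apply: NNPP => ns; have [e' [e'0 H]] := hU t' t01'.
    have [hg1 hg2] := hg (par u') (sg u').
    have dD : dist_model m u' <= D + 1 / 16.
      rewrite /D /dist_model.
      have t1 := dK_triangle m (proj m (xl m u)) (proj m (xl m u')) (proj m (yl m u')).
      have t2 := dK_triangle m (proj m (yl m u)) (proj m (xl m u)) (proj m (yl m u')).
      by rewrite (dK_sym m (proj m (xl m u')) (proj m (xl m u))) in t1; lra.
    have t1 := eucl_triangle (S m) (xl m u') (xl m u) (yg m u (par u') (sg u')).
    have t2 := eucl_triangle (S m) (yg m u' (par u') (sg u')) (xl m u') (yg m u (par u') (sg u')).
    rewrite (eucl_sym _ (yg m u' _ _)) in t2.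
    have := H _ _ ns ltac:(lra); rewrite ht' dK_sym; lra.
  have [sp si] := same; split=> //.
  by rewrite /idx -sp; apply: first_fork_ext => i im; rewrite si.
pose u0 (i : nat) := 0; pose u1 i := match i with 0%nat => 1 | _ => 0 end.
have off0 b i : off m b u0 i = 0 by rewrite /off /StaircaseCones.coord /u0 clamp0.
have off1 b i : off m b u1 i = 0 by rewrite /off /StaircaseCones.coord /u1 clamp0.
have h01 : height m u1 = height m u0.
  by rewrite /height; congr (_ + (_ - _) / _); apply: rsum_ext => i _; rewrite !off0 !off1.
have epr : pr m u0 = pr m u1.
  rewrite /pr; congr (_, _); apply/proj_eq.
    apply: (deck_Krel m 1 (fun _ => 0%Z)); split=> [i im|].
      by rewrite !mk_low // !off0 !off1 /sgn /=; field.
    by rewrite !mk_top /u0 /u1; ring.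
  apply: (deck_Krel m 1 (fun _ => 1%Z)); split=> [i im|].
    by rewrite !mk_low // !off0 !off1 /sgn /=; field.
  by rewrite !mk_top h01 /u0 /u1; ring.
have ecol : col u0 = col u1 by rewrite /col epr.
have [||||||ep ei] := @StaircaseCones.axis_colour_determines_label m (S k) col par idx _ _ _ _ _ gauge _ u0 u1 (fun _ => eq_refl) (fun _ => eq_refl) ecol.
- by move=> u; have [h _] := cP (pr m u); rewrite /col; lia.
- by move=> u; have [] := first_forkP m (par u) (sg u).
- by move=> u; have [f1 _] := labP u; apply: minimal_side f1.
- move=> u i; have [f1 _] := labP u; have [h1 [h2 h3]] := first_forkP m (par u) (sg u) => ik.
  have [H _] := minimal_coord m m1 u _ _ i ltac:(rewrite /idx in ik; lia) f1.
  by apply: H; apply: h2.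
- move=> u ik; have [f1 _] := labP u; have [h1 [h2 h3]] := first_forkP m (par u) (sg u).
  have [_ H] := minimal_coord m m1 u _ _ (idx u) ltac:(rewrite /idx in ik *; lia) f1.
  by apply: H; apply: h3.
- by lia.
have eg : g u1 = g u0 by rewrite /g -ecol -epr.
have [f1 [t' [t01' ht']]] := labP u1.
rewrite -/(par u1) -/(sg u1) eg in f1 ht'.
(* At the centre the deviations vanish, so the reflection of degree -1 acts on the horizontal
   displacements just by negating the signs. *)
have flip b s : mid m u1 b s = mid m u0 b (fun i => negb (s i)).
  apply/proj_eq; apply: (deck_Krel m (-1) (fun _ => 0%Z)); split=> [i im|].
    rewrite !(mkRnE _ (fun i => (xl _ _).[i] + _)); try lia.
    by rewrite !mk_low // !off0 !off1 /sgn /pm /=; case: b; case: (s i) => /=; field.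
  rewrite !(mkRnE _ (fun i => (xl _ _).[i] + _)); try lia.
  by rewrite !mk_top h01 /u0 /u1; case: b; field.
have flipd b s : eucl (S m) (xl m u1) (yg m u1 b s) =
    eucl (S m) (xl m u0) (yg m u0 b (fun i => negb (s i))).
  rewrite /eucl !sumsq_rsum; congr (sqrt (_ + _)); last by rewrite !mk_top h01 /u0 /u1; case: b; ring.
  apply: rsum_ext => i im; rewrite !mk_low // !off0 !off1 /pm; case: b; case: (s i) => /=; field.
have eD : dist_model m u1 = dist_model m u0.
  by rewrite -[LHS]/(dK (S m) (fst (pr m u1)) (snd (pr m u1))) -epr.
rewrite flip in ht'; rewrite flipd eD in f1.
have [|||_ es] := follows_unique m m1 u0 (g u0) (par u0) (sg u0) (par u1)
  (fun i => negb (sg u1 i)) t' (gj u0) (labP u0).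
- by lra.
- by [].
- by rewrite ht' dK_refl; lra.
apply: (first_fork_neg m (par u0) (sg u1) m1).
rewrite -(first_fork_ext m (par u0) _ _ es) -/(idx u0) ei /idx ep //.
Qed.

(** * A fundamental domain for pairs *)

Definition bn (P : Prop) : nat :=
  match excluded_middle_informative P with left _ => 1%nat | right _ => 0%nat end.

Lemma bn_true (P : Prop) : P -> bn P = 1%nat.
Proof. by rewrite /bn; case: excluded_middle_informative. Qed.

Lemma bn_false (P : Prop) : ~ P -> bn P = 0%nat.
Proof. by rewrite /bn; case: excluded_middle_informative. Qed.

Lemma bn_le1 P : (bn P <= 1)%nat.
Proof. by rewrite /bn; case: excluded_middle_informative => _; lia. Qed.

Lemma bn_mono (P Q : Prop) : (P -> Q) -> (bn P <= bn Q)%nat.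
Proof. by rewrite /bn; do 2 case: excluded_middle_informative; tauto || lia. Qed.

Lemma bn_iff (P Q : Prop) : (P <-> Q) -> bn P = bn Q.
Proof. by rewrite /bn; do 2 case: excluded_middle_informative; tauto. Qed.

Lemma bn_eq_imp (P Q : Prop) : bn P = bn Q -> Q -> P.
Proof. by rewrite /bn; do 2 case: excluded_middle_informative; tauto || discriminate. Qed.

Fixpoint nsum (k : nat) (f : nat -> nat) : nat :=
  match k with O => O | S k' => (nsum k' f + f k')%nat end.

Lemma nsum_le k f g : (forall i, (i < k)%nat -> (f i <= g i)%nat) -> (nsum k f <= nsum k g)%nat.
Proof.
elim: k => [|k IH] H //=; have := H k ltac:(lia).
have := IH (fun i ik => H i ltac:(lia)); lia.
Qed.

Lemma nsum_ext k f g : (forall i, (i < k)%nat -> f i = g i) -> nsum k f = nsum k g.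
Proof.
elim: k => [|k IH] H //=; rewrite (H k); last by lia.
by rewrite (IH (fun i ik => H i ltac:(lia))).
Qed.

Lemma nsum_le_eq k f g : (forall i, (i < k)%nat -> (f i <= g i)%nat) ->
  (nsum k g <= nsum k f)%nat -> forall i, (i < k)%nat -> f i = g i.
Proof.
elim: k => [|k IH] H /= le i ik; first by lia.
have h1 := nsum_le k f g (fun i ik => H i ltac:(lia)); have h2 := H k ltac:(lia).
have [->|ik'] : i = k \/ (i < k)%nat by lia.
  by lia.
by apply: IH => //; [move=> j jk; apply: H; lia | lia].
Qed.

Lemma nsum_const k c : nsum k (fun _ => c) = (k * c)%nat.
Proof. by elim: k => [|k IH] //=; rewrite IH; lia. Qed.

Lemma nsum_INR k f : INR (nsum k f) = rsum k (fun i => INR (f i)).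
Proof. by elim: k => [|k IH] //=; rewrite plus_INR IH. Qed.

Definition integral (t : R) : Prop := exists k, t = IZR k.
Definition halfodd (t : R) : Prop := exists k, t = IZR k + 1 / 2.

(** Doubling treats integers and half-odd numbers at once. A number with this property is close to
    such a value only if it equals it. *)
Definition gap (g t : R) : Prop := forall k, 2 * t = IZR k \/ g <= Rabs (2 * t - IZR k).

Definition related (t t' : R) : Prop :=
  exists k, t' = t + IZR k \/ t' = - t + IZR k.

Lemma related_integral t t' : related t t' -> integral t -> integral t'.
Proof.
move=> [k [->|->]] [l ->]; first by exists (l + k)%Z; rewrite plus_IZR.
by exists (- l + k)%Z; rewrite plus_IZR opp_IZR.
Qed.

Lemma related_integral2 t t' : related t t' -> integral (2 * t) -> integral (2 * t').
Proof.
move=> [k [->|->]] [l e].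
  by exists (l + 2 * k)%Z; rewrite plus_IZR mult_IZR; lra.
by exists (- l + 2 * k)%Z; rewrite plus_IZR opp_IZR mult_IZR; lra.
Qed.

Lemma related_halfodd t t' : related t t' -> halfodd t -> halfodd t'.
Proof.
move=> [k [->|->]] [l ->]; first by exists (l + k)%Z; rewrite plus_IZR; lra.
by exists (- l + k - 1)%Z; rewrite minus_IZR plus_IZR opp_IZR; lra.
Qed.

Lemma related_gap g t t' : related t t' -> gap g t -> gap g t'.
Proof.
move=> [k [->|->]] H j.
  have [e|le] := H (j - 2 * k)%Z; rewrite minus_IZR mult_IZR in e || rewrite minus_IZR mult_IZR in le.
    by left; lra.
  right; have -> : 2 * (t + IZR k) - IZR j = 2 * t - (IZR j - 2 * IZR k) by ring.
  exact: le.
have [e|le] := H (- j + 2 * k)%Z; rewrite plus_IZR opp_IZR mult_IZR in e || rewrite plus_IZR opp_IZR mult_IZR in le.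
  by left; lra.
right; rewrite -Rabs_Ropp.
have -> : - (2 * (- t + IZR k) - IZR j) = 2 * t - (- IZR j + 2 * IZR k) by ring.
exact: le.
Qed.

Lemma related_sym t t' : related t t' -> related t' t.
Proof.
move=> [k [->|->]]; first by exists (- k)%Z; left; rewrite opp_IZR; ring.
by exists k; right; ring.
Qed.

Lemma gap_exists t : exists g, 0 < g /\ gap g t.
Proof.
pose z := nint (2 * t).
have half k : k <> z -> 1 / 2 <= Rabs (2 * t - IZR k).
  move=> ne; have [h1 h2] := Rabs_bounds _ _ (nd_half (2 * t)); rewrite -/z in h1 h2.
  have [lt|gt] : (k + 1 <= z)%Z \/ (z + 1 <= k)%Z by lia.
    move: lt => /IZR_le; rewrite plus_IZR => lt.
    by apply: Rle_trans (Rle_abs _); lra.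
  move: gt => /IZR_le; rewrite plus_IZR => gt.
  by rewrite Rabs_minus_sym; apply: Rle_trans (Rle_abs _); lra.
have [e|ne] := Req_dec (2 * t) (IZR z).
  exists (1 / 2); split; first by lra.
  move=> k; have [->|nk] := Z.eq_dec k z; [by left | by right; apply: half].
exists (Rmin (1 / 2) (Rabs (2 * t - IZR z))); split.
  by apply: Rmin_glb_lt; [lra | apply: Rabs_pos_lt; lra].
move=> k; right; have [->|nk] := Z.eq_dec k z; first exact: Rmin_r.
exact: Rle_trans (Rmin_l _ _) (half k nk).
Qed.

Lemma gap_le g g' t : g' <= g -> gap g t -> gap g' t.
Proof. by move=> le H k; case: (H k) => h; [left | right; lra]. Qed.

Lemma gap_exists_finite (f : nat -> R) N :
  exists g, 0 < g /\ forall i, (i < N)%nat -> gap g (f i).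
Proof.
elim: N => [|N [g [g0 IH]]]; first by exists 1; split=> [|i]; [lra | lia].
have [g' [g'0 H]] := gap_exists (f N).
exists (Rmin g g'); split; first exact: Rmin_glb_lt.
move=> i iN; have [->|iN'] : i = N \/ (i < N)%nat by lia.
  exact: gap_le (Rmin_r _ _) H.
by apply: gap_le (Rmin_l _ _) (IH i iN').
Qed.

Lemma gap_snap g t t' k : gap g t -> 2 * Rabs (t - t') < g -> 2 * t' = IZR k -> t = t'.
Proof.
move=> H lt e; have [h|h] := H k; first by lra.
rewrite -e in h; have e2 : 2 * t - 2 * t' = 2 * (t - t') by ring.
by rewrite e2 Rabs_mult (Rabs_pos_eq 2) in h; lra.
Qed.

Lemma gap_le_half g t t' k : gap g t -> 2 * Rabs (t - t') < g -> 2 * t' <= IZR k -> 2 * t <= IZR k.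
Proof.
move=> H lt le; have [|h] := H k; first by lra.
have := Rle_abs (t - t'); have [l|l] := Rle_dec (2 * t) (IZR k); first by lra.
by rewrite Rabs_pos_eq in h; lra.
Qed.

Lemma gap_ge_half g t t' k : gap g t -> 2 * Rabs (t - t') < g -> IZR k <= 2 * t' -> IZR k <= 2 * t.
Proof.
move=> H lt le; have [|h] := H k; first by lra.
have := Rle_abs (- (t - t')); rewrite Rabs_Ropp.
have [l|l] := Rle_dec (IZR k) (2 * t); first by lra.
by rewrite Rabs_left in h; lra.
Qed.

Section FundamentalDomain.
Variable m : nat.
Local Notation n := (S m).
Implicit Types x y : Rn n.

Definition ee x y : R := De m x y - Do m x y.

(** Translating both points together keeps the difference and moves the sum by an even integer,
    whence the interval of length 2 for sums. In a tie of the parities, the lift with positive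
    vertical displacement is preferred. *)
Definition fund x y : Prop :=
  0 <= x.[m] < 1 /\
  (forall i, (i < m)%nat -> - (1 / 2) < y.[i] - x.[i] <= 1 / 2) /\
  (forall i, (i < m)%nat -> - (1 / 2) < x.[i] + y.[i] <= 3 / 2) /\
  -1 < y.[m] - x.[m] <= 1 /\ ee x y <= 0 /\ (ee x y = 0 -> 0 < y.[m] - x.[m]).

(** The closed version: enough to realise the distance, and all that is known of a lift close to a
    normalised lift of a neighbouring pair. *)
Definition almost_fund x y : Prop :=
  (forall i, (i < m)%nat -> Rabs (y.[i] - x.[i]) <= 1 / 2) /\
  Rabs (y.[m] - x.[m]) <= 1 /\ ee x y <= 0.

Lemma fund_almost x y : fund x y -> almost_fund x y.
Proof.
move=> [_ [h [_ [hw [he _]]]]]; split; [move=> i im; have := h i im | split=> //];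
  move=> *; apply: Rabs_le; lra.
Qed.

Lemma fund_dist x y : almost_fund x y -> eucl n x y = dK n (proj m x) (proj m y).
Proof.
move=> [h [hw he]]; have [d0 e] := dK_spec m x y.
have e1 := eucl_eq_De m x y h hw.
rewrite Rmin_left in e; last by rewrite /ee in he; lra.
apply: Rsqr_inj => //; first exact: eucl_ge0.
by rewrite !Rsqr_pow2 e1 e.
Qed.

Lemma ee_deck k t k' t' x x' y y' : deck m k t x x' -> deck m k' t' y y' ->
  (Z.even (k' - k) = true /\ ee x' y' = ee x y) \/
  (Z.even (k' - k) = false /\ ee x' y' = - ee x y).
Proof.
move=> hx hy; rewrite /ee; case: (De_deck _ _ _ _ _ _ _ _ _ hx hy) => -[ev [-> ->]].
  by left.
by right; split=> //; ring.
Qed.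

Lemma nonint_small (k : Z) : -1 < IZR k -> IZR k < 1 -> k = 0%Z.
Proof. by move=> /lt_IZR h1 /lt_IZR h2; lia. Qed.

Lemma fund_unique x y x' y' : fund x y -> fund x' y' -> Krel n x x' -> Krel n y y' ->
  x = x' /\ y = y'.
Proof.
move=> [c [d [s [w [e ew]]]]] [c' [d' [s' [w' [e' ew']]]]].
move=> /Krel_deck[k [t hx]] /Krel_deck[k' [t' hy]].
have he := ee_deck _ _ _ _ _ _ _ _ hx hy.
have [Hx Hxm] := hx; have [Hy Hym] := hy.
have k0 : k = 0%Z by apply: nonint_small; lra.
subst k; rewrite Z.sub_0_r in he.
have k'0 : k' = 0%Z.
  case: he => -[ev he].
    have l : IZR (-2) < IZR k' by lra.
    have u : IZR k' < IZR 2 by lra.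
    move: l u => /lt_IZR l /lt_IZR u.
    have [->|[h|h]] : k' = 0%Z \/ k' = 1%Z \/ k' = (-1)%Z by lia.
    - by [].
    - by rewrite h in ev.
    - by rewrite h in ev.
  (* An odd relative degree negates [ee], so both lifts are tied; by the tie rule both displacements
     lie in [(0, 1]], and they differ by an integer. *)
  have e0 : ee x y = 0 by lra.
  have e0' : ee x' y' = 0 by lra.
  have {}ew := ew e0; have {}ew' := ew' e0'.
  by apply: nonint_small; lra.
subst k'; rewrite /= in Hxm Hym.
have tt i : (i < m)%nat -> t i = 0%Z /\ t' i = 0%Z.
  move=> im; have hxi := Hx i im; have hyi := Hy i im; rewrite /sgn /= in hxi hyi.
  have := d i im; have := s i im; have := d' i im; have := s' i im => ? ? ? ?.
  have e1 : (t' i - t i)%Z = 0%Z by apply: nonint_small; rewrite minus_IZR; lra.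
  have e2 : t' i = t i by lia.
  rewrite e2 in hyi *; have z : t i = 0%Z by apply: nonint_small; lra.
  by rewrite z.
split; apply: Rn_extS => [i im|]; try lra; have [h h'] := tt i im.
  by rewrite Hx // h /sgn /=; ring.
by rewrite Hy // h' /sgn /=; ring.
Qed.

Lemma floor_shift (t : R) : exists k, 0 <= t + IZR k < 1.
Proof.
exists (- Int_part t)%Z; rewrite opp_IZR; have [h1 h2] := base_Int_part t; lra.
Qed.

Lemma ceil_shift (a t : R) : exists k, a < t + IZR k <= a + 1.
Proof.
have [k h] := floor_shift (a - t); exists (1 - k)%Z.
by rewrite minus_IZR; lra.
Qed.

Lemma even_ceil_shift (t : R) : exists k, Z.even k = true /\ -1 < t + IZR k <= 1.
Proof.
have [k h] := ceil_shift (- (1 / 2)) (t / 2); exists (2 * k)%Z.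
by rewrite mult_IZR Z.even_mul; split=> //; lra.
Qed.

Lemma fund_exists (p : Kn n * Kn n) : exists x y, p = (proj m x, proj m y) /\ fund x y.
Proof.
case: p => p q; have [x0 ->] := proj_surj m p; have [y0 ->] := proj_surj m q.
have [kc hc] := floor_shift (x0.[m]).
pose x1 := act m kc (fun _ => 0%Z) x0.
have hx1 : Krel n x0 x1 by apply: Krel_act.
have [y1 [hy1 [w1 [e1 ew1]]]] : exists y1, Krel n y0 y1 /\ -1 < y1.[m] - x1.[m] <= 1 /\
    ee x1 y1 <= 0 /\ (ee x1 y1 = 0 -> 0 < y1.[m] - x1.[m]).
  have dx : deck m 0 (fun _ => 0%Z) x1 x1 by split=> [i _|]; rewrite /sgn /=; ring.
  (* [ya] and [yb] are the candidates of even and odd degree, with vertical displacement in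
     [(-1, 1]]. In a tie at least one of these is positive. *)
  have [ka [eva ha]] := even_ceil_shift (y0.[m] - x1.[m]).
  have [kb [evb hb]] := even_ceil_shift (y0.[m] - x1.[m] + 1).
  pose ya := act m ka (fun _ => 0%Z) y0; pose yb := act m (1 + kb) (fun _ => 0%Z) y0.
  have ma : ya.[m] = y0.[m] + IZR ka by apply: act_top.
  have mb : yb.[m] = y0.[m] + (1 + IZR kb) by rewrite /yb act_top plus_IZR.
  have hxy : ee x1 ya = ee x1 y0.
    by case: (ee_deck _ _ _ _ _ _ _ _ dx (act_deck m ka (fun _ => 0%Z) y0)) => -[]; rewrite Z.sub_0_r eva.
  have hxb : ee x1 yb = - ee x1 y0.
    by case: (ee_deck _ _ _ _ _ _ _ _ dx (act_deck m (1 + kb) (fun _ => 0%Z) y0)) => -[]; rewrite Z.sub_0_r Z.even_add evb.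
  have [lt|[eq|gt]] := Rtotal_order (ee x1 y0) 0.
  - by exists ya; split; [apply: Krel_act | rewrite ma; split; [lra | split; lra]].
  - have [pa|na] := Rlt_dec 0 (ya.[m] - x1.[m]).
      by exists ya; split; [apply: Krel_act | split; [lra | split; lra]].
    exists yb; split; first exact: Krel_act.
    split; first by lra.
    split; first by lra.
    move=> _; have hh : IZR (1 + kb - ka) <> 0.
      move/eq_IZR_R0 => z; have : Z.even (1 + kb - ka) = true by rewrite z.
      by rewrite Z.even_sub Z.even_add eva evb.
    have [//|nb] := Rlt_dec 0 (yb.[m] - x1.[m]).
    have z : (1 + kb - ka)%Z = 0%Z.
      by apply: nonint_small; rewrite minus_IZR plus_IZR; lra.
    by rewrite z in hh.
  - by exists yb; split; [apply: Krel_act | rewrite mb; split; [lra | split; lra]].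
pose td i := proj1_sig (constructive_indefinite_description _ (ceil_shift (- (1 / 2)) (y1.[i] - x1.[i]))).
have hd i := proj2_sig (constructive_indefinite_description _ (ceil_shift (- (1 / 2)) (y1.[i] - x1.[i]))).
have tsE i : exists k, - (1 / 2) < x1.[i] + y1.[i] + IZR (td i) + 2 * IZR k <= 3 / 2.
  have [k hk] := ceil_shift (- (1 / 4)) ((x1.[i] + y1.[i] + IZR (td i)) / 2); exists k; lra.
pose ts i := proj1_sig (constructive_indefinite_description _ (tsE i)).
have hs i := proj2_sig (constructive_indefinite_description _ (tsE i)).
pose x2 := act m 0 ts x1; pose y2 := act m 0 (fun i => td i + ts i)%Z y1.
exists x2, y2; split.
  congr (_, _); apply/proj_eq.
    by apply: rst_trans hx1 _; apply: Krel_act.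
  by apply: rst_trans hy1 _; apply: Krel_act.
have xl i : (i < m)%nat -> x2.[i] = x1.[i] + IZR (ts i).
  by move=> im; rewrite act_low // /sgn /=; ring.
have yl i : (i < m)%nat -> y2.[i] = y1.[i] + IZR (td i) + IZR (ts i).
  by move=> im; rewrite act_low // /sgn /= plus_IZR; ring.
have xm : x2.[m] = x1.[m] by rewrite act_top; ring.
have ym : y2.[m] = y1.[m] by rewrite act_top; ring.
have e2 : ee x2 y2 = ee x1 y1.
  by case: (ee_deck _ _ _ _ _ _ _ _ (act_deck m 0 ts x1) (act_deck m 0 (fun i => td i + ts i)%Z y1)) => -[].
rewrite /fund xm ym e2; split; first by rewrite /x1 act_top.
split; first by move=> i im; rewrite xl // yl //; have := hd i; rewrite -/(td i); lra.
split; last by [].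
by move=> i im; rewrite xl // yl //; have := hs i; rewrite -/(ts i); lra.
Qed.

Definition cC x := integral (x.[m]).
Definition cD x y i := halfodd (y.[i] - x.[i]).
(** The interior value 1/2 counts as well: in a tie an odd transformation turns sums into
    differences up to sign and integers, so the condition has to be periodic like [cD]. *)
Definition cS x y i := halfodd (x.[i] + y.[i]).
Definition cH x y := ee x y = 0.
(** On normalised lifts this means displacement 1. In a tie displacement 0 must count too, since the
    lift of the other parity turns 1 into 0. *)
Definition cW x y := integral (y.[m] - x.[m]) /\ (y.[m] - x.[m] = 0 -> ee x y = 0).
(** The singular point of the quadric cut out by [cH] and [cW], described through half-integers so
    as not to depend on the lift. *)
Definition cV x y := cH x y /\ cW x y /\ forall i, (i < m)%nat ->
  integral (2 * (y.[i] - x.[i])) /\ integral (2 * (x.[i] + y.[i])).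

Definition cnt x y : nat :=
  (bn (cC x) + nsum m (fun i => bn (cD x y i) + bn (cS x y i)) +
   bn (cH x y) + bn (cW x y) + bn (cV x y))%nat.

Lemma deck_related k t k' t' x x' y y' : deck m k t x x' -> deck m k' t' y y' ->
  related (x.[m]) (x'.[m]) /\ related (y.[m] - x.[m]) (y'.[m] - x'.[m]) /\
  forall i, (i < m)%nat ->
  (Z.even (k' - k) = true /\ related (y.[i] - x.[i]) (y'.[i] - x'.[i]) /\
     related (x.[i] + y.[i]) (x'.[i] + y'.[i])) \/
  (Z.even (k' - k) = false /\ related (x.[i] + y.[i]) (y'.[i] - x'.[i]) /\
     related (y.[i] - x.[i]) (x'.[i] + y'.[i])).
Proof.
move=> [Hx Hxm] [Hy Hym]; split; first by exists k; left.
split; first by exists (k' - k)%Z; left; rewrite Hxm Hym minus_IZR; ring.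
move=> i im; rewrite Hx // Hy // Z.even_sub /sgn.
case: (Z.even k); case: (Z.even k'); [left | right | right | left]; split=> //; split.
- by exists (t' i - t i)%Z; left; rewrite minus_IZR; ring.
- by exists (t' i + t i)%Z; left; rewrite plus_IZR; ring.
- by exists (t' i - t i)%Z; right; rewrite minus_IZR; ring.
- by exists (t' i + t i)%Z; right; rewrite plus_IZR; ring.
- by exists (t' i - t i)%Z; left; rewrite minus_IZR; ring.
- by exists (t' i + t i)%Z; left; rewrite plus_IZR; ring.
- by exists (t' i - t i)%Z; right; rewrite minus_IZR; ring.
- by exists (t' i + t i)%Z; right; rewrite plus_IZR; ring.
Qed.

Lemma iff_related (Q : R -> Prop) t t' : (forall a b, related a b -> Q a -> Q b) ->
  related t t' -> (Q t <-> Q t').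
Proof. by move=> H r; split; apply: H => //; apply: related_sym. Qed.

Lemma integral_parity (w w' : R) (k : Z) : Rabs w <= 1 -> Rabs w' <= 1 ->
  w' = w + IZR k -> Z.even k = true -> (w = 0 <-> w' = 0).
Proof.
move=> /Rabs_bounds h /Rabs_bounds h' e ev; split=> z.
  have l : IZR (-2) < IZR k by lra.
  have u : IZR k < IZR 2 by lra.
  move: l u => /lt_IZR l /lt_IZR u.
  have [k0|[k1|k1]] : k = 0%Z \/ k = 1%Z \/ k = (-1)%Z by lia.
  - by rewrite k0 in e; lra.
  - by rewrite k1 in ev.
  - by rewrite k1 in ev.
have l : IZR (-2) < IZR k by lra.
have u : IZR k < IZR 2 by lra.
move: l u => /lt_IZR l /lt_IZR u.
have [k0|[k1|k1]] : k = 0%Z \/ k = 1%Z \/ k = (-1)%Z by lia.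
- by rewrite k0 in e; lra.
- by rewrite k1 in ev.
- by rewrite k1 in ev.
Qed.

(** Lifts of opposite parity compete only in a tie. Then [cD] and [cS] are exchanged, and only their
    joint count survives. *)
Lemma cnt_invariant x y x' y' : almost_fund x y -> almost_fund x' y' ->
  Krel n x x' -> Krel n y y' -> cnt x y = cnt x' y'.
Proof.
move=> [_ [w e]] [_ [w' e']] /Krel_deck[k [t hx]] /Krel_deck[k' [t' hy]].
have he := ee_deck _ _ _ _ _ _ _ _ hx hy.
have [rc [rw ri]] := deck_related _ _ _ _ _ _ _ _ hx hy.
have iC : cC x <-> cC x' by apply: iff_related rc; apply: related_integral.
have iWz : integral (y.[m] - x.[m]) <-> integral (y'.[m] - x'.[m]).
  by apply: iff_related rw; apply: related_integral.
have iH : cH x y <-> cH x' y' by rewrite /cH; case: he => -[_ h]; lra.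
have iW : cW x y <-> cW x' y'.
  rewrite /cW; case: he => -[ev h]; last first.
    have z : ee x y = 0 by lra.
    by move: iH; rewrite /cH; tauto.
  have z := integral_parity _ _ (k' - k) w w' _ ev.
  have {}z : y.[m] - x.[m] = 0 <-> y'.[m] - x'.[m] = 0.
    apply: z; have [_ ->] := hx; have [_ ->] := hy; rewrite minus_IZR; ring.
  by rewrite h; tauto.
have iI i : (i < m)%nat -> (integral (2 * (y.[i] - x.[i])) /\ integral (2 * (x.[i] + y.[i]))) <->
    (integral (2 * (y'.[i] - x'.[i])) /\ integral (2 * (x'.[i] + y'.[i]))).
  move=> im; have I2 := iff_related (fun t => integral (2 * t)) _ _ related_integral2.
  by case: (ri i im) => -[_ [r1 r2]]; have := I2 _ _ r1; have := I2 _ _ r2; tauto.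
have iV : cV x y <-> cV x' y'.
  rewrite /cV; split=> -[h1 [h2 h3]]; (split; [tauto | split; [tauto |]]) => i im;
    have := iI i im; have := h3 i im; tauto.
rewrite /cnt (bn_iff _ _ iC) (bn_iff _ _ iH) (bn_iff _ _ iW) (bn_iff _ _ iV).
do 3 congr (_ + _)%nat; congr (_ + _)%nat; apply: nsum_ext => i im.
have I2 := iff_related halfodd _ _ related_halfodd.
case: (ri i im) => -[_ [r1 r2]].
  by rewrite (bn_iff _ _ (I2 _ _ r1)) (bn_iff _ _ (I2 _ _ r2)).
by rewrite (bn_iff (cD x y i) _ (I2 _ _ r2)) (bn_iff (cS x y i) _ (I2 _ _ r1)) Nat.add_comm.
Qed.

Definition gapped (g : R) x y : Prop :=
  gap g (x.[m]) /\ gap g (y.[m] - x.[m]) /\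
  (forall i, (i < m)%nat -> gap g (y.[i] - x.[i]) /\ gap g (x.[i] + y.[i])) /\
  (ee x y = 0 \/ g <= Rabs (ee x y)).

Lemma gapped_exists x y : exists g, 0 < g /\ gapped g x y.
Proof.
have [g1 [p1 h1]] := gap_exists (x.[m]).
have [g2 [p2 h2]] := gap_exists (y.[m] - x.[m]).
have [g3 [p3 h3]] := gap_exists_finite (fun i => y.[i] - x.[i]) m.
have [g4 [p4 h4]] := gap_exists_finite (fun i => x.[i] + y.[i]) m.
have [g5 [p5 h5]] : exists g5, 0 < g5 /\ (ee x y = 0 \/ g5 <= Rabs (ee x y)).
  have [z|nz] := Req_dec (ee x y) 0; first by exists 1; split; [lra | left].
  by exists (Rabs (ee x y)); split; [apply: Rabs_pos_lt | right; lra].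
exists (Rmin (Rmin g1 g2) (Rmin (Rmin g3 g4) g5)).
have a1 := Rmin_l g1 g2; have a2 := Rmin_r g1 g2; have a3 := Rmin_l g3 g4; have a4 := Rmin_r g3 g4.
have b1 := Rmin_l (Rmin g3 g4) g5; have b2 := Rmin_r (Rmin g3 g4) g5.
have c1 := Rmin_l (Rmin g1 g2) (Rmin (Rmin g3 g4) g5); have c2 := Rmin_r (Rmin g1 g2) (Rmin (Rmin g3 g4) g5).
split; first by repeat apply: Rmin_glb_lt.
split; first by apply: gap_le h1; lra.
split; first by apply: gap_le h2; lra.
split; first by move=> i im; split; [apply: gap_le (h3 i im) | apply: gap_le (h4 i im)]; lra.
by case: h5 => h; [left | right; lra].
Qed.

(** The scale [g] is found at the normalised lift but needed at whichever lift lies next to a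
    neighbouring pair. *)
Lemma gapped_invariant g x y x' y' : Krel n x x' -> Krel n y y' ->
  gapped g x y -> gapped g x' y'.
Proof.
move=> /Krel_deck[k [t hx]] /Krel_deck[k' [t' hy]] [h1 [h2 [h3 h4]]].
have he := ee_deck _ _ _ _ _ _ _ _ hx hy.
have [rc [rw ri]] := deck_related _ _ _ _ _ _ _ _ hx hy.
split; first exact: related_gap rc h1.
split; first exact: related_gap rw h2.
split.
  move=> i im; have [g1 g2] := h3 i im.
  by case: (ri i im) => -[_ [r1 r2]]; split; [apply: related_gap r1 _ | apply: related_gap r2 _ |
    apply: related_gap r1 _ | apply: related_gap r2 _].
case: he => -[_ ->]; first by [].
by rewrite Rabs_Ropp; case: h4 => h; [left; lra | right].
Qed.

Definition near (eta : R) x x' := forall i, (i < n)%nat -> Rabs (x.[i] - x'.[i]) <= eta.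

Lemma sqr_lip a b M : 0 <= a <= M -> 0 <= b <= M -> Rabs (a ^ 2 - b ^ 2) <= 2 * M * Rabs (a - b).
Proof.
move=> ha hb; have -> : a ^ 2 - b ^ 2 = (a - b) * (a + b) by ring.
rewrite Rabs_mult (Rabs_pos_eq (a + b)); last by lra.
by have := Rabs_pos (a - b); nra.
Qed.

(** The squared distance to the integers has Lipschitz constant 1, that to the even integers 2, and
    every argument moves by at most [2 * eta]. *)
Lemma ee_lip eta x y x' y' : near eta x x' -> near eta y y' ->
  Rabs (ee x y - ee x' y') <= (4 * INR m + 8) * eta.
Proof.
move=> hx hy.
have dab a b a' b' : Rabs (a - a') <= eta -> Rabs (b - b') <= eta ->
    Rabs (a - b - (a' - b')) <= 2 * eta /\ Rabs (a + b - (a' + b')) <= 2 * eta.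
  move=> /Rabs_bounds h /Rabs_bounds h'; split; apply: Rabs_le; lra.
have low s s' : Rabs (s - s') <= 2 * eta -> - (2 * eta) <= nd s ^ 2 - nd s' ^ 2 <= 2 * eta.
  move=> h; apply: Rabs_bounds.
  have := sqr_lip (nd s) (nd s') (1 / 2) (conj (nd_ge0 s) (nd_half s)) (conj (nd_ge0 s') (nd_half s')).
  have := nd_lip s s'; lra.
have nd2_bound s : 0 <= nd2 s <= 1.
  by have := nd_ge0 (s / 2); have := nd_half (s / 2); rewrite /nd2; lra.
have top s s' : Rabs (s - s') <= 2 * eta -> - (4 * eta) <= nd2 s ^ 2 - nd2 s' ^ 2 <= 4 * eta.
  move=> h; apply: Rabs_bounds.
  have := sqr_lip (nd2 s) (nd2 s') 1 (nd2_bound s) (nd2_bound s').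
  have := nd2_lip s s'; lra.
have lows (f f' : nat -> R) : (forall i, (i < m)%nat -> Rabs (f i - f' i) <= 2 * eta) ->
    - (INR m * (2 * eta)) <= rsum m (fun i => nd (f i) ^ 2) - rsum m (fun i => nd (f' i) ^ 2) <= INR m * (2 * eta).
  move=> H; have e1 := rsum_le m (fun i => nd (f i) ^ 2) (fun i => nd (f' i) ^ 2 + 2 * eta).
  have e2 := rsum_le m (fun i => nd (f' i) ^ 2) (fun i => nd (f i) ^ 2 + 2 * eta).
  rewrite -!rsum_plus !rsum_const in e1 e2.
  have {}e1 := e1 (fun i im => ltac:(have := low _ _ (H i im); lra)).
  have {}e2 := e2 (fun i im => ltac:(have := low _ _ (H i im); lra)).
  by lra.
have [tm tp] := dab _ _ _ _ (hy m ltac:(lia)) (hx m ltac:(lia)).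
have t1 := top _ _ tm.
have t2 : Rabs (y.[m] - x.[m] - 1 - (y'.[m] - x'.[m] - 1)) <= 2 * eta.
  by have -> : y.[m] - x.[m] - 1 - (y'.[m] - x'.[m] - 1) = y.[m] - x.[m] - (y'.[m] - x'.[m]) by ring.
have {}t2 := top _ _ t2.
have s1 := lows (fun i => y.[i] - x.[i]) (fun i => y'.[i] - x'.[i])
  (fun i im => proj1 (dab _ _ _ _ (hy i ltac:(lia)) (hx i ltac:(lia)))).
have s2 := lows (fun i => y.[i] + x.[i]) (fun i => y'.[i] + x'.[i])
  (fun i im => proj2 (dab _ _ _ _ (hy i ltac:(lia)) (hx i ltac:(lia)))).
by apply: Rabs_le; rewrite /ee /De /Do; lra.
Qed.

(** Upper semicontinuity with its equality case. By the gap, every condition met at the nearby pair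
    is met at [(x, y)]. If the counts agree none is new; but a lift on an excluded face of the
    domain would meet a new one, so [(x, y)] is normalised. *)
Lemma conditions_closed g eta x y x' y' : gapped g x y -> fund x' y' ->
  0 < eta -> (4 * INR m + 8) * eta < g -> near eta x x' -> near eta y y' ->
  almost_fund x y /\ (cnt x' y' <= cnt x y)%nat /\
  (cnt x' y' = cnt x y -> fund x y /\
    (cC x <-> cC x') /\ (cH x y <-> cH x' y') /\ (cW x y <-> cW x' y') /\ (cV x y <-> cV x' y') /\
    (forall i, (i < m)%nat -> (cD x y i <-> cD x' y' i) /\ (cS x y i <-> cS x' y' i) /\
      (x.[i] + y.[i] <= 1 / 2 <-> x'.[i] + y'.[i] <= 1 / 2))).
Proof.
move=> [gc [gw [gi ge]]] [c [d [s [w [e ew]]]]] eta0 lt hx hy.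
have m0 := pos_INR m.
have lt8 : 8 * eta < g by nra.
have le := ee_lip eta x y x' y' hx hy.
have hxm := hx m ltac:(lia); have hym := hy m ltac:(lia).
have nc : 2 * Rabs (x.[m] - x'.[m]) < g by lra.
have dab a b a' b' : Rabs (a - a') <= eta -> Rabs (b - b') <= eta ->
    2 * Rabs (a - b - (a' - b')) < g /\ 2 * Rabs (b + a - (b' + a')) < g.
  move=> /Rabs_bounds h /Rabs_bounds h'.
  have [h1 h2] : Rabs (a - b - (a' - b')) <= 2 * eta /\ Rabs (b + a - (b' + a')) <= 2 * eta.
    by split; apply: Rabs_le; lra.
  by lra.
have [nw _] := dab _ _ _ _ hym hxm.
have ni i : (i < m)%nat -> 2 * Rabs (y.[i] - x.[i] - (y'.[i] - x'.[i])) < g /\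
    2 * Rabs (x.[i] + y.[i] - (x'.[i] + y'.[i])) < g.
  by move=> im; apply: dab; [apply: (hy i) | apply: (hx i)]; lia.
have he : - g < ee x y - ee x' y' < g by have := Rabs_bounds _ _ le; lra.
have snap2 t t' k : gap g t -> 2 * Rabs (t - t') < g -> t' = IZR k + 1 / 2 -> t = t'.
  by move=> G l z; apply: (gap_snap g t t' (2 * k + 1) G l); rewrite plus_IZR mult_IZR; lra.
have snap1 t t' k : gap g t -> 2 * Rabs (t - t') < g -> t' = IZR k -> t = t'.
  by move=> G l z; apply: (gap_snap g t t' (2 * k) G l); rewrite mult_IZR; lra.
have e_le : ee x y <= 0.
  case: ge => h; first by lra.
  by move: h; rewrite /Rabs; case: Rcase_abs; lra.
have e_0 : ee x' y' = 0 -> ee x y = 0.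
  by move=> z; case: ge => // h; move: h; rewrite Rabs_left1; lra.
have hw2 : -2 <= 2 * (y.[m] - x.[m]) <= 2.
  by split; [apply: (gap_ge_half g _ (y'.[m] - x'.[m]) (-2)) | apply: (gap_le_half g _ (y'.[m] - x'.[m]) 2)] => //; lra.
have hd2 i : (i < m)%nat -> -1 <= 2 * (y.[i] - x.[i]) <= 1.
  move=> im; have [n1 n2] := ni i im; have [g1 g2] := gi i im; have := d i im => di.
  by split; [apply: (gap_ge_half g _ (y'.[i] - x'.[i]) (-1)) | apply: (gap_le_half g _ (y'.[i] - x'.[i]) 1)] => //; lra.
have hs2 i : (i < m)%nat -> -1 <= 2 * (x.[i] + y.[i]) <= 3.
  move=> im; have [n1 n2] := ni i im; have [g1 g2] := gi i im; have := s i im => si.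
  by split; [apply: (gap_ge_half g _ (x'.[i] + y'.[i]) (-1)) | apply: (gap_le_half g _ (x'.[i] + y'.[i]) 3)] => //; lra.
have hc2 : 0 <= 2 * x.[m] <= 2.
  by split; [apply: (gap_ge_half g _ (x'.[m]) 0) | apply: (gap_le_half g _ (x'.[m]) 2)] => //; lra.
have iC : cC x' -> cC x by move=> [k z]; exists k; rewrite -z; apply: snap1 z.
have iH : cH x' y' -> cH x y := e_0.
have iW : cW x' y' -> cW x y.
  move=> [[k z] z0]; have ewz : y.[m] - x.[m] = y'.[m] - x'.[m] by apply: snap1 z.
  by split; [exists k; rewrite ewz | rewrite ewz => /z0/e_0].
have iD i : (i < m)%nat -> cD x' y' i -> cD x y i.
  move=> im [k z]; have [n1 n2] := ni i im; have [g1 g2] := gi i im.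
  by exists k; rewrite -z; apply: snap2 z.
have iS i : (i < m)%nat -> cS x' y' i -> cS x y i.
  move=> im [k z]; have [n1 n2] := ni i im; have [g1 g2] := gi i im.
  by exists k; rewrite -z; apply: snap2 z.
have iV : cV x' y' -> cV x y.
  move=> [h [h' H]]; split; [exact: iH | split; [exact: iW |]] => i im.
  have [[k1 z1] [k2 z2]] := H i im; have [n1 n2] := ni i im; have [g1 g2] := gi i im.
  by split; [exists k1; rewrite -z1 (gap_snap _ _ _ _ g1 n1 z1) | exists k2; rewrite -z2 (gap_snap _ _ _ _ g2 n2 z2)].
have bC := bn_mono _ _ iC; have bH := bn_mono _ _ iH; have bW := bn_mono _ _ iW; have bV := bn_mono _ _ iV.
have bI i : (i < m)%nat -> (bn (cD x' y' i) + bn (cS x' y' i) <= bn (cD x y i) + bn (cS x y i))%nat.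
  by move=> im; have := bn_mono _ _ (iD i im); have := bn_mono _ _ (iS i im); lia.
have bS := nsum_le m _ _ bI.
split.
  split; first by move=> i im; apply: Rabs_le; have := hd2 i im; lra.
  by split=> //; apply: Rabs_le; lra.
split; first by rewrite /cnt; lia.
rewrite /cnt => eq.
have rC := bn_eq_imp (cC x') (cC x) ltac:(lia).
have rH := bn_eq_imp (cH x' y') (cH x y) ltac:(lia).
have rW := bn_eq_imp (cW x' y') (cW x y) ltac:(lia).
have rV := bn_eq_imp (cV x' y') (cV x y) ltac:(lia).
have rI := nsum_le_eq m _ _ bI ltac:(lia).
have rD i : (i < m)%nat -> cD x y i -> cD x' y' i.
  move=> im; apply: bn_eq_imp; have := rI i im.
  by have := bn_mono _ _ (iD i im); have := bn_mono _ _ (iS i im); lia.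
have rS i : (i < m)%nat -> cS x y i -> cS x' y' i.
  move=> im; apply: bn_eq_imp; have := rI i im.
  by have := bn_mono _ _ (iD i im); have := bn_mono _ _ (iS i im); lia.
split; last first.
  do 4 (split; first by split).
  move=> i im; split; first by split; auto.
  split; first by split; auto.
  have [n1 n2] := ni i im; have [g1 g2] := gi i im; split=> h.
    have [//|gt] := Rle_dec (x'.[i] + y'.[i]) (1 / 2).
    have h1 := gap_ge_half _ _ _ 1 g2 n2 ltac:(lra).
    have ss : cS x y i by exists 0%Z; lra.
    have [k z] := rS i im ss; have := snap2 _ _ k g2 n2 z; lra.
  by have := gap_le_half _ _ _ 1 g2 n2 ltac:(lra); lra.
split.
  split; first by lra.
  have [//|nlt] := Rlt_dec (x.[m]) 1.
  have e1 : x.[m] = 1 by lra.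
  have [k z] := rC (ex_intro _ 1%Z e1); have := snap1 _ _ k gc nc z; lra.
split.
  move=> i im; have := hd2 i im; have := d i im => di h; split; last by lra.
  have [//|nlt] := Rlt_dec (- (1 / 2)) (y.[i] - x.[i]).
  have [n1 n2] := ni i im; have [g1 g2] := gi i im.
  have dd : cD x y i by exists (-1)%Z; lra.
  have [k z] := rD i im dd; have := snap2 _ _ k g1 n1 z; lra.
split.
  move=> i im; have := hs2 i im; have := s i im => si h; split; last by lra.
  have [//|nlt] := Rlt_dec (- (1 / 2)) (x.[i] + y.[i]).
  have [n1 n2] := ni i im; have [g1 g2] := gi i im.
  have ss : cS x y i by exists (-1)%Z; lra.
  have [k z] := rS i im ss; have := snap2 _ _ k g2 n2 z; lra.
split.
  split; last by lra.
  have [//|nlt] := Rlt_dec (-1) (y.[m] - x.[m]).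
  have wW : cW x y by split; [exists (-1)%Z; lra | lra].
  have [[k z] _] := rW wW; have := snap1 _ _ k gw nw z; lra.
split=> // ez.
have w0 := ew (rH ez).
have := gap_ge_half _ _ _ 0 gw nw ltac:(lra) => h0.
have [//|nlt] := Rlt_dec 0 (y.[m] - x.[m]).
have wW : cW x y by split; [exists 0%Z; lra | move=> _].
have [[k z] _] := rW wW; have := snap1 _ _ k gw nw z; lra.
Qed.

Definition Fx (p : Kn n * Kn n) : Rn n :=
  proj1_sig (constructive_indefinite_description _ (fund_exists p)).
Definition Fy (p : Kn n * Kn n) : Rn n :=
  proj1_sig (constructive_indefinite_description _
    (proj2_sig (constructive_indefinite_description _ (fund_exists p)))).

Lemma F_spec p : p = (proj m (Fx p), proj m (Fy p)) /\ fund (Fx p) (Fy p).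
Proof.
exact: (proj2_sig (constructive_indefinite_description _
  (proj2_sig (constructive_indefinite_description _ (fund_exists p))))).
Qed.

Lemma F_unique x y : fund x y -> Fx (proj m x, proj m y) = x /\ Fy (proj m x, proj m y) = y.
Proof.
move=> h; have [e h'] := F_spec (proj m x, proj m y).
have [e1 e2] : proj m x = proj m (Fx (proj m x, proj m y)) /\ proj m y = proj m (Fy (proj m x, proj m y)).
  by split; [exact: (f_equal fst e) | exact: (f_equal snd e)].
have [a b] := fund_unique _ _ _ _ h h' (proj1 (proj_eq _ _ _) e1) (proj1 (proj_eq _ _ _) e2).
by split; symmetry.
Qed.

Definition level p : nat := cnt (Fx p) (Fy p).

Lemma F_local p e : 0 < e -> exists delta, 0 < delta /\ forall p', level p' = level p ->
  dprod (dK n) p p' < delta -> near e (Fx p) (Fx p') /\ near e (Fy p) (Fy p') /\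
  (cC (Fx p) <-> cC (Fx p')) /\ (cH (Fx p) (Fy p) <-> cH (Fx p') (Fy p')) /\
  (cW (Fx p) (Fy p) <-> cW (Fx p') (Fy p')) /\ (cV (Fx p) (Fy p) <-> cV (Fx p') (Fy p')) /\
  (forall i, (i < m)%nat -> (cD (Fx p) (Fy p) i <-> cD (Fx p') (Fy p') i) /\
     (cS (Fx p) (Fy p) i <-> cS (Fx p') (Fy p') i) /\
     ((Fx p).[i] + (Fy p).[i] <= 1 / 2 <-> (Fx p').[i] + (Fy p').[i] <= 1 / 2)).
Proof.
move=> e0; have [ep hp] := F_spec p.
have [g [g0 G]] := gapped_exists (Fx p) (Fy p).
have m0 := pos_INR m.
pose eta := Rmin e (g / (8 * INR m + 16)).
have eta0 : 0 < eta.
  by apply: Rmin_glb_lt => //; apply: Rdiv_lt_0_compat; lra.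
have eta_e : eta <= e by apply: Rmin_l.
have eta_g : (4 * INR m + 8) * eta < g.
  have h : eta <= g / (8 * INR m + 16) by apply: Rmin_r.
  have h2 : (4 * INR m + 8) * (g / (8 * INR m + 16)) = g / 2 by field; lra.
  by nra.
exists eta; split=> // p' lev close.
have [ep' hp'] := F_spec p'.
have {}close : dprod (dK n) (proj m (Fx p), proj m (Fy p)) (proj m (Fx p'), proj m (Fy p')) < eta.
  by rewrite -ep -ep'.
have c1 : dK n (proj m (Fx p')) (proj m (Fx p)) < eta.
  by rewrite dK_sym; apply: Rle_lt_trans close; apply: Rmax_l.
have c2 : dK n (proj m (Fy p')) (proj m (Fy p)) < eta.
  by rewrite dK_sym; apply: Rle_lt_trans close; apply: Rmax_r.
(* Lifts of [p] are taken next to the normalised lift of [p']; uniqueness in the domain will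
   identify them with the normalised lift of [p]. *)
have [x [hx ex]] := dK_lift m (Fx p') (Fx p).
have [y [hy ey]] := dK_lift m (Fy p') (Fy p).
have nx : near eta x (Fx p').
  by move=> i iN; rewrite Rabs_minus_sym; have := eucl_coord n (Fx p') x i iN; lra.
have ny : near eta y (Fy p').
  by move=> i iN; rewrite Rabs_minus_sym; have := eucl_coord n (Fy p') y i iN; lra.
have [af [le H]] := conditions_closed g eta x y (Fx p') (Fy p')
  (gapped_invariant _ _ _ _ _ hx hy G) hp' eta0 eta_g nx ny.
have inv := cnt_invariant _ _ _ _ (fund_almost _ _ hp) af hx hy.
have [fxy conds] := H ltac:(rewrite -inv; exact: lev).
have [exx eyy] := fund_unique _ _ _ _ hp fxy hx hy.
rewrite exx eyy; split; first by move=> i iN; have := nx i iN; lra.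
by split; first by move=> i iN; have := ny i iN; lra.
Qed.

End FundamentalDomain.

(** * Continuity of the geodesic choice *)

Section Segments.
Variable m : nat.
Local Notation n := (S m).
Implicit Types x y : Rn n.

Definition seg x y (t : R) : Kn n := proj m (interp n t x y).

Lemma seg_lip x y s t : dK n (seg x y s) (seg x y t) <= Rabs (s - t) * eucl n x y.
Proof. by rewrite -eucl_interp; apply: dK_le_eucl. Qed.

Lemma seg_min_geodesic x y : almost_fund m x y ->
  min_geodesic (dK n) (seg x y) /\ seg x y 0 = proj m x /\ seg x y 1 = proj m y.
Proof.
move=> af; have e0 : seg x y 0 = proj m x by rewrite /seg interp0.
have e1 : seg x y 1 = proj m y by rewrite /seg interp1.
have D := fund_dist m x y af; have D0 := eucl_ge0 n x y.
split=> //; split.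
  move=> t _ e epos; exists (e / (eucl n x y + 1)); split; first by apply: Rdiv_lt_0_compat; lra.
  move=> s _ hs; apply: Rle_lt_trans (seg_lip x y t s) _; rewrite /R_dist in hs.
  have h : e / (eucl n x y + 1) * (eucl n x y + 1) = e by field; lra.
  have := Rabs_pos (t - s); nra.
rewrite e0 e1; split; last first.
  move=> b ub; apply: ub; exists 1%nat, (fun i => INR i); split.
    by split=> //; split=> // i _; rewrite S_INR; lra.
  by rewrite /= e0 e1; ring.
move=> r [k [t [[t0 [tk mono]] ->]]]; rewrite -D.
have H j : (j <= k)%nat -> psum (dK n) (seg x y) t j <= (t j - t 0%nat) * eucl n x y.
  elim: j => [|j IH] jk /=; first by lra.
  have := IH ltac:(lia); have := mono j ltac:(lia); have := seg_lip x y (t j) (t (S j)).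
  by move=> h1 h2 h3; rewrite Rabs_left1 in h1; lra.
by have := H k ltac:(lia); rewrite t0 tk; lra.
Qed.

Lemma seg_near x y x' y' e t : 0 <= t <= 1 -> 0 <= e -> near m e x x' -> near m e y y' ->
  dK n (seg x y t) (seg x' y' t) <= INR n * e.
Proof.
move=> t01 e0 hx hy; apply: Rle_trans (dK_le_eucl _ _ _) _; apply: eucl_le_coord => // i iN.
rewrite !mkRnE //; have := Rabs_bounds _ _ (hx i iN); have := Rabs_bounds _ _ (hy i iN).
by move=> ? ?; apply: Rabs_le; nra.
Qed.

Lemma list_min_pos (l : list R) : (forall r, In r l -> 0 < r) ->
  exists e, 0 < e /\ forall r, In r l -> e <= r.
Proof.
elim: l => [|a l IH] H; first by exists 1; split=> [|r []]; lra.
have [e [e0 he]] := IH (fun r h => H r (or_intror h)).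
exists (Rmin a e); split; first by apply: Rmin_glb_lt => //; apply: H; left.
move=> r [<-|h]; first exact: Rmin_l.
by apply: Rle_trans (Rmin_r _ _) (he r h).
Qed.

Lemma seg_uniform x y (K : R -> Prop) (U : Kn n -> Prop) : compact K -> open_in (dK n) U ->
  (forall t, K t -> U (seg x y t)) ->
  exists e, 0 < e /\ forall t z, K t -> dK n (seg x y t) z < e -> U z.
Proof.
move=> cK oU hU.
(* A Lebesgue number argument. [compact] uses families indexed by reals, so the radius serves as the
   index; the larger [r'] leaves room to make each member open. *)
pose W r t := 0 < r /\ exists r', r < r' /\ forall z, dK n (seg x y t) z < r' -> U z.
have condW r : (exists t, W r t) -> 0 < r by move=> [t []].
pose fam := mkfamily (fun r => 0 < r) W condW.
have cov : covering_open_set K fam.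
  split=> [t Kt|r t [r0 [r' [rr' h]]]].
    have [e [e0 he]] := oU _ (hU t Kt).
    by exists (e / 2); split; [lra | exists e; split=> //; lra].
  have D0 := eucl_ge0 n x y.
  have del0 : 0 < (r' - r) / 2 / (eucl n x y + 1) by apply: Rdiv_lt_0_compat; lra.
  exists (mkposreal _ del0) => s; rewrite /disc /= => hs; split=> //.
  exists ((r + r') / 2); split; first by lra.
  move=> z hz; apply: h.
  apply: Rle_lt_trans (dK_triangle m (seg x y s) _ _) _.
  have h1 := seg_lip x y t s; rewrite Rabs_minus_sym in h1.
  have h2 : (r' - r) / 2 / (eucl n x y + 1) * (eucl n x y + 1) = (r' - r) / 2 by field; lra.
  have := Rabs_pos (s - t); nra.
have [D [covD [l hl]]] := cK fam cov.
have hl' r : In r l <-> 0 < r /\ D r by rewrite -hl.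
have [e [e0 he]] := list_min_pos l (fun r h => proj1 (proj1 (hl' r) h)).
exists e; split=> // t z Kt hz; have [r [[r0 [r' [rr' h]]] Dr]] := covD t Kt.
by apply: h; have := he r (proj2 (hl' r) (conj r0 Dr)); lra.
Qed.

Lemma seg_co_continuous j :
  co_continuous (dK n) (fun p => level m p = j) (fun p => seg (Fx m p) (Fy m p)).
Proof.
move=> K U cK K01 oU p lp hU.
have [e [e0 he]] := seg_uniform _ _ K U cK oU hU.
have N0 : 0 < INR n by apply: lt_0_INR; lia.
have e'0 : 0 < e / (2 * INR n) by apply: Rdiv_lt_0_compat; lra.
have [del [del0 H]] := F_local m p _ e'0.
exists del; split=> // p' lp' close t Kt.
have [|nx [ny _]] := H p' _ close; first by rewrite lp lp'.
apply: (he t) => //.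
have := seg_near _ _ _ _ _ _ (K01 t Kt) (Rlt_le _ _ e'0) nx ny.
have -> : INR n * (e / (2 * INR n)) = e / 2 by field; lra.
by lra.
Qed.

End Segments.

(** * Pointwise continuity of real functions on Euclidean space *)

Section CoordinateContinuity.
Variable N : nat.
Implicit Types (q : Rn N) (phi psi : Rn N -> R).

Definition eventually_near q (Q : Rn N -> Prop) : Prop :=
  exists d, 0 < d /\ forall q', eucl N q q' < d -> Q q'.

Definition ctn phi q : Prop := forall e, 0 < e ->
  eventually_near q (fun q' => Rabs (phi q' - phi q) < e).

Lemma ev_and q (Q Q' : Rn N -> Prop) : eventually_near q Q -> eventually_near q Q' ->
  eventually_near q (fun z => Q z /\ Q' z).
Proof.
move=> [d [d0 H]] [d' [d'0 H']]; exists (Rmin d d'); split; first exact: Rmin_glb_lt.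
move=> z hz; split; [apply: H | apply: H']; apply: Rlt_le_trans hz _; [exact: Rmin_l | exact: Rmin_r].
Qed.

Lemma ev_imp q (Q Q' : Rn N -> Prop) : (forall z, Q z -> Q' z) ->
  eventually_near q Q -> eventually_near q Q'.
Proof. by move=> h [d [d0 H]]; exists d; split=> // z /H/h. Qed.

Lemma ev_const q (P : Prop) : P -> eventually_near q (fun _ => P).
Proof. by move=> p; exists 1; split=> //; lra. Qed.

Lemma ev_forall q k (Q : nat -> Rn N -> Prop) :
  (forall i, (i < k)%nat -> eventually_near q (Q i)) ->
  eventually_near q (fun z => forall i, (i < k)%nat -> Q i z).
Proof.
elim: k => [|k IH] H; first by exists 1; split=> [|z _ i]; [lra | lia].
have h := ev_and _ _ _ (IH (fun i ik => H i ltac:(lia))) (H k ltac:(lia)).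
apply: ev_imp h => z [h1 h2] i ik; have [->|ik'] : i = k \/ (i < k)%nat by lia.
  exact: h2.
exact: h1.
Qed.

Lemma ctn_comp (f : R -> R) phi q : continuity_pt f (phi q) -> ctn phi q ->
  ctn (fun z => f (phi z)) q.
Proof.
move=> cf cp e e0; have [a [a0 ha]] := cf e e0.
apply: ev_imp (cp a a0) => z hz.
have [->|ne] := Req_dec (phi z) (phi q); first by rewrite Rminus_diag Rabs_R0.
by apply: (ha (phi z)); split=> //; split=> //; apply: not_eq_sym.
Qed.

Lemma ctn_cst c q : ctn (fun _ => c) q.
Proof. by move=> e e0; apply: ev_const; rewrite Rminus_diag Rabs_R0. Qed.

Lemma ctn_coord i q : (i < N)%nat -> ctn (fun z => z.[i]) q.
Proof.
move=> iN e e0; exists e; split=> // z hz; rewrite Rabs_minus_sym.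
by apply: Rle_lt_trans (eucl_coord N q z i iN) hz.
Qed.

Lemma ctn_plus phi psi q : ctn phi q -> ctn psi q -> ctn (fun z => phi z + psi z) q.
Proof.
move=> h h' e e0; apply: ev_imp (ev_and _ _ _ (h (e / 2) ltac:(lra)) (h' (e / 2) ltac:(lra))).
move=> z [/Rabs_def2 h1 /Rabs_def2 h2]; apply: Rabs_def1; lra.
Qed.

Lemma ctn_scal c phi q : ctn phi q -> ctn (fun z => c * phi z) q.
Proof.
apply: (ctn_comp (fun t => c * t)); apply: continuity_pt_mult.
  exact: continuity_pt_const.
exact: derivable_continuous_pt (derivable_pt_id _).
Qed.

Lemma ctn_minus phi psi q : ctn phi q -> ctn psi q -> ctn (fun z => phi z - psi z) q.
Proof.
move=> h h' e e0; apply: ev_imp (ctn_plus _ _ _ h (ctn_scal (-1) _ _ h') e e0) => z.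
have -> : phi z + -1 * psi z - (phi q + -1 * psi q) = phi z - psi z - (phi q - psi q) by ring.
by [].
Qed.

Lemma ctn_sqr phi q : ctn phi q -> ctn (fun z => phi z ^ 2) q.
Proof.
apply: (ctn_comp (fun t => t ^ 2)).
exact: derivable_continuous_pt (derivable_pt_pow 2 _).
Qed.

(** Polarisation reduces products to squares. *)
Lemma ctn_mult phi psi q : ctn phi q -> ctn psi q -> ctn (fun z => phi z * psi z) q.
Proof.
move=> h h'; have H := ctn_scal (1 / 4) _ _ (ctn_minus _ _ _ (ctn_sqr _ _ (ctn_plus _ _ _ h h'))
  (ctn_sqr _ _ (ctn_minus _ _ _ h h'))).
move=> e e0; apply: ev_imp (H e e0) => z.
have E a b : 1 / 4 * ((a + b) ^ 2 - (a - b) ^ 2) = a * b by field.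
by rewrite !E.
Qed.

Lemma ctn_inv phi q : phi q <> 0 -> ctn phi q -> ctn (fun z => / phi z) q.
Proof.
move=> nz; apply: (ctn_comp Rinv).
apply: (continuity_pt_inv (fun t => t)) => //.
exact: derivable_continuous_pt (derivable_pt_id _).
Qed.

Lemma ctn_sqrt phi q : 0 <= phi q -> ctn phi q -> ctn (fun z => sqrt (phi z)) q.
Proof. by move=> h; apply: ctn_comp; apply: continuity_pt_sqrt. Qed.

Lemma ctn_abs phi q : ctn phi q -> ctn (fun z => Rabs (phi z)) q.
Proof. by apply: ctn_comp; apply: Rcontinuity_abs. Qed.

Lemma ctn_rsum k (f : nat -> Rn N -> R) q : (forall i, (i < k)%nat -> ctn (f i) q) ->
  ctn (fun z => rsum k (fun i => f i z)) q.
Proof.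
elim: k => [|k IH] H /=; first exact: ctn_cst.
by apply: ctn_plus; [apply: IH => i ik; apply: H; lia | apply: H; lia].
Qed.

Lemma ctn_if (b : bool) phi psi q : (b = true -> ctn phi q) -> (b = false -> ctn psi q) ->
  ctn (fun z => if b then phi z else psi z) q.
Proof. by case: b => h h'; [apply: h | apply: h']. Qed.

Lemma ev_lt phi psi q : ctn phi q -> ctn psi q -> phi q < psi q ->
  eventually_near q (fun z => phi z < psi z).
Proof.
move=> h h' lt.
apply: ev_imp (ev_and _ _ _ (h ((psi q - phi q) / 2) ltac:(lra)) (h' ((psi q - phi q) / 2) ltac:(lra))).
by move=> z [/Rabs_def2 h1 /Rabs_def2 h2]; lra.
Qed.

Definition neighborhood_retract (A : Rn N -> Prop) : Prop :=
  exists (U : Rn N -> Prop) (r : Rn N -> Rn N),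
    (forall q, U q -> eventually_near q U) /\
    (forall q, A q -> U q) /\
    (forall q i, U q -> (i < N)%nat -> ctn (fun z => (r z).[i]) q) /\
    (forall q, U q -> A (r q)) /\
    (forall q, A q -> r q = q).

Lemma neighborhood_retract_ext (A A' : Rn N -> Prop) : (forall q, A q <-> A' q) ->
  neighborhood_retract A -> neighborhood_retract A'.
Proof.
move=> e [U [r [h1 [h2 [h3 [h4 h5]]]]]]; exists U, r; split=> //.
split; first by move=> q /e; apply: h2.
split=> //; split; first by move=> q /h4/e.
by move=> q /e; apply: h5.
Qed.

Lemma neighborhood_retract_empty (A : Rn N -> Prop) : (forall q, ~ A q) -> neighborhood_retract A.
Proof.
move=> H; exists (fun _ => False), (fun q => q); split=> //.
Qed.

End CoordinateContinuity.

(** * Neighbourhood retractions *)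

Section Strata.
Variable m : nat.
Local Notation M := (S (S (m + m))).
Local Notation cI := (m + m)%nat.
Local Notation wI := (S (m + m)).
Implicit Types q : Rn M.

(** The horizontal part of [De - Do]. Coordinates are the [m] differences, the [m] sums reduced
    modulo 1, the height of the first point and the vertical displacement. *)
Definition quad (z : nat -> R) : R := rsum m (fun i => z i ^ 2 - z (m + i)%nat ^ 2).

Definition excess q : R := quad (proj1_sig q) + 2 * Rabs (q.[wI]) - 1.

Definition fundz q : Prop :=
  0 <= q.[cI] < 1 /\
  (forall l, (l < m + m)%nat -> - (1 / 2) < q.[l] <= 1 / 2) /\
  -1 < q.[wI] <= 1 /\ excess q <= 0 /\ (excess q = 0 -> 0 < q.[wI]).

Definition vertex q : Prop := excess q = 0 /\ q.[wI] = 1 /\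
  forall l, (l < m + m)%nat -> q.[l] = 0 \/ q.[l] = 1 / 2.

Definition stratum (bz : nat -> bool) (bC bW bH bV : bool) q : Prop :=
  fundz q /\ (forall l, (l < m + m)%nat -> (q.[l] = 1 / 2 <-> bz l = true)) /\
  (q.[cI] = 0 <-> bC = true) /\ (q.[wI] = 1 <-> bW = true) /\
  (excess q = 0 <-> bH = true) /\ (vertex q <-> bV = true).

Section OneStratum.
Variables (bz : nat -> bool) (bC bW bH bV : bool).

Definition adjust (phi : nat -> Rn M -> R) (omega : Rn M -> R) q : Rn M :=
  mkRn M (fun l => if Nat.ltb l (m + m) then (if bz l then 1 / 2 else phi l q)
    else if Nat.eqb l cI then (if bC then 0 else q.[l]) else (if bW then 1 else omega q)).

Lemma adjust_low phi omega q l : (l < m + m)%nat ->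
  (adjust phi omega q).[l] = if bz l then 1 / 2 else phi l q.
Proof.
move=> lm; rewrite mkRnE; last by lia.
by rewrite (proj2 (Nat.ltb_lt _ _) lm).
Qed.

Lemma adjust_c phi omega q : (adjust phi omega q).[cI] = if bC then 0 else q.[cI].
Proof. by rewrite mkRnE; [rewrite Nat.ltb_irrefl Nat.eqb_refl | lia]. Qed.

Lemma adjust_w phi omega q : (adjust phi omega q).[wI] = if bW then 1 else omega q.
Proof.
rewrite mkRnE; last by lia.
have -> : Nat.ltb wI (m + m) = false by apply/Nat.ltb_ge; lia.
by have -> : Nat.eqb wI cI = false by apply/Nat.eqb_neq; lia.
Qed.

Lemma excess_ctn (f : Rn M -> Rn M) q : (forall l, (l < M)%nat -> ctn M (fun z => (f z).[l]) q) ->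
  ctn M (fun z => excess (f z)) q.
Proof.
move=> H; apply: ctn_minus; last exact: ctn_cst.
apply: ctn_plus; last by apply: ctn_scal; apply: ctn_abs; apply: H; lia.
refine (ctn_rsum _ m (fun i z => (f z).[i] ^ 2 - (f z).[m + i] ^ 2) q _) => i im.
by apply: ctn_minus; apply: ctn_sqr; apply: H; lia.
Qed.

(** Conditions not met are strict inequalities and define the neighbourhood; those met are imposed
    by [adjust]. Each kind of stratum then only has to solve [excess = 0] and to control the
    vertex. *)
Lemma stratum_retract (phi : nat -> Rn M -> R) (omega : Rn M -> R) (U0 : Rn M -> Prop) :
  (forall q, U0 q -> eventually_near M q U0) ->
  (forall q l, U0 q -> (l < m + m)%nat -> bz l = false -> ctn M (phi l) q) ->
  (forall q, U0 q -> bW = false -> ctn M omega q) ->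
  (forall q, U0 q -> bH = true -> (bW = false -> 0 < omega q) -> excess (adjust phi omega q) = 0) ->
  (forall q, U0 q -> (forall l, (l < m + m)%nat -> bz l = false -> Rabs (phi l q) < 1 / 2) ->
     (bW = false -> omega q < 1) -> (bH = false -> excess (adjust phi omega q) < 0) ->
     (bH = true -> excess (adjust phi omega q) = 0) ->
     (vertex (adjust phi omega q) <-> bV = true)) ->
  (forall q, stratum bz bC bW bH bV q -> U0 q /\
     (forall l, (l < m + m)%nat -> bz l = false -> phi l q = q.[l]) /\
     (bW = false -> omega q = q.[wI])) ->
  neighborhood_retract M (stratum bz bC bW bH bV).
Proof.
move=> oU0 cphi comega hH hV hA.
pose r := adjust phi omega.
pose U q := U0 q /\
  (forall l, (l < m + m)%nat -> bz l = false -> Rabs (phi l q) < 1 / 2) /\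
  (bC = false -> 0 < q.[cI] < 1) /\
  (bW = false -> -1 < omega q < 1 /\ (bH = true -> 0 < omega q)) /\
  (bH = false -> excess (r q) < 0).
have cr q l : U0 q -> (l < M)%nat -> ctn M (fun z => (r z).[l]) q.
  move=> Uq lM; have [lm|[lc|lw]] : (l < m + m)%nat \/ l = cI \/ l = wI by lia.
  - move=> e e0; have H := ctn_if M (bz l) (fun _ => 1 / 2) (phi l) q (fun _ => ctn_cst _ _ _) (cphi q l Uq lm) e e0.
    by apply: ev_imp H => z; rewrite /r !adjust_low.
  - subst l; move=> e e0; have H := ctn_if M bC (fun _ => 0) (fun z => z.[cI]) q (fun _ => ctn_cst _ _ _) (fun _ => ctn_coord M cI q ltac:(lia)) e e0.
    by apply: ev_imp H => z; rewrite /r !adjust_c.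
  - subst l; move=> e e0; have H := ctn_if M bW (fun _ => 1) omega q (fun _ => ctn_cst _ _ _) (comega q Uq) e e0.
    by apply: ev_imp H => z; rewrite /r !adjust_w.
have rA q : stratum bz bC bW bH bV q -> r q = q.
  move=> Aq; have [Uq [pq wq]] := hA q Aq; have [F [kz [kC [kW _]]]] := Aq.
  apply: Rn_ext => l lM; have [lm|[lc|lw]] : (l < m + m)%nat \/ l = cI \/ l = wI by lia.
  - rewrite /r adjust_low //; case e : (bz l); last exact: pq.
    by symmetry; apply/kz.
  - subst l; rewrite /r adjust_c; case e : bC => //.
    by symmetry; apply/kC.
  - subst l; rewrite /r adjust_w; case e : bW; last exact: wq.
    by symmetry; apply/kW.
exists U, r; split.
  move=> q [Uq [h1 [h2 [h3 h4]]]].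
  have E1 : eventually_near M q (fun z => forall l, (l < m + m)%nat -> bz l = false -> Rabs (phi l z) < 1 / 2).
    apply: ev_forall => l lm; case e : (bz l); first by apply: ev_imp (ev_const M q True I) => z _.
    have := ev_lt M _ _ q (ctn_abs _ _ _ (cphi q l Uq lm e)) (ctn_cst M (1 / 2) q) (h1 l lm e).
    by apply: ev_imp => z hz _.
  have E2 : eventually_near M q (fun z => bC = false -> 0 < z.[cI] < 1).
    case e : bC; first by apply: ev_imp (ev_const M q True I) => z _.
    have [a b] := h2 e; have cc := ctn_coord M cI q ltac:(lia).
    have := ev_and _ _ _ _ (ev_lt M _ _ q (ctn_cst M 0 q) cc a) (ev_lt M _ _ q cc (ctn_cst M 1 q) b).
    by apply: ev_imp => z hz _.
  have E3 : eventually_near M q (fun z => bW = false -> -1 < omega z < 1 /\ (bH = true -> 0 < omega z)).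
    case e : bW; first by apply: ev_imp (ev_const M q True I) => z _.
    have [[a b] c] := h3 e; have cc := comega q Uq e.
    have e1 := ev_and _ _ _ _ (ev_lt M _ _ q (ctn_cst M (-1) q) cc a) (ev_lt M _ _ q cc (ctn_cst M 1 q) b).
    have e2 : eventually_near M q (fun z => bH = true -> 0 < omega z).
      case e' : bH; last by apply: ev_imp (ev_const M q True I) => z _.
      by apply: ev_imp (ev_lt M _ _ q (ctn_cst M 0 q) cc (c e')) => z hz _.
    by apply: ev_imp (ev_and _ _ _ _ e1 e2) => z [? ?] _.
  have E4 : eventually_near M q (fun z => bH = false -> excess (r z) < 0).
    case e : bH; first by apply: ev_imp (ev_const M q True I) => z _.
    have := ev_lt M _ _ q (excess_ctn r q (fun l => cr q l Uq)) (ctn_cst M 0 q) (h4 e).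
    by apply: ev_imp => z hz _.
  exact: ev_and (oU0 q Uq) (ev_and _ _ _ _ E1 (ev_and _ _ _ _ E2 (ev_and _ _ _ _ E3 E4))).
split.
  move=> q Aq; have [Uq [pq wq]] := hA q Aq.
  have [[fc [fz [fw [fh fh0]]]] [kz [kC [kW [kH kV]]]]] := Aq.
  split=> //; split.
    move=> l lm e; rewrite pq //; have := fz l lm => h.
    have ne : q.[l] <> 1 / 2 by move/(kz l lm); rewrite e.
    by apply: Rabs_def1; lra.
  split.
    move=> e; have ne : q.[cI] <> 0 by move/kC; rewrite e.
    by lra.
  split.
    move=> e; rewrite wq //; have ne : q.[wI] <> 1 by move/kW; rewrite e.
    by split; [lra | move/kH; apply: fh0].
  move=> e; rewrite rA //; have ne : excess q <> 0 by move/kH; rewrite e.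
  by lra.
split; first by move=> q i [Uq _]; apply: cr.
split=> // q [Uq [h1 [h2 [h3 h4]]]].
have hx : bH = true -> excess (r q) = 0.
  by move=> e; apply: hH => // e'; have [_ h] := h3 e'; apply: h.
have V := hV q Uq h1 (fun e => proj2 (proj1 (h3 e))) h4 hx.
rewrite -/r in V.
have rc : (r q).[cI] = if bC then 0 else q.[cI] by apply: adjust_c.
have rw : (r q).[wI] = if bW then 1 else omega q by apply: adjust_w.
split; [split; [|split; [|split; [|split]]]|split; [|split; [|split; [|split]]]] => //.
- by rewrite rc; case: bC h2 => h2; [lra | have := h2 eq_refl; lra].
- move=> l lm; rewrite /r adjust_low //; case e : (bz l); first by lra.
  by have := Rabs_def2 _ _ (h1 l lm e); lra.
- by rewrite rw; case: bW h3 => h3; [lra | have [] := h3 eq_refl; lra].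
- by case: bH hx h4 {h3 V} => hx h4; [have := hx eq_refl | have := h4 eq_refl]; lra.
- move=> z; rewrite rw; case: bW h3 => h3; first by lra.
  have [_ h] := h3 eq_refl; apply: h.
  by case e : bH => //; have := h4 e; lra.
- move=> l lm; rewrite /r adjust_low //; case e : (bz l); first by split.
  by split=> // z; have := Rabs_def2 _ _ (h1 l lm e); lra.
- rewrite rc; case: bC h2 => h2; first by split.
  by split=> // z; have := h2 eq_refl; lra.
- rewrite rw; case: bW h3 => h3; first by split.
  by split=> // z; have [] := h3 eq_refl; lra.
- case: bH hx h4 {h3 V} => hx h4; split=> // z.
  by have := h4 eq_refl; lra.
Qed.

(** The contribution to [quad] of the coordinates forced to be 1/2. *)
Definition fixed : R := rsum m (fun i =>
  (if bz i then 1 / 4 else 0) - (if bz (m + i)%nat then 1 / 4 else 0)).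

Definition freeX q : R := rsum m (fun i => if bz i then 0 else q.[i] ^ 2).
Definition freeY q : R := rsum m (fun i => if bz (m + i)%nat then 0 else q.[m + i] ^ 2).

Lemma quad_adjust phi omega q (a b : R) :
  (forall i, (i < m)%nat -> bz i = false -> phi i q = a * q.[i]) ->
  (forall i, (i < m)%nat -> bz (m + i)%nat = false -> phi (m + i)%nat q = b * q.[m + i]) ->
  quad (proj1_sig (adjust phi omega q)) = fixed + a ^ 2 * freeX q - b ^ 2 * freeY q.
Proof.
move=> ha hb; rewrite /quad /fixed /freeX /freeY.
have -> : forall u v w : R, u + v - w = u + v + (-1) * w by move=> *; ring.
rewrite !rsum_scal !rsum_plus; apply: rsum_ext => i im.
rewrite !adjust_low; try lia.
have ha' := ha i im; have hb' := hb i im.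
case: (bz i) ha' => ha'; case: (bz (m + i)%nat) hb' => hb'; rewrite ?ha' ?hb' //; field.
Qed.

Lemma quad_forced q : (forall l, (l < m + m)%nat -> bz l = true -> q.[l] = 1 / 2) ->
  quad (proj1_sig q) = fixed + freeX q - freeY q.
Proof.
move=> H; rewrite /quad /fixed /freeX /freeY.
have -> : forall u v w : R, u + v - w = u + v + (-1) * w by move=> *; ring.
rewrite rsum_scal !rsum_plus; apply: rsum_ext => i im.
have part l : (l < m + m)%nat -> q.[l] ^ 2 = (if bz l then 1 / 4 else 0) + (if bz l then 0 else q.[l] ^ 2).
  by move=> lm; case e : (bz l); [rewrite (H l lm e); field | ring].
by rewrite (part i ltac:(lia)) (part (m + i)%nat ltac:(lia)); case: (bz i); case: (bz (m + i)%nat); ring.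
Qed.

Lemma free_ctn (s : nat -> nat) q : (forall i, (i < m)%nat -> (s i < M)%nat) ->
  ctn M (fun z => rsum m (fun i => if bz (s i) then 0 else z.[s i] ^ 2)) q.
Proof.
move=> H; apply: (ctn_rsum _ m (fun i z => if bz (s i) then 0 else z.[s i] ^ 2)) => i im.
apply: (ctn_if M (bz (s i)) (fun _ => 0) (fun z => z.[s i] ^ 2)) => _; first exact: ctn_cst.
by apply: ctn_sqr; apply: ctn_coord; apply: H.
Qed.

Lemma freeX_ctn q : ctn M freeX q.
Proof. by apply: (free_ctn (fun i => i)) => i im; lia. Qed.

Lemma freeY_ctn q : ctn M freeY q.
Proof. by apply: (free_ctn (fun i => (m + i)%nat)) => i im; lia. Qed.

Lemma free_ge0 q : 0 <= freeX q /\ 0 <= freeY q.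
Proof.
by split; apply: rsum_ge0 => i _; case: (bz _); try lra; apply: pow2_ge_0.
Qed.

Lemma free_pos q l : (l < m + m)%nat -> bz l = false -> q.[l] <> 0 -> 0 < freeX q + freeY q.
Proof.
move=> lm e nz; have [x0 y0] := free_ge0 q.
have p : 0 < q.[l] ^ 2 by rewrite -Rsqr_pow2; apply: Rsqr_pos_lt.
have [lm'|lm'] : (l < m)%nat \/ exists i, l = (m + i)%nat /\ (i < m)%nat.
  have [h|h] : (l < m)%nat \/ (m <= l)%nat by lia.
    by left.
  by right; exists (l - m)%nat; lia.
  have := rsum_term m (fun i => if bz i then 0 else q.[i] ^ 2) l _ lm'.
  rewrite e -/(freeX q) => h; suff : q.[l] ^ 2 <= freeX q by lra.
  by apply: h => i _; case: (bz _); try lra; apply: pow2_ge_0.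
have [i [el im]] := lm'; subst l.
have := rsum_term m (fun i => if bz (m + i)%nat then 0 else q.[m + i] ^ 2) i _ im.
rewrite e -/(freeY q) => h; suff : q.[m + i] ^ 2 <= freeY q by lra.
by apply: h => j _; case: (bz _); try lra; apply: pow2_ge_0.
Qed.

(** Without the equation the stratum is relatively open in an affine subspace. *)
Lemma retract_off_equality : bH = false -> neighborhood_retract M (stratum bz bC bW bH bV).
Proof.
move=> eH; case eV : bV.
  apply: neighborhood_retract_empty => q [_ [_ [_ [_ [kH kV]]]]].
  have [z _] := proj2 kV eq_refl; have := proj1 kH z; by rewrite eH.
rewrite -eV; apply: (stratum_retract (fun l q => q.[l]) (fun q => q.[wI]) (fun _ => True)) => //.
- by move=> q _; apply: ev_const.
- by move=> q l _ lm _; apply: ctn_coord; lia.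
- by move=> q _ _; apply: ctn_coord; lia.
- by move=> q _; rewrite eH.
- move=> q _ _ _ h _; rewrite eV; split=> // -[z _].
  by have := h eH; lra.
Qed.

(** The tie rule makes the displacement positive, so the equation is linear in it and the stratum is
    part of a graph. *)
Lemma retract_equality_generic : bH = true -> bW = false ->
  neighborhood_retract M (stratum bz bC bW bH bV).
Proof.
move=> eH eW; case eV : bV.
  apply: neighborhood_retract_empty => q [_ [_ [_ [kW [_ kV]]]]].
  have [_ [z _]] := proj2 kV eq_refl; have := proj1 kW z; by rewrite eW.
pose omega q := (1 - (fixed + freeX q - freeY q)) / 2.
have quadE om q : quad (proj1_sig (adjust (fun l q => q.[l]) om q)) = fixed + freeX q - freeY q.
  rewrite (quad_adjust _ _ _ 1 1) => [|i _ _|i _ _]; ring.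
rewrite -eV; apply: (stratum_retract (fun l q => q.[l]) omega (fun _ => True)) => //.
- by move=> q _; apply: ev_const.
- by move=> q l _ lm _; apply: ctn_coord; lia.
- move=> q _ _; have H := ctn_scal M (/ 2) _ _ (ctn_minus M _ _ q (ctn_cst M 1 q)
    (ctn_minus M _ _ q (ctn_plus M _ _ q (ctn_cst M fixed q) (freeX_ctn q)) (freeY_ctn q))).
  by move=> e e0; apply: ev_imp (H e e0) => z; rewrite /omega /Rdiv !(Rmult_comm (/ 2)).
- move=> q _ _ /(_ eW) pos; rewrite /excess quadE adjust_w eW Rabs_pos_eq; last by lra.
  by rewrite /omega; field.
- move=> q _ _ /(_ eW) lt _ _; rewrite eV; split=> // -[_ [z _]].
  by rewrite adjust_w eW in z; lra.
- move=> q Aq; split=> //; split=> // _.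
  have [[_ [_ [_ [_ pos]]]] [kz [_ [_ [kH _]]]]] := Aq.
  have z := proj2 kH eH; have {}pos := pos z.
  have e : quad (proj1_sig q) = fixed + freeX q - freeY q.
    by apply: quad_forced => l lm /(kz l lm).
  by rewrite /excess e Rabs_pos_eq in z; rewrite /omega; lra.
Qed.

(** The bits determine every coordinate except possibly the height of the first point. *)
Lemma retract_vertex : bH = true -> bW = true -> bV = true ->
  neighborhood_retract M (stratum bz bC bW bH bV).
Proof.
move=> eH eW eV.
have [[q0 A0]|none] := classic (exists q, stratum bz bC bW bH bV q); last first.
  by apply: neighborhood_retract_empty => q Aq; apply: none; exists q.
have coordE q l : stratum bz bC bW bH bV q -> (l < m + m)%nat -> q.[l] = if bz l then 1 / 2 else 0.
  move=> [_ [kz [_ [_ [_ kV]]]]] lm; have [_ [_ h]] := proj2 kV eV.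
  case e : (bz l); first by apply/kz.
  by case: (h l lm) => // /(kz l lm); rewrite e.
have exE om q : excess (adjust (fun _ _ => 0) om q) = 0.
  have [_ [_ [_ [kW [kH _]]]]] := A0.
  transitivity (excess q0); last exact: (proj2 kH eH).
  rewrite /excess adjust_w eW (proj2 kW eW); congr (_ + _ - _).
  apply: rsum_ext => i im; rewrite (coordE q0 i A0) ?(coordE q0 (m + i)%nat A0); try lia.
  by rewrite !adjust_low; try lia.
apply: (stratum_retract (fun _ _ => 0) (fun _ => 0) (fun _ => True)) => //.
- by move=> q _; apply: ev_const.
- by move=> q l _ _ _; apply: ctn_cst.
- by move=> q _ _; apply: ctn_cst.
- move=> q _ _ _ _ _; rewrite eV; split=> // _; split; first exact: exE.
  split; first by rewrite adjust_w eW.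
  by move=> l lm; rewrite adjust_low //; case: (bz l); [right | left].
- move=> q Aq; split=> //; split; last by rewrite eW.
  by move=> l lm e; rewrite (coordE q) // e.
Qed.

(* On this stratum the equation is [X - Y = kappa] with [X], [Y] the squared
   norms of the free coordinates. Scaling these by [1 + theta] and [1 - theta]
   gives [D theta^2 + 2 S theta + D = kappa] where [D = X - Y], [S = X + Y]; the
   root vanishing at [D = kappa] is written without dividing by [D]. *)
Lemma quadric_root X Y kappa : let D := X - Y in let S := X + Y in
  let disc := S ^ 2 - D * (D - kappa) in 0 < S -> 0 < disc ->
  let theta := (kappa - D) / (S + sqrt disc) in
  (1 + theta) ^ 2 * X - (1 - theta) ^ 2 * Y = kappa.
Proof.
move=> D S disc S0 disc0 theta.
have r0 := sqrt_lt_R0 _ disc0; have r2 := pow2_sqrt disc (Rlt_le _ _ disc0).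
have e1 : theta * (S + sqrt disc) = kappa - D by rewrite /theta; field; lra.
have h : (S + sqrt disc) ^ 2 * ((1 + theta) ^ 2 * X - (1 - theta) ^ 2 * Y - kappa) = 0.
  have -> : (S + sqrt disc) ^ 2 * ((1 + theta) ^ 2 * X - (1 - theta) ^ 2 * Y - kappa) =
      D * (theta * (S + sqrt disc)) ^ 2 + 2 * S * (theta * (S + sqrt disc)) * (S + sqrt disc) +
      (D - kappa) * (S ^ 2 + 2 * S * sqrt disc + sqrt disc ^ 2) by rewrite /D /S; ring.
  rewrite e1 r2 /disc; ring.
have nz : (S + sqrt disc) ^ 2 <> 0 by apply: pow_nonzero; lra.
by have [//|] := Rmult_integral _ _ h; lra.
Qed.

(** The scaling of [quadric_root] is restricted to the region where some rescaled free coordinate is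
    non-zero, which keeps the image away from the vertex. *)
Lemma retract_quadric : bH = true -> bW = true -> bV = false ->
  neighborhood_retract M (stratum bz bC bW bH bV).
Proof.
move=> eH eW eV.
pose kappa := -1 - fixed.
pose D q := freeX q - freeY q; pose S q := freeX q + freeY q.
pose disc q := S q ^ 2 - D q * (D q - kappa).
pose theta q := (kappa - D q) / (S q + sqrt (disc q)).
pose phi l q := if Nat.ltb l m then (1 + theta q) * q.[l] else (1 - theta q) * q.[l].
pose U0 q := 0 < S q /\ 0 < disc q /\ exists l, (l < m + m)%nat /\ bz l = false /\ phi l q <> 0.
have cD q : ctn M D q by apply: ctn_minus; [apply: freeX_ctn | apply: freeY_ctn].
have cS q : ctn M S q by apply: ctn_plus; [apply: freeX_ctn | apply: freeY_ctn].
have cdisc q : ctn M disc q.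
  apply: ctn_minus; first exact: ctn_sqr.
  by apply: ctn_mult => //; apply: ctn_minus => //; apply: ctn_cst.
have ctheta q : 0 < S q -> 0 < disc q -> ctn M theta q.
  move=> s0 d0; apply: ctn_mult; first by apply: ctn_minus => //; apply: ctn_cst.
  apply: ctn_inv; first by have := sqrt_lt_R0 _ d0; lra.
  by apply: ctn_plus => //; apply: ctn_sqrt => //; lra.
have cphi q l : 0 < S q -> 0 < disc q -> (l < m + m)%nat -> ctn M (phi l) q.
  move=> s0 d0 lm; apply: (ctn_if M (Nat.ltb l m) (fun q => (1 + theta q) * q.[l])) => _.
    apply: ctn_mult; last by apply: ctn_coord; lia.
    by apply: ctn_plus; [apply: ctn_cst | apply: ctheta].
  apply: ctn_mult; last by apply: ctn_coord; lia.
  by apply: ctn_minus; [apply: ctn_cst | apply: ctheta].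
have quadE om q : quad (proj1_sig (adjust phi om q)) =
    fixed + (1 + theta q) ^ 2 * freeX q - (1 - theta q) ^ 2 * freeY q.
  apply: quad_adjust => i im _; rewrite /phi.
    by rewrite (proj2 (Nat.ltb_lt _ _) im).
  by have -> : Nat.ltb (m + i) m = false by apply/Nat.ltb_ge; lia.
apply: (stratum_retract phi (fun _ => 0) U0).
- move=> q [s0 [d0 [l [lm [e nz]]]]].
  have e1 := ev_lt M _ _ q (ctn_cst M 0 q) (cS q) s0.
  have e2 := ev_lt M _ _ q (ctn_cst M 0 q) (cdisc q) d0.
  have e3 := ev_lt M _ _ q (ctn_cst M 0 q) (ctn_abs M _ q (cphi q l s0 d0 lm)) (Rabs_pos_lt _ nz).
  apply: ev_imp (ev_and _ _ _ _ e1 (ev_and _ _ _ _ e2 e3)) => z [h1 [h2 h3]].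
  split=> //; split=> //; exists l; split=> //; split=> // z0.
  by rewrite z0 Rabs_R0 in h3; lra.
- by move=> q l [s0 [d0 _]] lm _; apply: cphi.
- by move=> q _; rewrite eW.
- move=> q [s0 [d0 _]] _ _; rewrite /excess quadE adjust_w eW Rabs_R1.
  by have := quadric_root (freeX q) (freeY q) kappa s0 d0; rewrite -/(theta q) /kappa; lra.
- move=> q [_ [_ [l [lm [e nz]]]]] h _ _ _; rewrite eV; split=> // -[_ [_ V]].
  have := V l lm; rewrite adjust_low // e; have := Rabs_def2 _ _ (h l lm e); lra.
move=> q Aq; have [_ [kz [_ [kW [kH kV]]]]] := Aq.
have z := proj2 kH eH; have w1 := proj2 kW eW.
have e : quad (proj1_sig q) = fixed + freeX q - freeY q.
  by apply: quad_forced => l lm /(kz l lm).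
have Dk : D q = kappa.
  by rewrite /excess e w1 Rabs_R1 in z; rewrite /D /kappa; lra.
have t0 : theta q = 0 by rewrite /theta Dk /Rdiv Rminus_diag Rmult_0_l.
have phiE l : phi l q = q.[l] by rewrite /phi t0; case: Nat.ltb; ring.
(* Away from the vertex such a coordinate exists. It is free, so [S q] is positive, and on the
   stratum [disc q] is [S q ^ 2]. *)
have [l [lm [n0 n1]]] : exists l, (l < m + m)%nat /\ q.[l] <> 0 /\ q.[l] <> 1 / 2.
  apply: NNPP => no; have : vertex q.
    split=> //; split=> // l lm; have [->|n0] := Req_dec (q.[l]) 0; first by left.
    have [->|n1] := Req_dec (q.[l]) (1 / 2); first by right.
    by case: no; exists l.
  by move/kV; rewrite eV.
have el : bz l = false by case h : (bz l) => //; case: n1; apply/kz.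
have S0 := free_pos q l lm el n0.
split; last by split=> [l' _ _|]; [apply: phiE | rewrite eW].
split=> //; split; last by exists l; rewrite phiE.
by rewrite /disc Dk Rminus_diag Rmult_0_r Rminus_0_r; apply: pow_lt.
Qed.

End OneStratum.

Lemma stratum_neighborhood_retract bz bC bW bH bV :
  neighborhood_retract M (stratum bz bC bW bH bV).
Proof.
case: bH; last exact: retract_off_equality.
case: bW; last exact: retract_equality_generic.
by case: bV; [apply: retract_vertex | apply: retract_quadric].
Qed.

End Strata.

(** * Types of pairs, and the level sets as neighbourhood retracts *)

Definition pb (P : Prop) : bool :=
  match excluded_middle_informative P with left _ => true | right _ => false end.

Lemma pbP P : P <-> pb P = true.
Proof. by rewrite /pb; case: excluded_middle_informative => h; split. Qed.

Lemma pb_iff P Q : pb P = pb Q <-> (P <-> Q).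
Proof. by rewrite /pb; do 2 case: excluded_middle_informative => ?; split; tauto || discriminate. Qed.

Fixpoint encode (k : nat) (f : nat -> bool) : nat :=
  match k with
  | O => O
  | S k' => (2 * encode k' f + Nat.b2n (f k'))%nat
  end.

Lemma encode_inj k f g : encode k f = encode k g -> forall i, (i < k)%nat -> f i = g i.
Proof.
elim: k => [|k IH] /= e i ik; first by lia.
have [e1 e2] : encode k f = encode k g /\ f k = g k.
  by case: (f k) e; case: (g k) => /= e; split=> //; lia.
have [->//|ik'] : i = k \/ (i < k)%nat by lia.
exact: IH.
Qed.

Lemma encode_ext k f g : (forall i, (i < k)%nat -> f i = g i) -> encode k f = encode k g.
Proof.
elim: k => [|k IH] H //=; rewrite (IH (fun i ik => H i ltac:(lia))) (H k) //; lia.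
Qed.

Section Coordinates.
Variable m : nat.
Local Notation n := (S m).
Local Notation M := (S (S (m + m))).
Local Notation cI := (m + m)%nat.
Local Notation wI := (S (m + m)).
Implicit Types (x y : Rn n) (q : Rn M).

(** For a displacement [w] with [|w| <= 1], the distance of [w - 1] to the even integers is
    [1 - |w|], so the squares of [w] cancel and leave [2 |w| - 1]. *)
Lemma ee_formula x y (s : nat -> R) :
  (forall i, (i < m)%nat -> Rabs (y.[i] - x.[i]) <= 1 / 2 /\ Rabs (s i) <= 1 / 2 /\
     exists k, x.[i] + y.[i] = s i + IZR k) -> Rabs (y.[m] - x.[m]) <= 1 ->
  ee m x y = rsum m (fun i => (y.[i] - x.[i]) ^ 2 - s i ^ 2) + 2 * Rabs (y.[m] - x.[m]) - 1.
Proof.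
move=> H hw; rewrite /ee /De /Do (nd2_small _ hw).
have -> : nd2 (y.[m] - x.[m] - 1) = 1 - Rabs (y.[m] - x.[m]).
  have [h1 h2] := Rabs_bounds _ _ hw.
  have [p|p] := Rle_dec 0 (y.[m] - x.[m]).
    rewrite nd2_small; last by apply: Rabs_le; lra.
    by rewrite Rabs_left1 ?Rabs_pos_eq //; lra.
  rewrite -(nd2_addeven _ 2) // nd2_small; last by apply: Rabs_le; lra.
  by rewrite Rabs_pos_eq ?Rabs_left //; lra.
have -> : rsum m (fun i => nd (y.[i] - x.[i]) ^ 2) = rsum m (fun i => (y.[i] - x.[i]) ^ 2).
  by apply: rsum_ext => i im; have [h _] := H i im; rewrite (nd_small _ h) Rabs_sqr.
have -> : rsum m (fun i => nd (y.[i] + x.[i]) ^ 2) = rsum m (fun i => s i ^ 2).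
  apply: rsum_ext => i im; have [_ [h [k e]]] := H i im.
  by rewrite Rplus_comm e nd_addZ (nd_small _ h) Rabs_sqr.
have -> : rsum m (fun i => (y.[i] - x.[i]) ^ 2 - s i ^ 2) =
    rsum m (fun i => (y.[i] - x.[i]) ^ 2) + (-1) * rsum m (fun i => s i ^ 2).
  by rewrite rsum_scal rsum_plus; apply: rsum_ext => i _; ring.
by ring.
Qed.

(** The interval for sums has length 2 and splits at 1/2 into two unit intervals; this bit remembers
    which one, so that sums can be reduced modulo 1 without loss. *)
Definition kap x y (i : nat) : bool := negb (pb (x.[i] + y.[i] <= 1 / 2)).
Definition b2r (b : bool) : R := if b then 1 else 0.

Definition cz x y : Rn M := mkRn M (fun l =>
  if Nat.ltb l m then y.[l] - x.[l]
  else if Nat.ltb l (m + m) then x.[l - m] + y.[l - m] - b2r (kap x y (l - m))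
  else if Nat.eqb l cI then x.[m] else y.[m] - x.[m]).

Lemma cz_d x y i : (i < m)%nat -> (cz x y).[i] = y.[i] - x.[i].
Proof. by move=> im; rewrite mkRnE; [rewrite (proj2 (Nat.ltb_lt _ _) im) | lia]. Qed.

Lemma cz_s x y i : (i < m)%nat -> (cz x y).[m + i] = x.[i] + y.[i] - b2r (kap x y i).
Proof.
move=> im; rewrite mkRnE; last by lia.
have -> : Nat.ltb (m + i) m = false by apply/Nat.ltb_ge; lia.
have -> : Nat.ltb (m + i) (m + m) = true by apply/Nat.ltb_lt; lia.
by have -> : (m + i - m)%nat = i by lia.
Qed.

Lemma cz_c x y : (cz x y).[cI] = x.[m].
Proof.
rewrite mkRnE; last by lia.
have -> : Nat.ltb cI m = false by apply/Nat.ltb_ge; lia.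
by rewrite Nat.ltb_irrefl Nat.eqb_refl.
Qed.

Lemma cz_w x y : (cz x y).[wI] = y.[m] - x.[m].
Proof.
rewrite mkRnE; last by lia.
have -> : Nat.ltb wI m = false by apply/Nat.ltb_ge; lia.
have -> : Nat.ltb wI (m + m) = false by apply/Nat.ltb_ge; lia.
by have -> : Nat.eqb wI cI = false by apply/Nat.eqb_neq; lia.
Qed.

Lemma Rn_extM q q' : (forall i, (i < m)%nat -> q.[i] = q'.[i] /\ q.[m + i] = q'.[m + i]) ->
  q.[cI] = q'.[cI] -> q.[wI] = q'.[wI] -> q = q'.
Proof.
move=> H Hc Hw; apply: Rn_ext => l lM.
have [lm|[lm|[->|->]]] : (l < m)%nat \/ (m <= l < m + m)%nat \/ l = cI \/ l = wI by lia.
- by have [] := H l lm.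
- by have [_] := H (l - m)%nat ltac:(lia); have -> : (m + (l - m))%nat = l by lia.
- by [].
- by [].
Qed.

Lemma low_cases (Q : nat -> Prop) : (forall i, (i < m)%nat -> Q i /\ Q (m + i)%nat) ->
  forall l, (l < m + m)%nat -> Q l.
Proof.
move=> H l lm; have [h|h] : (l < m)%nat \/ (m <= l)%nat by lia.
  by have [] := H l h.
by have [_] := H (l - m)%nat ltac:(lia); have -> : (m + (l - m))%nat = l by lia.
Qed.

Lemma kap_cases x y i : (kap x y i = false /\ x.[i] + y.[i] <= 1 / 2) \/
  (kap x y i = true /\ 1 / 2 < x.[i] + y.[i]).
Proof.
rewrite /kap /pb; case: excluded_middle_informative => h /=; first by left.
by right; split=> //; lra.
Qed.

Lemma cz_bounds x y : fund m x y -> forall l, (l < m + m)%nat -> - (1 / 2) < (cz x y).[l] <= 1 / 2.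
Proof.
move=> [_ [d [s _]]]; apply: low_cases => i im; rewrite cz_d // cz_s //.
split; first exact: d.
by have := s i im; case: (kap_cases x y i) => -[-> h] /=; lra.
Qed.

Lemma excess_cz x y : fund m x y -> excess m (cz x y) = ee m x y.
Proof.
move=> F; have B := cz_bounds x y F; have [_ [_ [_ [w _]]]] := F.
rewrite (ee_formula x y (fun i => (cz x y).[m + i])).
- rewrite /excess cz_w /quad; congr (_ + _ - _).
  by apply: rsum_ext => i im; rewrite (cz_d x y i im).
- move=> i im; split; first by rewrite -cz_d //; have := B i ltac:(lia) => ?; apply: Rabs_le; lra.
  split; first by have := B (m + i)%nat ltac:(lia) => ?; apply: Rabs_le; lra.
  rewrite cz_s //; exists (if kap x y i then 1 else 0)%Z; case: (kap x y i) => /=; ring.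
- by apply: Rabs_le; lra.
Qed.

Lemma fundz_cz x y : fund m x y -> fundz m (cz x y).
Proof.
move=> F; rewrite /fundz excess_cz // cz_c cz_w.
by split; [case: F | split; [apply: cz_bounds | case: F => _ [_ [_]]]].
Qed.

Lemma halfodd_half t : - (1 / 2) < t <= 1 / 2 -> (halfodd t <-> t = 1 / 2).
Proof.
move=> h; split=> [[k e]|->]; last by exists 0%Z; lra.
have k0 : k = 0%Z by apply: nonint_small; lra.
by rewrite k0 in e; lra.
Qed.

Lemma integral2_half t : - (1 / 2) < t <= 1 / 2 -> (integral (2 * t) <-> t = 0 \/ t = 1 / 2).
Proof.
move=> h; split=> [[k e]|[->|->]]; last 2 first.
- by exists 0%Z; lra.
- by exists 1%Z; lra.
have l : IZR (-1) < IZR k by lra.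
have u : IZR k < IZR 2 by lra.
move: l u => /lt_IZR l /lt_IZR u.
have [k0|k0] : k = 0%Z \/ k = 1%Z by lia.
  by left; rewrite k0 in e; lra.
by right; rewrite k0 in e; lra.
Qed.

Lemma conditions_cz x y : fund m x y ->
  (cC m x <-> (cz x y).[cI] = 0) /\ (cH m x y <-> excess m (cz x y) = 0) /\
  (cW m x y <-> (cz x y).[wI] = 1) /\ (cV m x y <-> vertex m (cz x y)) /\
  (forall i, (i < m)%nat -> (cD m x y i <-> (cz x y).[i] = 1 / 2) /\
     (cS m x y i <-> (cz x y).[m + i] = 1 / 2)).
Proof.
move=> F; have B := cz_bounds x y F; have E := excess_cz x y F.
have [c [d [s [w [e ew]]]]] := F.
have iC : cC m x <-> (cz x y).[cI] = 0.
  rewrite cz_c; split=> [[k z]|z]; last by exists 0%Z.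
  have k0 : k = 0%Z by apply: nonint_small; lra.
  by rewrite z k0.
have iH : cH m x y <-> excess m (cz x y) = 0 by rewrite E.
have iW : cW m x y <-> (cz x y).[wI] = 1.
  rewrite cz_w; split=> [[[k z] z0]|z]; last by split; [exists 1%Z | lra].
  have l : IZR (-1) < IZR k by lra.
  have u : IZR k < IZR 2 by lra.
  move: l u => /lt_IZR l /lt_IZR u.
  have [k0|k1] : k = 0%Z \/ k = 1%Z by lia.
    have w0 : y.[m] - x.[m] = 0 by rewrite z k0.
    by have := ew (z0 w0); lra.
  by rewrite z k1.
have sk i : (i < m)%nat -> related (x.[i] + y.[i]) ((cz x y).[m + i]).
  move=> im; rewrite cz_s //; exists (if kap x y i then -1 else 0)%Z; left.
  by case: (kap x y i) => /=; ring.
have iS i : (i < m)%nat -> cS m x y i <-> (cz x y).[m + i] = 1 / 2.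
  move=> im; rewrite -halfodd_half; last by apply: B; lia.
  by apply: iff_related (sk i im); apply: related_halfodd.
have iD i : (i < m)%nat -> cD m x y i <-> (cz x y).[i] = 1 / 2.
  by move=> im; rewrite -halfodd_half ?cz_d //; apply: d.
split=> //; split=> //; split=> //; split; last by move=> i im; split; [apply: iD | apply: iS].
have I2 i : (i < m)%nat -> (integral (2 * (y.[i] - x.[i])) /\ integral (2 * (x.[i] + y.[i]))) <->
    ((cz x y).[i] = 0 \/ (cz x y).[i] = 1 / 2) /\ ((cz x y).[m + i] = 0 \/ (cz x y).[m + i] = 1 / 2).
  move=> im; rewrite -!integral2_half; try by apply: B; lia.
  rewrite -cz_d //.
  have := iff_related (fun t => integral (2 * t)) _ _ related_integral2 (sk i im); tauto.
rewrite /cV /vertex iH iW; split=> -[h1 [h2 h3]]; (split; [done | split; [done |]]).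
  by apply: low_cases => i im; apply/I2/h3.
by move=> i im; apply/I2 => //; split; apply: h3; lia.
Qed.

Definition cntz q : nat :=
  (bn (q.[cI] = 0%R) + nsum m (fun i => bn (q.[i] = (1 / 2)%R) + bn (q.[m + i] = (1 / 2)%R)) +
   bn (excess m q = 0%R) + bn (q.[wI] = 1%R) + bn (vertex m q))%nat.

Lemma cnt_cz x y : fund m x y -> cnt m x y = cntz (cz x y).
Proof.
move=> F; have [iC [iH [iW [iV iI]]]] := conditions_cz x y F.
rewrite /cnt /cntz (bn_iff _ _ iC) (bn_iff _ _ iH) (bn_iff _ _ iW) (bn_iff _ _ iV).
do 3 congr (_ + _)%nat; congr (_ + _)%nat; apply: nsum_ext => i im.
by have [iD iS] := iI i im; rewrite (bn_iff _ _ iD) (bn_iff _ _ iS).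
Qed.

(** There are [2 * n + 2] conditions. Without the tie, or with displacement below 1, the vertex
    condition fails along with it. If both hold, then [quad = -1]: not all horizontal coordinates
    are 1/2, since differences and sums would cancel, and at a vertex four more sums than
    differences equal 1/2. *)
Lemma cntz_bound q : fundz m q -> (cntz q <= 2 * n)%nat.
Proof.
move=> [c [z [w [e ew]]]]; rewrite /cntz.
set T := nsum m _.
have T2 : (T <= m * 2)%nat.
  rewrite -nsum_const; apply: nsum_le => i im.
  by have := bn_le1 (q.[i] = 1 / 2); have := bn_le1 (q.[m + i] = 1 / 2); lia.
have b1 := bn_le1 (q.[cI] = 0); have b2 := bn_le1 (excess m q = 0).
have b3 := bn_le1 (q.[wI] = 1); have b4 := bn_le1 (vertex m q).
have [eH|nH] := classic (excess m q = 0); last first.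
  have nV : ~ vertex m q by move=> [h _].
  by rewrite (bn_false _ nH) (bn_false _ nV); lia.
have [eW|nW] := classic (q.[wI] = 1); last first.
  have nV : ~ vertex m q by move=> [_ [h _]].
  by rewrite (bn_false _ nW) (bn_false _ nV); lia.
have Q : quad m (proj1_sig q) = -1 by rewrite /excess eW Rabs_R1 in eH; lra.
have [V|nV] := classic (vertex m q).
  have [_ [_ v]] := V.
  suff : (T + 4 <= m * 2)%nat by lia.
  apply: INR_le; rewrite plus_INR mult_INR nsum_INR.
  (* A coordinate [t] in [{0, 1/2}] satisfies [t ^ 2 = t / 2], which gives the termwise bound;
     summed against [quad = -1] it yields [T <= 2 m - 4]. *)
  have := rsum_le m (fun i => INR (bn (q.[i] = 1 / 2) + bn (q.[m + i] = 1 / 2)))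
     (fun i => 2 + 4 * (q.[i] ^ 2 - q.[m + i] ^ 2)).
  rewrite -rsum_plus -rsum_scal -/(quad m (proj1_sig q)) Q rsum_const => H.
  rewrite /=; suff : rsum m (fun i => INR (bn (q.[i] = 1 / 2) + bn (q.[m + i] = 1 / 2))) <= INR m * 2 + 4 * -1 by lra.
  apply: H => i im; rewrite plus_INR.
  have half t : t = 0 \/ t = 1 / 2 -> INR (bn (t = 1 / 2)) = 2 * t /\ t ^ 2 = t / 2.
    move=> [->|->]; first by rewrite bn_false /=; [split; field | lra].
    by rewrite bn_true //=; split; field.
  have [h1 h2] := half _ (v i ltac:(lia)); have [h3 h4] := half _ (v (m + i)%nat ltac:(lia)).
  rewrite h1 h3 h2 h4; have := v i ltac:(lia); have := v (m + i)%nat ltac:(lia); lra.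
rewrite (bn_false _ nV).
suff : (T < m * 2)%nat by lia.
have [//|full] : (T < m * 2)%nat \/ (m * 2 <= T)%nat by lia.
rewrite -nsum_const in full.
have all2 := nsum_le_eq m _ _ _ full.
have {}all2 i : (i < m)%nat -> q.[i] = 1 / 2 /\ q.[m + i] = 1 / 2.
  move=> im; have := all2 _ i im.
  rewrite /bn; case: excluded_middle_informative => h1; case: excluded_middle_informative => h2 //= H;
    by have := H (fun j _ => ltac:(do 2 case: excluded_middle_informative => _; lia)).
have : quad m (proj1_sig q) = 0.
  rewrite /quad (rsum_ext _ _ (fun _ => 0)) ?rsum_const; first by ring.
  by move=> i im; have [-> ->] := all2 i im; ring.
by rewrite Q; lra.
Qed.

(** Together with [ly], the inverse of [cz] once the bits [k] are given. *)
Definition lx (k : nat -> bool) q : Rn n := mkRn n (fun i =>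
  if Nat.ltb i m then (q.[m + i] + b2r (k i) - q.[i]) / 2 else q.[cI]).
Definition ly (k : nat -> bool) q : Rn n := mkRn n (fun i =>
  if Nat.ltb i m then (q.[m + i] + b2r (k i) + q.[i]) / 2 else q.[cI] + q.[wI]).

Lemma lift_fund k q : fundz m q -> fund m (lx k q) (ly k q) /\
  cz (lx k q) (ly k q) = q /\ forall i, (i < m)%nat -> kap (lx k q) (ly k q) i = k i.
Proof.
move=> [c [z [w [e ew]]]].
have xi i : (i < m)%nat -> (lx k q).[i] = (q.[m + i] + b2r (k i) - q.[i]) / 2.
  by move=> im; rewrite mkRnE; [rewrite (proj2 (Nat.ltb_lt _ _) im) | lia].
have yi i : (i < m)%nat -> (ly k q).[i] = (q.[m + i] + b2r (k i) + q.[i]) / 2.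
  by move=> im; rewrite mkRnE; [rewrite (proj2 (Nat.ltb_lt _ _) im) | lia].
have xm : (lx k q).[m] = q.[cI] by rewrite mkRnE; [rewrite Nat.ltb_irrefl | lia].
have ym : (ly k q).[m] = q.[cI] + q.[wI] by rewrite mkRnE; [rewrite Nat.ltb_irrefl | lia].
have di i : (i < m)%nat -> (ly k q).[i] - (lx k q).[i] = q.[i].
  by move=> im; rewrite xi // yi //; field.
have si i : (i < m)%nat -> (lx k q).[i] + (ly k q).[i] = q.[m + i] + b2r (k i).
  by move=> im; rewrite xi // yi //; field.
have wm : (ly k q).[m] - (lx k q).[m] = q.[wI] by rewrite xm ym; ring.
have E : ee m (lx k q) (ly k q) = excess m q.
  rewrite (ee_formula _ _ (fun i => q.[m + i])).
  - rewrite wm /excess /quad; congr (_ + _ - _).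
    by apply: rsum_ext => i im; rewrite di.
  - move=> i im; rewrite di // si //.
    have z1 := z i ltac:(lia); have z2 := z (m + i)%nat ltac:(lia).
    split; first by apply: Rabs_le; lra.
    split; first by apply: Rabs_le; lra.
    by exists (if k i then 1 else 0)%Z; case: (k i).
  - by rewrite wm; apply: Rabs_le; lra.
have ki i : (i < m)%nat -> kap (lx k q) (ly k q) i = k i.
  move=> im; have z2 := z (m + i)%nat ltac:(lia).
  case: (kap_cases (lx k q) (ly k q) i) => -[->]; rewrite si //; case: (k i) => //=; lra.
split; last first.
  split=> //; apply: Rn_extM; [|by rewrite cz_c|by rewrite cz_w].
  by move=> i im; rewrite cz_d // cz_s // ki // di // si //; split=> //; ring.
split; first by rewrite xm.
split; first by move=> i im; rewrite di //; apply: z; lia.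
split.
  move=> i im; rewrite si //; have z2 := z (m + i)%nat ltac:(lia).
  by case: (k i) => /=; lra.
by rewrite wm E.
Qed.

Definition cf p : Rn M := cz (Fx m p) (Fy m p).

Definition bits p (l : nat) : bool :=
  if Nat.ltb l (m + m) then pb ((cf p).[l] = 1 / 2)
  else match (l - (m + m))%nat with
       | 0%nat => pb ((cf p).[cI] = 0)
       | 1%nat => pb ((cf p).[wI] = 1)
       | 2%nat => pb (excess m (cf p) = 0)
       | 3%nat => pb (vertex m (cf p))
       | S (S (S (S i))) => kap (Fx m p) (Fy m p) i
       end.

Definition code p : nat := encode (m + m + 4 + m) (bits p).

Lemma bits_low p l : (l < m + m)%nat -> bits p l = pb ((cf p).[l] = 1 / 2).
Proof. by move=> lm; rewrite /bits (proj2 (Nat.ltb_lt _ _) lm). Qed.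

Lemma bits_high p i : bits p (m + m + i) = match i with
  | 0%nat => pb ((cf p).[cI] = 0)
  | 1%nat => pb ((cf p).[wI] = 1)
  | 2%nat => pb (excess m (cf p) = 0)
  | 3%nat => pb (vertex m (cf p))
  | S (S (S (S i))) => kap (Fx m p) (Fy m p) i
  end.
Proof.
rewrite /bits; have -> : Nat.ltb (m + m + i) (m + m) = false by apply/Nat.ltb_ge; lia.
by have -> : (m + m + i - (m + m))%nat = i by lia.
Qed.

Definition same_type p p' : Prop :=
  (forall l, (l < m + m)%nat -> ((cf p).[l] = 1 / 2 <-> (cf p').[l] = 1 / 2)) /\
  ((cf p).[cI] = 0 <-> (cf p').[cI] = 0) /\ ((cf p).[wI] = 1 <-> (cf p').[wI] = 1) /\
  (excess m (cf p) = 0 <-> excess m (cf p') = 0) /\ (vertex m (cf p) <-> vertex m (cf p')) /\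
  (forall i, (i < m)%nat -> kap (Fx m p) (Fy m p) i = kap (Fx m p') (Fy m p') i).

Lemma code_eq p p' : code p = code p' <-> same_type p p'.
Proof.
split=> [/encode_inj H|[hl [hc [hw [hx [hv hk]]]]]].
  split; first by move=> l lm; apply/pb_iff; rewrite -!bits_low //; apply: H; lia.
  have Hh i : (i < 4 + m)%nat -> bits p (m + m + i) = bits p' (m + m + i) by move=> im; apply: H; lia.
  split; first by apply/pb_iff; have := Hh 0%nat ltac:(lia); rewrite !bits_high.
  split; first by apply/pb_iff; have := Hh 1%nat ltac:(lia); rewrite !bits_high.
  split; first by apply/pb_iff; have := Hh 2%nat ltac:(lia); rewrite !bits_high.
  split; first by apply/pb_iff; have := Hh 3%nat ltac:(lia); rewrite !bits_high.
  by move=> i im; have := Hh (4 + i)%nat ltac:(lia); rewrite !bits_high.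
apply: encode_ext => l lm; have [h|h] : (l < m + m)%nat \/ (m + m <= l)%nat by lia.
  by rewrite !bits_low //; apply/pb_iff/hl.
have -> : l = (m + m + (l - (m + m)))%nat by lia.
rewrite !bits_high; have : (l - (m + m) < 4 + m)%nat by lia.
case: (l - (m + m))%nat => [|[|[|[|i]]]] im; try by apply/pb_iff.
by apply: hk; lia.
Qed.

Lemma same_type_level p p' : same_type p p' -> level m p = level m p'.
Proof.
move=> [hl [hc [hw [hx [hv _]]]]].
rewrite /level (cnt_cz _ _ (proj2 (F_spec m p))) (cnt_cz _ _ (proj2 (F_spec m p'))).
rewrite -/(cf p) -/(cf p') /cntz (bn_iff _ _ hc) (bn_iff _ _ hw) (bn_iff _ _ hx) (bn_iff _ _ hv).
do 3 congr (_ + _)%nat; congr (_ + _)%nat; apply: nsum_ext => i im.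
by rewrite (bn_iff _ _ (hl i ltac:(lia))) (bn_iff _ _ (hl (m + i)%nat ltac:(lia))).
Qed.

Lemma level_bound p : (level m p <= 2 * n)%nat.
Proof.
have [_ F] := F_spec m p; rewrite /level cnt_cz //; apply: cntz_bound; exact: fundz_cz.
Qed.

Lemma cf_local p e : 0 < e -> exists delta, 0 < delta /\ forall p', level m p' = level m p ->
  dprod (dK n) p p' < delta -> code p' = code p /\
  forall l, (l < M)%nat -> Rabs ((cf p).[l] - (cf p').[l]) <= 2 * e.
Proof.
move=> e0; have [delta [d0 H]] := F_local m p e e0.
exists delta; split=> // p' lev close.
have [nx [ny [iC [iH [iW [iV iI]]]]]] := H p' lev close.
have [_ F] := F_spec m p; have [_ F'] := F_spec m p'.
have [jC [jH [jW [jV jI]]]] := conditions_cz _ _ F.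
have [jC' [jH' [jW' [jV' jI']]]] := conditions_cz _ _ F'.
rewrite -!/(cf p) in jC jH jW jV jI; rewrite -!/(cf p') in jC' jH' jW' jV' jI'.
have kk i : (i < m)%nat -> kap (Fx m p) (Fy m p) i = kap (Fx m p') (Fy m p') i.
  by move=> im; have [_ [_ h]] := iI i im; congr negb; apply/pb_iff.
split.
  symmetry; apply/code_eq; split.
    apply: low_cases => i im; have [iD [iS _]] := iI i im.
    by have [a b] := jI i im; have [a' b'] := jI' i im; tauto.
  by split; [tauto | split; [tauto | split; [tauto | split; [tauto |]]]].
have hxm := Rabs_bounds _ _ (nx m ltac:(lia)); have hym := Rabs_bounds _ _ (ny m ltac:(lia)).
move=> l lM; have [lm|[->|->]] : (l < m + m)%nat \/ l = cI \/ l = wI by lia.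
- move: l lm {lM}; apply: low_cases => i im; rewrite /cf !(cz_d _ _ i im) !(cz_s _ _ i im) kk //.
  have := Rabs_bounds _ _ (nx i ltac:(lia)); have := Rabs_bounds _ _ (ny i ltac:(lia)).
  by move=> ? ?; split; apply: Rabs_le; lra.
- by rewrite /cf !cz_c; apply: Rabs_le; lra.
- by rewrite /cf !cz_w; apply: Rabs_le; lra.
Qed.

Lemma F_of_cf p : Fx m p = lx (kap (Fx m p) (Fy m p)) (cf p) /\ Fy m p = ly (kap (Fx m p) (Fy m p)) (cf p).
Proof.
split; apply: Rn_extS => [i im|]; rewrite mkRnE; try lia.
- by rewrite (proj2 (Nat.ltb_lt _ _) im) /cf (cz_d _ _ i im) (cz_s _ _ i im); field.
- by rewrite Nat.ltb_irrefl /cf cz_c.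
- by rewrite (proj2 (Nat.ltb_lt _ _) im) /cf (cz_d _ _ i im) (cz_s _ _ i im); field.
- by rewrite Nat.ltb_irrefl /cf cz_c cz_w; ring.
Qed.

Lemma lift_near k k' q q' e : (forall i, (i < m)%nat -> k i = k' i) ->
  (forall l, (l < M)%nat -> Rabs (q.[l] - q'.[l]) <= e) ->
  near m (2 * e) (lx k q) (lx k' q') /\ near m (2 * e) (ly k q) (ly k' q').
Proof.
move=> kk H.
have hc := Rabs_bounds _ _ (H cI ltac:(lia)); have hw := Rabs_bounds _ _ (H wI ltac:(lia)).
split=> i iN; rewrite !mkRnE //; case: Nat.ltb_spec => h; apply: Rabs_le; try lra.
- have h1 := Rabs_bounds _ _ (H i ltac:(lia)); have h2 := Rabs_bounds _ _ (H (m + i)%nat ltac:(lia)).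
  by rewrite kk //; lra.
- have h1 := Rabs_bounds _ _ (H i ltac:(lia)); have h2 := Rabs_bounds _ _ (H (m + i)%nat ltac:(lia)).
  by rewrite kk //; lra.
Qed.

Definition piece (j k : nat) q : Prop := exists p, level m p = j /\ code p = k /\ cf p = q.

(** Every point of a stratum lifts to a pair with the prescribed bits, and the type determines the
    level; so a non-empty piece is a whole stratum. *)
Lemma piece_retract j k : neighborhood_retract M (piece j k).
Proof.
have [[p0 [l0 c0]]|none] := classic (exists p, level m p = j /\ code p = k); last first.
  by apply: neighborhood_retract_empty => q [p [h1 [h2 _]]]; apply: none; exists p.
apply: (neighborhood_retract_ext _ (stratum m (fun l => pb ((cf p0).[l] = 1 / 2))
  (pb ((cf p0).[cI] = 0)) (pb ((cf p0).[wI] = 1)) (pb (excess m (cf p0) = 0))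
  (pb (vertex m (cf p0))))); last exact: stratum_neighborhood_retract.
move=> q; split.
  move=> [F [hl [hc [hw [hx hv]]]]].
  have [F' [eq kq]] := lift_fund (kap (Fx m p0) (Fy m p0)) q F.
  pose p := (proj m (lx (kap (Fx m p0) (Fy m p0)) q), proj m (ly (kap (Fx m p0) (Fy m p0)) q)).
  have [ex ey] := F_unique m _ _ F'; rewrite -/p in ex ey.
  have ecf : cf p = q by rewrite /cf ex ey.
  have st : same_type p p0.
    rewrite /same_type ecf ex ey; split; first by move=> l lm; rewrite hl // -pbP.
    by rewrite hc hw hx hv -!pbP.
  exists p; split; first by rewrite (same_type_level _ _ st).
  by split=> //; rewrite -c0; apply/code_eq.
move=> [p [lp [cp <-]]]; rewrite -c0 in cp; move/code_eq: cp => [hl [hc [hw [hx [hv _]]]]].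
split; first by apply: fundz_cz; have [] := F_spec m p.
split; first by move=> l lm; rewrite -pbP; apply: hl.
by rewrite -!pbP.
Qed.

(** The code as an extra coordinate keeps different pieces at distance at least 1, so that their
    retractions can be used side by side. *)
Definition embed p : Rn (S M) := mkRn (S M) (fun l => if Nat.ltb l M then (cf p).[l] else INR (code p)).
Definition prefix (z : Rn (S M)) : Rn M := mkRn M (fun l => z.[l]).

Lemma embed_low p l : (l < M)%nat -> (embed p).[l] = (cf p).[l].
Proof. by move=> lM; rewrite mkRnE; [rewrite (proj2 (Nat.ltb_lt _ _) lM) | lia]. Qed.

Lemma embed_top p : (embed p).[M] = INR (code p).
Proof. by rewrite mkRnE; [rewrite Nat.ltb_irrefl | lia]. Qed.

Lemma prefix_embed p : prefix (embed p) = cf p.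
Proof. by apply: Rn_ext => l lM; rewrite mkRnE // embed_low. Qed.

Lemma eucl_prefix (z z' : Rn (S M)) : eucl M (prefix z) (prefix z') <= eucl (S M) z z'.
Proof.
apply: sqrt_le_1_alt; rewrite !sumsq_rsum.
rewrite (rsum_ext M _ (fun i => (z.[i] - z'.[i]) ^ 2)).
  rewrite -[rsum (S M) _]/(rsum M (fun i => (z.[i] - z'.[i]) ^ 2) + (z.[M] - z'.[M]) ^ 2).
  by have := pow2_ge_0 (z.[M] - z'.[M]); lra.
by move=> i iM; rewrite !mkRnE.
Qed.

Lemma INR_close_eq (k k' : nat) : Rabs (INR k - INR k') < 1 -> k = k'.
Proof.
rewrite !INR_IZR_INZ -minus_IZR => /Rabs_def2 [h1 h2].
have := nonint_small (Z.of_nat k - Z.of_nat k') h2 h1; lia.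
Qed.

Lemma level_ENR j : ENR (dprod (dK n)) (fun p => level m p = j).
Proof.
have ex k : exists Ur : (Rn M -> Prop) * (Rn M -> Rn M),
    (forall q, fst Ur q -> eventually_near M q (fst Ur)) /\
    (forall q, piece j k q -> fst Ur q) /\
    (forall q i, fst Ur q -> (i < M)%nat -> ctn M (fun z => (snd Ur z).[i]) q) /\
    (forall q, fst Ur q -> piece j k (snd Ur q)) /\
    (forall q, piece j k q -> snd Ur q = q).
  by have [U [r h]] := piece_retract j k; exists (U, r).
pose U k := fst (proj1_sig (constructive_indefinite_description _ (ex k))).
pose r k := snd (proj1_sig (constructive_indefinite_description _ (ex k))).
have UR k := proj2_sig (constructive_indefinite_description _ (ex k)).
(* Open slabs of half-width 1/2 around the codes are disjoint. Outside them [kz] takes an arbitrary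
   value, but [V] avoids those points. *)
pose near_code (z : Rn (S M)) k := Rabs (z.[M] - INR k) < 1 / 2.
have codeu z k k' : near_code z k -> near_code z k' -> k = k'.
  move=> /Rabs_def2 h /Rabs_def2 h'; apply: INR_close_eq; apply: Rabs_def1; lra.
pose V z := exists k, near_code z k /\ U k (prefix z).
pose kz z : nat := epsilon (inhabits 0%nat) (near_code z).
have kzE z k : near_code z k -> kz z = k.
  move=> h; apply: (codeu z) => //; apply: (epsilon_spec (inhabits 0%nat) (near_code z)); by exists k.
pose rr z : Rn (S M) := mkRn (S M) (fun l => if Nat.ltb l M then (r (kz z) (prefix z)).[l] else INR (kz z)).
have rr_low z l : (l < M)%nat -> (rr z).[l] = (r (kz z) (prefix z)).[l].
  by move=> lM; rewrite mkRnE; [rewrite (proj2 (Nat.ltb_lt _ _) lM) | lia].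
have rr_top z : (rr z).[M] = INR (kz z).
  by rewrite mkRnE; [rewrite Nat.ltb_irrefl | lia].
have split_M (Q : nat -> Prop) : (forall l, (l < M)%nat -> Q l) -> Q M -> forall l, (l < S M)%nat -> Q l.
  move=> h1 h2 l lM; have [->//|h] : l = M \/ (l < M)%nat by lia.
  exact: h1.
have MN : 0 < INR (S M) by apply: lt_0_INR; lia.
have rr_embed p : level m p = j -> V (embed p) /\ rr (embed p) = embed p.
  move=> lp; have nc : near_code (embed p) (code p).
    by rewrite /near_code embed_top Rminus_diag Rabs_R0; lra.
  have [_ [h2 [_ [_ h5]]]] := UR (code p).
  have pc : piece j (code p) (cf p) by exists p.
  split; first by exists (code p); split=> //; rewrite prefix_embed; apply: h2.
  apply: Rn_ext; apply: split_M => [l lM|]; last by rewrite rr_top embed_top (kzE _ _ nc).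
  by rewrite rr_low // embed_low // (kzE _ _ nc) prefix_embed /r h5.
exists (S M), embed, V, rr; split.
  move=> p lp e e0.
  have e'0 : 0 < e / (4 * INR (S M)) by apply: Rdiv_lt_0_compat; lra.
  have [delta [d0 H]] := cf_local p _ e'0; exists delta; split=> // p' lp' close.
  have [cc hh] := H p' ltac:(by rewrite lp lp') close.
  have le : eucl (S M) (embed p) (embed p') <= INR (S M) * (2 * (e / (4 * INR (S M)))).
    apply: eucl_le_coord; first by lra.
    apply: split_M => [l lM|]; first by rewrite !embed_low //; apply: hh.
    by rewrite !embed_top cc Rminus_diag Rabs_R0; lra.
  apply: Rle_lt_trans le _.
  have -> : INR (S M) * (2 * (e / (4 * INR (S M)))) = e / 2 by field; lra.
  by lra.
have lift_eq p : p = (proj m (lx (kap (Fx m p) (Fy m p)) (cf p)), proj m (ly (kap (Fx m p) (Fy m p)) (cf p))).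
  by have [e _] := F_spec m p; have [<- <-] := F_of_cf p.
split.
  move=> p p' lp lp' e.
  have ecf : cf p = cf p' by rewrite -!prefix_embed e.
  have ec : code p = code p'.
    by apply: INR_eq; rewrite -!embed_top e.
  move/code_eq: ec => [_ [_ [_ [_ [_ kk]]]]].
  rewrite (lift_eq p) (lift_eq p') -ecf; move: (cf p) => q.
  by congr (proj m _, proj m _); apply: Rn_ext => i iN; rewrite !mkRnE //; case: Nat.ltb_spec => // im; rewrite kk.
split.
  move=> p lp e e0; have Nn : 0 < INR n by apply: lt_0_INR; lia.
  have e'0 : 0 < e / (4 * INR n) by apply: Rdiv_lt_0_compat; lra.
  exists (Rmin 1 (e / (4 * INR n))); split; first by apply: Rmin_glb_lt => //; lra.
  move=> p' lp' close.
  have c1 : eucl (S M) (embed p) (embed p') < 1 by apply: Rlt_le_trans close (Rmin_l _ _).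
  have c2 : eucl (S M) (embed p) (embed p') < e / (4 * INR n) by apply: Rlt_le_trans close (Rmin_r _ _).
  have ec : code p = code p'.
    apply: INR_close_eq; rewrite -!embed_top.
    by apply: Rle_lt_trans c1; apply: eucl_coord; lia.
  move/code_eq: ec => [_ [_ [_ [_ [_ kk]]]]].
  have hh l : (l < M)%nat -> Rabs ((cf p).[l] - (cf p').[l]) <= e / (4 * INR n).
    move=> lM; rewrite -!embed_low //; apply: Rle_trans (Rlt_le _ _ c2).
    by apply: eucl_coord; lia.
  have [nx ny] := lift_near _ _ _ _ _ kk hh.
  have fin : INR n * (2 * (e / (4 * INR n))) < e.
    have -> : INR n * (2 * (e / (4 * INR n))) = e / 2 by field; lra.
    by lra.
  rewrite (lift_eq p) (lift_eq p') /dprod /=; apply: Rmax_lub_lt; apply: Rle_lt_trans fin;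
    apply: Rle_trans (dK_le_eucl _ _ _) _; apply: eucl_le_coord => //; lra.
split.
  move=> z [k [nc Uz]]; have [h1 _] := UR k; have [d [d0 hd]] := h1 _ Uz.
  exists (Rmin d (1 / 2 - Rabs (z.[M] - INR k))); split.
    by apply: Rmin_glb_lt => //; rewrite /near_code in nc; lra.
  move=> z' hz'; exists k; split.
    have := Rlt_le_trans _ _ _ hz' (Rmin_r _ _).
    have := eucl_coord (S M) z z' M ltac:(lia); rewrite Rabs_minus_sym /near_code.
    have := Rabs_triang (z'.[M] - z.[M]) (z.[M] - INR k).
    have -> : z'.[M] - z.[M] + (z.[M] - INR k) = z'.[M] - INR k by ring.
    by lra.
  apply: hd; apply: Rle_lt_trans (eucl_prefix z z') _.
  exact: Rlt_le_trans hz' (Rmin_l _ _).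
split; first by move=> p /rr_embed[].
split.
  move=> z [k [nc Uz]] e e0.
  have [_ [_ [h3 _]]] := UR k.
  have e'0 : 0 < e / (2 * INR (S M)) by apply: Rdiv_lt_0_compat; lra.
  have [d [d0 hd]] := ev_forall M (prefix z) M _ (fun i iM => h3 _ i Uz iM _ e'0).
  exists (Rmin d (1 / 2 - Rabs (z.[M] - INR k))); split.
    by apply: Rmin_glb_lt => //; rewrite /near_code in nc; lra.
  move=> z' _ hz'.
  have nc' : near_code z' k.
    have := Rlt_le_trans _ _ _ hz' (Rmin_r _ _).
    have := eucl_coord (S M) z z' M ltac:(lia); rewrite Rabs_minus_sym /near_code.
    have := Rabs_triang (z'.[M] - z.[M]) (z.[M] - INR k).
    have -> : z'.[M] - z.[M] + (z.[M] - INR k) = z'.[M] - INR k by ring.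
    by lra.
  have le : eucl (S M) (rr z) (rr z') <= INR (S M) * (e / (2 * INR (S M))).
    apply: eucl_le_coord; first by lra.
    apply: split_M => [l lM|]; last first.
      by rewrite !rr_top (kzE _ _ nc) (kzE _ _ nc') Rminus_diag Rabs_R0; lra.
    rewrite !rr_low // (kzE _ _ nc) (kzE _ _ nc') Rabs_minus_sym; apply: Rlt_le.
    apply: (hd (prefix z')) => //; apply: Rle_lt_trans (eucl_prefix z z') _.
    exact: Rlt_le_trans hz' (Rmin_l _ _).
  apply: Rle_lt_trans le _.
  have -> : INR (S M) * (e / (2 * INR (S M))) = e / 2 by field; lra.
  by lra.
split; last by move=> p /rr_embed[].
move=> z [k [nc Uz]]; have [_ [_ [_ [h4 _]]]] := UR k.
have [p [lp [cp ep]]] := h4 _ Uz.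
exists p; split=> //; apply: Rn_ext; apply: split_M => [l lM|]; last by rewrite rr_top embed_top (kzE _ _ nc) cp.
by rewrite rr_low // embed_low // ep (kzE _ _ nc).
Qed.

End Coordinates.

Lemma GC_upper_bound m : GC_le (dK (S m)) (2 * S m).
Proof.
exists (fun j p => level m p = j); split.
  by move=> p; exists (level m p); split=> //; apply: level_bound.
split; first by move=> i j p _ _ <- <-.
move=> j _; split; first exact: level_ENR.
exists (fun p => seg m (Fx m p) (Fy m p)); split; last exact: seg_co_continuous.
move=> p _; have [e F] := F_spec m p.
have [h1 [h2 h3]] := seg_min_geodesic m _ _ (fund_almost m _ _ F).
split=> //; rewrite h2 h3; split; first exact: (f_equal fst (eq_sym e)).
exact: (f_equal snd (eq_sym e)).
Qed.

Theorem theorem1p1 : forall n : nat, (2 <= n)%nat -> GC_eq (dK n) (2 * n)%nat.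
Proof.
move=> [|m] n2; first by lia.
by split; [apply: GC_upper_bound | move=> k; apply: GC_lower_bound; lia].
Qed.
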